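(* Let $T:I\to I$ be an interval exchange map of Roth type, with alphabet $\mathcal A$, combinatorial data $(\pi_0,\pi_1)$ and length data $\lambda$. Let $\Phi:I\to\mathbb R$ be a function such that, for every $\alpha\in\mathcal A$, the restriction of $\Phi$ to the interval $j_0(I_\alpha)$ is absolutely continuous and its derivative $\Phi'$ is of bounded variation on $j_0(I_\alpha)$, and such that $\int_I \Phi'(x)\,dx=0$. Then there exist a function $\chi:I\to\mathbb R$ which is constant on each interval $j_0(I_\alpha)$, $\alpha\in\mathcal A$, and a bounded function $\Psi:I\to\mathbb R$ such that $$\Psi-\Psi\circ T=\Phi-\chi .$$
   Context: Interval exchange maps. Let $\mathcal A$ be a finite alphabet with $d\ge2$ elements. Combinatorial data are two bijections $\pi_0,\pi_1:\mathcal A\to\{1,\dots,d\}$, assumed admissible: for every $k\in\{1,\dots,d-1\}$, $\pi_0^{-1}(\{1,\dots,k\})\neq\pi_1^{-1}(\{1,\dots,k\})$. Length data are $\lambda=(\lambda_\alpha)_{\alpha\in\mathcal A}\in(0,\infty)^{\mathcal A}$. Put $\lambda^*=\sum_\alpha\lambda_\alpha$, $I=[0,\lambda^* )$, $I_\alpha=[0,\lambda_\alpha)\times\{\alpha\}$, and for $\varepsilon\in\{0,1\}$ let $j_\varepsilon:\bigsqcup_\alpha I_\alpha\to I$, $j_\varepsilon(x,\alpha)=x+\sum_{\pi_\varepsilon(\beta)<\pi_\varepsilon(\alpha)}\lambda_\beta$. The interval exchange map (i.e.m.) is $T=j_1\circ j_0^{-1}$; it is a translation on each $j_0(I_\alpha)$.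 $T$ has the Keane property if there is no triple $(\alpha,\beta,m)$ with $\alpha,\beta\in\mathcal A$, $\pi_0(\beta)>1$, $m\ge1$ an integer, and $T^m(j_0(0,\alpha))=j_0(0,\beta)$. Rauzy–Veech step. Let $\alpha_0,\alpha_1$ be defined by $\pi_0(\alpha_0)=\pi_1(\alpha_1)=d$. If $\lambda_{\alpha_0}\ne\lambda_{\alpha_1}$ (always true under the Keane property), let $\varepsilon\in\{0,1\}$ with $\lambda_{\alpha_\varepsilon}>\lambda_{\alpha_{1-\varepsilon}}$. The first return map of $T$ to $[0,\lambda^*-\lambda_{\alpha_{1-\varepsilon}})$ is the i.e.m. $\hat T$ on the same alphabet with lengths $\hat\lambda_\alpha=\lambda_\alpha$ ($\alpha\ne\alpha_\varepsilon$), $\hat\lambda_{\alpha_\varepsilon}=\lambda_{\alpha_\varepsilon}-\lambda_{\alpha_{1-\varepsilon}}$, and combinatorial data $\hat\pi_\varepsilon=\pi_\varepsilon$, $\hat\pi_{1-\varepsilon}(\alpha)=\pi_{1-\varepsilon}(\alpha)$ if $\pi_{1-\varepsilon}(\alpha)\le\pi_{1-\varepsilon}(\alpha_\varepsilon)$, $\hat\pi_{1-\varepsilon}(\alpha)=\pi_{1-\varepsilon}(\alpha)+1$ if $\pi_{1-\varepsilon}(\alpha_\varepsilon)<\pi_{1-\varepsilon}(\alpha)<d$, $\hat\pi_{1-\varepsilon}(\alpha)=\pi_{1-\varepsilon}(\alpha_\varepsilon)+1$ if $\pi_{1-\varepsilon}(\alpha)=d$. The step has type $\varepsilon$, name $\alpha_\varepsilon$,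 secondary name $\alpha_{1-\varepsilon}$, and matrix $V=\mathbf I+E_{\alpha_\varepsilon\alpha_{1-\varepsilon}}$ (so $\lambda=V\hat\lambda$). If $T$ has the Keane property so does $\hat T$, so one gets iterates $T^{[0]}=T,T^{[1]},\dots$ with lengths $\lambda^{[n]}$ and matrices $V^{[n]}$, $\lambda^{[n-1]}=V^{[n]}\lambda^{[n]}$; every letter is the name of infinitely many steps. Accelerated algorithm. Let $n(0)=0$ and let $n(k+1)$ be the largest integer such that the steps of indices $n(k)<n\le n(k+1)$ have at most $d-1$ distinct names. Put $Z(k)=V^{[n(k-1)+1]}\cdots V^{[n(k)]}$ ($k\ge1$), $Q(k,l)=Z(k+1)\cdots Z(l)$ for $0\le k\le l$ (identity if $k=l$), $Q(l)=Q(0,l)$, $T^{(k)}=T^{[n(k)]}$, $\lambda^{(k)}=\lambda^{[n(k)]}$. $\|M\|$ denotes the sum of absolute values of the entries of a matrix $M$. For $0\le k\le l$ let $S(k,l):\mathbb R^{\mathcal A}\to\mathbb R^{\mathcal A}$ be the linear map with matrix ${}^tQ(k,l)$, and $S(l)=S(0,l)$. Roth type. $T$ is of Roth type if it has the Keane property and: (a) for every $\varepsilon>0$ there is $C_\varepsilon>0$ with $\|Z(k+1)\|\le C_\varepsilon\|Q(k)\|^\varepsilon$ for all $k\ge0$; (b) with $\Gamma_*=\{v\in\mathbb R^{\mathcal A}:\sum_\alpha\lambda_\alpha v_\alpha=0\}$, there are $\theta>0$, $C>0$ with $\|S(k)|_{\Gamma_*}\|\le C\|Q(k)\|^{1-\theta}$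 for all $k\ge0$; (c) for $k\ge0$ let $\Gamma^{(k)}_s$ be the linear subspace of those $v\in\mathbb R^{\mathcal A}$ for which there are $\sigma>0,C>0$ with $\|S(k,l)v\|\le C\|S(k,l)\|^{-\sigma}\|v\|$ for all $l\ge k$; $S(k,l)$ maps $\Gamma^{(k)}_s$ onto $\Gamma^{(l)}_s$ and induces an isomorphism $S_\flat(k,l):\mathbb R^{\mathcal A}/\Gamma^{(k)}_s\to\mathbb R^{\mathcal A}/\Gamma^{(l)}_s$; the condition is that for every $\varepsilon>0$ there is $C_\varepsilon>0$ with $\|S_\flat(k,l)^{-1}\|\le C_\varepsilon\|Q(l)\|^\varepsilon$ and $\|S(k,l)|_{\Gamma^{(k)}_s}\|\le C_\varepsilon\|Q(l)\|^\varepsilon$ for all $0\le k\le l$. (Norms on $\mathbb R^{\mathcal A}$ and induced operator/quotient norms are any fixed norms.) *)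

(* Defs.v *)
From HB Require Import structures.
From mathcomp Require Import all_boot all_order all_algebra.
From mathcomp Require Import all_classical all_reals all_analysis.
Set Implicit Arguments. Unset Strict Implicit. Unset Printing Implicit Defensive.
Import Order.TTheory GRing.Theory Num.Theory.
Import numFieldNormedType.Exports.
Local Open Scope classical_set_scope.
Local Open Scope ring_scope.

Section IEM.
Context {R : realType} {A : finType}.

(* Combinatorial data pi0, pi1 : A -> {0,...,d-1} (0-based positions:
   paper position p corresponds to p.-1 here) and length data lam. *)
Record iem_data := IemData { pi0 : A -> nat ; pi1 : A -> nat ; lam : A -> R }.

Definition pi_ (D : iem_data) (eps : bool) : A -> nat :=
  if eps then pi1 D else pi0 D.

Definition bij_pos (p : A -> nat) : Prop :=
  (forall a, p a < #|A|)%N /\ (forall k, (k < #|A|)%N -> exists! a, p a = k).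

Definition admissible (p0 p1 : A -> nat) : Prop :=
  forall k : nat, (1 <= k <= #|A|.-1)%N ->
    [set a | (p0 a < k)%N] != [set a | (p1 a < k)%N].

Definition is_iem (D : iem_data) : Prop :=
  [/\ (2 <= #|A|)%N, bij_pos (pi0 D), bij_pos (pi1 D),
      admissible (pi0 D) (pi1 D) & forall a, 0 < lam D a].

Definition start (D : iem_data) (eps : bool) (a : A) : R :=
  \sum_(b | (pi_ D eps b < pi_ D eps a)%N) lam D b.

Definition total (D : iem_data) : R := \sum_a lam D a.

Definition left_end (D : iem_data) (a : A) : R := start D false a.
Definition right_end (D : iem_data) (a : A) : R := start D false a + lam D a.

(* T = j1 o j0^-1 : translation by start1 a - start0 a on j0(I_a)
   (the intervals j0(I_a) are disjoint; T is the identity outside I) *)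
Definition iem_map (D : iem_data) (x : R) : R :=
  x + \sum_a (if (left_end D a <= x) && (x < right_end D a)
              then start D true a - start D false a else 0).

Definition keane (D : iem_data) : Prop :=
  ~ exists (a b : A) (m : nat),
      [/\ (0 < pi0 D b)%N, (1 <= m)%N &
          iter m (iem_map D) (start D false a) = start D false b].

Definition last_letter (p : A -> nat) : option A := [pick a | p a == #|A|.-1].

(* (type eps, name alpha_eps, secondary name alpha_{1-eps}) *)
Definition rv_info (D : iem_data) : option (bool * A * A) :=
  match last_letter (pi0 D), last_letter (pi1 D) with
  | Some a0, Some a1 =>
      if lam D a1 < lam D a0 then Some (false, a0, a1) else Some (true, a1, a0)
  | _, _ => None
  end.

Definition rv_newpi (p : A -> nat) (w : A) : A -> nat := fun a =>
  if (p a <= p w)%N then p a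
  else if (p a < #|A|.-1)%N then (p a).+1 else (p w).+1.

Definition rv_step (D : iem_data) : iem_data :=
  match rv_info D with
  | Some (eps, w, l) =>
      IemData (if eps then rv_newpi (pi0 D) w else pi0 D)
              (if eps then pi1 D else rv_newpi (pi1 D) w)
              (fun a => if a == w then lam D w - lam D l else lam D a)
  | None => D
  end.

Definition rv_data (D : iem_data) (n : nat) : iem_data := iter n rv_step D.

(* name of the step of index n >= 1 (step from T^[n-1] to T^[n]) *)
Definition rv_name (D : iem_data) (n : nat) : option A :=
  omap (fun t => t.1.2) (rv_info (rv_data D n.-1)).

Definition mx := A -> A -> R.
Definition idm : mx := fun a b => (a == b)%:R.
Definition mmul (M N : mx) : mx := fun a c => \sum_b M a b * N b c.
Definition mnorm (M : mx) : R := \sum_a \sum_b `|M a b|.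
Definition trmx_ (M : mx) : mx := fun a b => M b a.

Definition rv_mx (D : iem_data) (n : nat) : mx :=
  match rv_info (rv_data D n.-1) with
  | Some (_, w, l) => fun a b => (a == b)%:R + ((a == w) && (b == l))%:R
  | None => idm
  end.

Fixpoint mprod (D : iem_data) (m j : nat) : mx :=
  match j with
  | 0 => idm
  | j'.+1 => mmul (mprod D m j') (rv_mx D (m + j'.+1))
  end.

Definition names_between (D : iem_data) (m N : nat) : {set A} :=
  [set a | [exists i : 'I_N.+1, (m < i)%N && (rv_name D i == Some a)]].

Definition at_most_dm1_names (D : iem_data) (m N : nat) : Prop :=
  (#|names_between D m N| <= #|A|.-1)%N.

Definition is_largest (P : nat -> Prop) (N : nat) : Prop :=
  P N /\ forall M, P M -> (M <= N)%N.

Definition acc_next (D : iem_data) (m : nat) : nat :=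
  xget 0%N (is_largest (at_most_dm1_names D m)).

Definition acc_time (D : iem_data) (k : nat) : nat := iter k (acc_next D) 0%N.

Definition Zmx (D : iem_data) (k : nat) : mx :=
  mprod D (acc_time D k.-1) (acc_time D k - acc_time D k.-1).

Fixpoint qprod (D : iem_data) (k j : nat) : mx :=
  match j with
  | 0 => idm
  | j'.+1 => mmul (qprod D k j') (Zmx D (k + j'.+1))
  end.

Definition Qmx (D : iem_data) (k l : nat) : mx := qprod D k (l - k).

Definition vnorm (v : A -> R) : R := \sum_a `|v a|.

Definition Smap (D : iem_data) (k l : nat) (v : A -> R) : A -> R :=
  fun a => \sum_b trmx_ (Qmx D k l) a b * v b.

Definition Snorm (D : iem_data) (k l : nat) : R := mnorm (trmx_ (Qmx D k l)).

Definition Gamma_star (D : iem_data) : set (A -> R) :=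
  [set v | \sum_a lam D a * v a = 0].

Definition Gamma_s (D : iem_data) (k : nat) : set (A -> R) :=
  [set v | exists2 sigma : R, 0 < sigma &
           exists2 C : R, 0 < C &
           forall l, (k <= l)%N ->
             vnorm (Smap D k l v) <= C * (Snorm D k l) `^ (- sigma) * vnorm v].

Definition qnorm (G : set (A -> R)) (v : A -> R) : R :=
  inf [set vnorm (fun a => v a - g a) | g in G].

Definition roth_type (D : iem_data) : Prop :=
  [/\ keane D,
   (forall eps : R, 0 < eps -> exists2 C : R, 0 < C &
      forall k, mnorm (Zmx D k.+1) <= C * (mnorm (Qmx D 0 k)) `^ eps),
   (exists2 theta : R, 0 < theta & exists2 C : R, 0 < C &
      forall k (v : A -> R), Gamma_star D v ->
        vnorm (Smap D 0 k v) <= C * (mnorm (Qmx D 0 k)) `^ (1 - theta) * vnorm v) &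
   (forall eps : R, 0 < eps -> exists2 C : R, 0 < C &
      forall k l, (k <= l)%N ->
        (* || S_flat(k,l)^-1 || <= C ||Q(l)||^eps ; S_flat(k,l) maps [v]_k to [S(k,l) v]_l *)
        (forall v : A -> R,
           qnorm (Gamma_s D k) v
             <= C * (mnorm (Qmx D 0 l)) `^ eps * qnorm (Gamma_s D l) (Smap D k l v)) /\
        (forall v : A -> R, Gamma_s D k v ->
           vnorm (Smap D k l v) <= C * (mnorm (Qmx D 0 l)) `^ eps * vnorm v))].

Definition abs_cont_on (a b : R) (f : R -> R) : Prop :=
  forall e : R, 0 < e -> exists2 delta : R, 0 < delta &
    forall (n : nat) (s t : nat -> R),
      (forall i, (i < n)%N -> a <= s i /\ s i <= t i /\ t i < b) ->
      (forall i j, (i < n)%N -> (j < n)%N -> i <> j -> t i <= s j \/ t j <= s i) ->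
      \sum_(i < n) (t i - s i) < delta ->
      \sum_(i < n) `|f (t i) - f (s i)| < e.

End IEM.
Arguments iem_data : clear implicits.

Section Sets.
Context {R : realType} {A : finType}.
Definition Iset (D : iem_data R A) : set R := [set x | 0 <= x < total D].
Definition Jset (D : iem_data R A) (a : A) : set R :=
  [set x | left_end D a <= x < right_end D a].
Definition Jint (D : iem_data R A) (a : A) : set R :=
  [set x | left_end D a < x < right_end D a].
End Sets.

(* Main.v *)
Require Import Defs.
From HB Require Import structures.
From mathcomp Require Import all_boot all_order all_algebra.
From mathcomp Require Import all_classical all_reals all_analysis.
From mathcomp Require Import perm.
From mathcomp Require Import zify ring lra.
Import Order.TTheory GRing.Theory Num.Theory.
Import numFieldNormedType.Exports.
Local Open Scope classical_set_scope.
Local Open Scope ring_scope.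
Set Implicit Arguments. Unset Strict Implicit. Unset Printing Implicit Defensive.

(** Read a function on [I] in the coordinate of each exchanged interval measured from
    its left end. The special Birkhoff sums along the Rauzy-Veech steps then satisfy a
    recursion which depends on the name and the secondary name of each step but not on
    its type.

    Bounded variation of [Phi'] makes the difference quotients of these sums oscillate
    by at most the total variation on each interval, and the mean slopes evolve by the
    matrices [S(k)]. Since [Phi'] has zero integral, conditions (a) and (b) make the
    oscillation of the special sums over the intervals of [T^(k)] decay like a negative
    power of [||Q(k)||]. The sums are then constants up to that error, and condition (c)
    lets one solve for [chi]: pulling the increments of the constants back by [S(0, k)]
    gives a series converging modulo the stable space. For [Phi - chi] the sup norms of
    the special sums at successive steps are summable. A Birkhoff sum costs at most two
    special sums per step, so Birkhoff sums are bounded, and their upper limit is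
    [Psi]. *)

(** * Rauzy-Veech steps *)

(** Since [Phi'] exists only almost everywhere, nothing is differentiated along the algorithm:
    slopes are difference quotients, and only they are carried from step to step.

    The mean slopes, and later the stable remainders, are sums over l <= k of vectors created at
    level l and carried to level k by [S(l, k)]. The Roth conditions give no decay of a single
    [S(l, k)]: the gain in (b) and in the definition of the stable space concerns maps starting at a
    fixed level. Each term therefore gets two bounds. Pulling the vector back to level 0 and using
    the gain of [S(0, k)] costs a fixed power of ||Q(l)||, because the matrices have determinant 1;
    this is good for small l. Carrying it directly is good for l close to k. A geometric mean of the
    two bounds is summable over l and still gains a power of ||Q(k)||.

    Blocks of [4 * #|A|] accelerated steps have positive matrices. With (a), this makes norms of
    products multiplicative up to arbitrarily small powers. *)

Section Positions.
Context {R : realType} {A : finType}.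
Implicit Types (p : A -> nat) (lam : A -> R).

(** Equivalent to [bij_pos]; on a finite alphabet surjectivity follows by counting. *)
Definition posperm p := injective p /\ forall a, (p a < #|A|)%N.

Lemma posperm_ex p k : posperm p -> (k < #|A|)%N -> exists a, p a = k.
Proof.
move=> [pinj plt] kA.
have inj : injective (fun a => Ordinal (plt a)) by move=> a b [] /pinj.
have /codomP[a ak] : Ordinal kA \in codom (fun a => Ordinal (plt a)).
  by rewrite inj_card_onto // card_ord.
by exists a; case: ak.
Qed.

Lemma bij_posP p : bij_pos p <-> posperm p.
Proof.
split=> [[plt pbij]|pp].
  split=> // a b ab; have [c [_ cu]] := pbij _ (plt a).
  by rewrite -(cu a erefl) -(cu b (esym ab)).
split=> [|k kA]; first by case: pp.
have [a ak] := posperm_ex pp kA; exists a; split=> // b bk.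
by case: pp => + _; apply; rewrite ak.
Qed.

(** [start] for a single row, with positions and lengths as separate arguments, since a step changes
    them separately. *)
Definition pstart p lam a : R := \sum_(b | (p b < p a)%N) lam b.

Lemma pstart_ge0 p lam a : (forall b, 0 < lam b) -> 0 <= pstart p lam a.
Proof. by move=> l0; apply: sumr_ge0 => b _; exact: ltW. Qed.

Lemma pstart_succ p lam a : posperm p ->
  pstart p lam a + lam a = \sum_(b | (p b <= p a)%N) lam b.
Proof.
move=> [pinj _]; rewrite [RHS](bigD1 a) //= addrC; congr (_ + _).
apply: eq_bigl => b; rewrite ltn_neqAle andbC; congr (_ && ~~ _).
by apply/eqP/eqP => [/pinj|->].
Qed.

Lemma pstart_next p lam a b : posperm p -> p b = (p a).+1 ->
  pstart p lam b = pstart p lam a + lam a.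
Proof. by move=> pp pb; rewrite pstart_succ // /pstart pb; apply: eq_bigl. Qed.

Lemma sum_le_subpred (P Q : pred A) lam : (forall b, 0 < lam b) ->
  (forall b, P b -> Q b) -> \sum_(b | P b) lam b <= \sum_(b | Q b) lam b.
Proof.
move=> l0 PQ; rewrite [leRHS](bigID P) /=.
rewrite [X in _ <= X + _](eq_bigl P); last first.
  by move=> b; case: (boolP (P b)) => [/PQ->|]; rewrite ?andbF.
by rewrite lerDl; apply: sumr_ge0 => b _; exact: ltW.
Qed.

Lemma pstart_lt p lam a b : posperm p -> (forall b, 0 < lam b) ->
  (p a < p b)%N -> pstart p lam a + lam a <= pstart p lam b.
Proof.
move=> pp l0 ab; rewrite pstart_succ //; apply: sum_le_subpred => // c.
by move=> /leq_ltn_trans; apply.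
Qed.

Lemma pstart_le_total p lam a : posperm p -> (forall b, 0 < lam b) ->
  pstart p lam a + lam a <= \sum_b lam b.
Proof. by move=> pp l0; rewrite pstart_succ //; apply: sum_le_subpred. Qed.

Lemma pstart_last p lam a : posperm p -> p a = #|A|.-1 ->
  pstart p lam a + lam a = \sum_b lam b.
Proof.
move=> pp pa; rewrite pstart_succ //; apply: eq_bigl => b.
by case: pp => _ /(_ b); rewrite pa; case: #|A|.
Qed.

Lemma pstart_first p lam a : p a = 0%N -> pstart p lam a = 0.
Proof. by move=> pa; rewrite /pstart pa big_pred0. Qed.

Lemma pstart_cover p lam x : posperm p -> (forall b, 0 < lam b) ->
  0 <= x < \sum_b lam b ->
  exists a t, 0 <= t < lam a /\ x = pstart p lam a + t.
Proof.
move=> pp l0 /andP[x0 xt].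
have A0 : (0 < #|A|)%N.
  by rewrite lt0n; apply/eqP => /card0_eq A0; move: xt; rewrite big_pred0 ?ltNge ?x0.
have [a0 pa0] := posperm_ex pp A0.
have Pa0 : pstart p lam a0 <= x by rewrite pstart_first.
(* The rightmost interval that starts at or before [x]. If [x] were beyond it, the next interval
   would also start at or before [x]. *)
pose a := [arg max_(a > a0 | pstart p lam a <= x) p a].
have [ax amax] : pstart p lam a <= x /\
    forall b, pstart p lam b <= x -> (p b <= p a)%N.
  by rewrite /a; case: arg_maxnP.
exists a, (x - pstart p lam a); split; last by rewrite addrC subrK.
rewrite subr_ge0 ax /= ltrBlDl ltNge; apply/negP => lex.
have [pa|pa] := eqVneq (p a) #|A|.-1.
  by move: xt; rewrite ltNge -(pstart_last _ pp pa) lex.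
have [|b pb] := posperm_ex (k := (p a).+1) pp.
  by have := pp.2 a; move: pa; case: #|A| => //= n; rewrite ltnS => ? ?; rewrite ltn_neqAle; lia.
by have := amax b; rewrite (pstart_next _ pp pb) lex pb ltnn => /(_ isT).
Qed.

Lemma pstart_inj p lam a b (s t : R) : posperm p -> (forall b, 0 < lam b) ->
  0 <= s < lam a -> 0 <= t < lam b ->
  pstart p lam a + s = pstart p lam b + t -> a = b.
Proof.
move=> pp l0 /andP[s0 sa] /andP[t0 tb] e.
case: (ltngtP (p a) (p b)) => [ab|ba|/pp.1//].
  by exfalso; have := pstart_lt pp l0 ab; lra.
by exfalso; have := pstart_lt pp l0 ba; lra.
Qed.

Lemma card_pos_lt p k : posperm p -> (k <= #|A|)%N ->
  #|[set a | (p a < k)%N]%SET| = k.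
Proof.
move=> pp kA; rewrite cardE -(size_map p) -[RHS](size_iota 0).
apply/perm_size/uniq_perm; first by rewrite map_inj_uniq ?enum_uniq //; exact: pp.1.
  exact: iota_uniq.
move=> i; rewrite mem_iota /= add0n; apply/mapP/idP => [[a]|ik].
  by rewrite mem_enum inE => ? ->.
have [a pa] := posperm_ex pp (leq_trans ik kA).
by exists a; rewrite ?mem_enum ?inE pa.
Qed.

End Positions.

Section NewPositions.
Context {R : realType} {A : finType}.
Variables (p : A -> nat) (w l : A).
Hypotheses (pp : posperm p) (pl : p l = #|A|.-1) (wl : w != l).

Lemma pos_lt_last a : a != l -> (p a < #|A|.-1)%N.
Proof.
move=> al; have := pp.2 a; have : p a != #|A|.-1.
  by rewrite -pl; apply: contra al => /eqP/pp.1->.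
by lia.
Qed.

Lemma rv_newpi_loser : rv_newpi p w l = (p w).+1.
Proof. by rewrite /rv_newpi pl leqNgt pos_lt_last //= ltnn. Qed.

Lemma rv_newpi_other a : a != l ->
  rv_newpi p w a = if (p a <= p w)%N then p a else (p a).+1.
Proof. by move=> al; rewrite /rv_newpi pos_lt_last. Qed.

Lemma rv_newpi_posperm : posperm (rv_newpi p w).
Proof.
have pw := pos_lt_last wl.
split=> [a b|a].
  have [->|al] := eqVneq a l; have [->|bl] := eqVneq b l => //.
  - by rewrite rv_newpi_loser rv_newpi_other //; case: ifP; lia.
  - by rewrite rv_newpi_loser rv_newpi_other //; case: ifP; lia.
  - rewrite !rv_newpi_other // => e; apply: pp.1; move: e.
    by case: ifP; case: ifP; lia.
have [->|al] := eqVneq a l; first by rewrite rv_newpi_loser; lia.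
by have := pos_lt_last al; rewrite rv_newpi_other //; case: ifP; lia.
Qed.

Variable lam : A -> R.
Let lam' a := if a == w then lam w - lam l else lam a.

(** The loser is inserted just after the winner, which is shortened by the loser's length. Together
    they fill the old place of the winner, so no other letter is displaced. *)
Lemma rv_newpi_start a : a != l ->
  pstart (rv_newpi p w) lam' a = pstart p lam a.
Proof.
move=> al; have pw := pos_lt_last wl; have pa := pos_lt_last al.
have [aw|wa] := leqP (p a) (p w).
  rewrite /pstart; apply: eq_big => b.
    rewrite (rv_newpi_other al) aw; have [->|bl] := eqVneq b l.
      by rewrite rv_newpi_loser pl; lia.
    by rewrite rv_newpi_other //; case: ifP; lia.
  rewrite (rv_newpi_other al) aw /lam'; case: eqP => // ->.
  by rewrite rv_newpi_other // leqnn; lia.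
have Pl : (rv_newpi p w l < rv_newpi p w a)%N.
  by rewrite rv_newpi_loser rv_newpi_other // [(p a <= _)%N]leqNgt wa.
have Pw : (rv_newpi p w w < rv_newpi p w a)%N.
  by rewrite !rv_newpi_other // leqnn [(p a <= _)%N]leqNgt wa /=; lia.
rewrite /pstart (bigD1 w) //= (bigD1 l) /=; last by rewrite Pl eq_sym.
rewrite [in RHS](bigD1 w) //= /lam' eqxx eq_sym (negbTE wl) addrA subrK.
congr (_ + _); apply: eq_big => b; last by move=> /andP[/andP[_ /negbTE->]].
have [->|bl] := eqVneq b l; first by rewrite andbF pl; lia.
rewrite andbT; congr (_ && _); rewrite !rv_newpi_other //.
by rewrite [(p a <= _)%N]leqNgt wa /=; case: ifP; lia.
Qed.

Lemma rv_newpi_start_loser :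
  pstart (rv_newpi p w) lam' l = pstart p lam w + (lam w - lam l).
Proof.
have pw := pos_lt_last wl.
rewrite /pstart (bigD1 w) /=; last first.
  by rewrite rv_newpi_loser rv_newpi_other // leqnn.
rewrite addrC {2}/lam' eqxx; congr (_ + _).
apply: eq_big => b; last by move=> /andP[_ /negbTE]; rewrite /lam' => ->.
rewrite rv_newpi_loser; have [->|bl] := eqVneq b l.
  by rewrite rv_newpi_loser ltnn pl; lia.
rewrite rv_newpi_other //; have [->|bw] := eqVneq b w; first by rewrite andbF ltnn.
have : p b <> p w by move=> /pp.1 e; rewrite e eqxx in bw.
by case: ifP; lia.
Qed.

Lemma rv_newpi_total : \sum_b lam' b = \sum_b lam b - lam l.
Proof.
rewrite (bigD1 w) //= [in RHS](bigD1 w) //= /lam' eqxx addrAC; congr (_ + _ + _).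
by apply: eq_bigr => b /negbTE->.
Qed.

End NewPositions.

Section OneStep.
Context {R : realType} {A : finType}.
Implicit Types (D : iem_data R A) (e : bool).

(** The part of [is_iem] that each step preserves for simple reasons; admissibility is followed
    separately, as [irreducible]. *)
Definition good D := (forall e, posperm (pi_ D e)) /\ forall a, 0 < lam D a.

Lemma start_pstart D e a : start D e a = pstart (pi_ D e) (lam D) a.
Proof. by []. Qed.

Lemma is_iem_good D : is_iem D -> good D.
Proof. by case=> _ /bij_posP p0 /bij_posP p1 _ l0; split=> // -[]. Qed.

Lemma start_ge0 D e a : good D -> 0 <= start D e a.
Proof. by case=> _ l0; exact: pstart_ge0. Qed.

Lemma start_le_total D e a : good D -> start D e a + lam D a <= Defs.total D.
Proof. by case=> pp l0; exact: pstart_le_total. Qed.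

Lemma Iset_cover D x : good D -> Iset D x ->
  exists a t, 0 <= t < lam D a /\ x = start D false a + t.
Proof. by case=> pp l0; exact: (pstart_cover (pp false)). Qed.

Lemma Iset_start D e a t : good D -> 0 <= t < lam D a ->
  Iset D (start D e a + t).
Proof.
move=> gD /andP[t0 ta]; have := start_ge0 e a gD.
have := start_le_total e a gD; rewrite /Iset /= => ? ?.
by apply/andP; split; lra.
Qed.

Lemma iem_mapE D a t : good D -> 0 <= t < lam D a ->
  iem_map D (start D false a + t) = start D true a + t.
Proof.
move=> [pp l0] /andP[t0 ta]; rewrite /iem_map (bigD1 a) //= big1 ?addr0.
  by rewrite /left_end /right_end lerDl t0 ltrD2l ta /= addrC addrA subrK.
move=> b ba; case: ifP => // /andP[]; rewrite /left_end /right_end => h1 h2.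
suff /eqP : b = a by rewrite (negbTE ba).
apply: (@pstart_inj _ _ _ _ _ _ (start D false a + t - start D false b) t
  (pp false) l0); rewrite ?t0 ?ta //; last by rewrite !start_pstart; lra.
by apply/andP; split; lra.
Qed.

Lemma iem_map_Iset D x : good D -> Iset D x -> Iset D (iem_map D x).
Proof.
move=> gD /(Iset_cover gD)[a [t [ta ->]]].
by rewrite iem_mapE //; exact: Iset_start.
Qed.

Lemma rv_info_ex D : good D -> (0 < #|A|)%N -> exists e w l,
  [/\ rv_info D = Some (e, w, l), pi_ D e w = #|A|.-1,
      pi_ D (~~ e) l = #|A|.-1 & lam D l <= lam D w].
Proof.
move=> [pp l0] A0; rewrite /rv_info /last_letter.
have Alt : (#|A|.-1 < #|A|)%N by rewrite prednK.
case: pickP => [a0 /eqP pa0|no]; last first.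
  by have [a pa] := posperm_ex (pp false) Alt; have /eqP := no a; case.
case: pickP => [a1 /eqP pa1|no]; last first.
  by have [a pa] := posperm_ex (pp true) Alt; have /eqP := no a; case.
by case: ltP => h; [exists false, a0, a1|exists true, a1, a0]; split=> //; exact: ltW.
Qed.

(** The strict inequality excludes a tie, which [rv_info] would silently count as type [true]. *)
Definition step_spec D e w l := [/\ rv_info D = Some (e, w, l),
  pi_ D e w = #|A|.-1, pi_ D (~~ e) l = #|A|.-1 & lam D l < lam D w].

(* If the two last intervals had the same length, T would send the left end of
   the last interval of the bottom row onto the left end of the last interval of
   the top row. *)
Lemma keane_step D : good D -> (1 < #|A|)%N -> keane D ->
  exists e w l, step_spec D e w l.
Proof.
move=> gD A1 kD; have [e [w [l [info pw pl]]]] := rv_info_ex gD (ltnW A1).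
rewrite le_eqVlt => /orP[/eqP eql|lwl]; last by exists e, w, l.
exfalso; apply: kD.
have [a [b [pa pb eqab]]] : exists a b, [/\ pi1 D a = #|A|.-1,
    pi0 D b = #|A|.-1 & lam D a = lam D b].
  by case: e pw pl {info} => /= pw pl; [exists w, l|exists l, w].
exists a, b, 1%N; split=> //=; first by rewrite pb; lia.
rewrite -[start D false a]addr0 iem_mapE // ?lexx ?gD.2// addr0.
apply: (addIr (lam D a)); rewrite (pstart_last _ (gD.1 true) pa) eqab.
by rewrite (pstart_last _ (gD.1 false) pb).
Qed.

Section Step.
Variables (D : iem_data R A) (e : bool) (w l : A).
Hypotheses (gD : good D) (sD : step_spec D e w l).
Let D' := rv_step D.

Let info : rv_info D = Some (e, w, l). Proof. by case: sD. Qed.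
Let pw : pi_ D e w = #|A|.-1. Proof. by case: sD. Qed.
Let pl : pi_ D (~~ e) l = #|A|.-1. Proof. by case: sD. Qed.
Let ltl : lam D l < lam D w. Proof. by case: sD. Qed.

Lemma step_neq : w != l.
Proof. by apply/eqP => wl; move: ltl; rewrite wl ltxx. Qed.

Let wl := step_neq.

Lemma step_lam a : lam D' a = if a == w then lam D w - lam D l else lam D a.
Proof. by rewrite /D' /rv_step info. Qed.

Lemma step_lam_w : lam D' w = lam D w - lam D l.
Proof. by rewrite step_lam eqxx. Qed.

Lemma step_lam_other a : a != w -> lam D' a = lam D a.
Proof. by rewrite step_lam => /negbTE->. Qed.

Lemma step_lam_l : lam D' l = lam D l.
Proof. by rewrite step_lam_other // eq_sym. Qed.

Lemma step_lam_le a : lam D' a <= lam D a.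
Proof.
by rewrite step_lam; case: eqP => // ->; rewrite gerBl ltW // gD.2.
Qed.

Lemma step_pi_e : pi_ D' e = pi_ D e.
Proof. by rewrite /D' /rv_step info; case: (e). Qed.

Lemma step_pi_ne : pi_ D' (~~ e) = rv_newpi (pi_ D (~~ e)) w.
Proof. by rewrite /D' /rv_step info; case: (e). Qed.

Lemma step_good : good D'.
Proof.
split=> [e'|a]; last first.
  by rewrite step_lam; case: ifP => _; rewrite ?subr_gt0 // gD.2.
have [->|ne] : e' = e \/ e' = ~~ e by case: (e) (e') => -[]; [left|right|right|left].
  by rewrite step_pi_e; exact: gD.1.
by rewrite ne step_pi_ne; exact: (rv_newpi_posperm (gD.1 _) pl wl).
Qed.

Lemma step_start_e a : start D' e a = start D e a.
Proof.
rewrite !start_pstart step_pi_e; apply: eq_bigr => b ba.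
rewrite step_lam_other //; apply/eqP => bw; move: ba; rewrite bw pw.
by have := (gD.1 e).2 a; lia.
Qed.

Lemma step_start_ne a : a != l -> start D' (~~ e) a = start D (~~ e) a.
Proof.
move=> al; rewrite !start_pstart step_pi_ne.
rewrite -(rv_newpi_start (gD.1 _) pl wl (lam D) al).
by apply: eq_bigr => b _; rewrite step_lam.
Qed.

Lemma step_start_loser : start D' (~~ e) l = start D (~~ e) w + lam D' w.
Proof.
rewrite !start_pstart step_pi_ne step_lam_w.
rewrite -(rv_newpi_start_loser (gD.1 _) pl wl (lam D)).
by apply: eq_bigr => b _; rewrite step_lam.
Qed.

Lemma step_total : Defs.total D' = Defs.total D - lam D l.
Proof.
rewrite /Defs.total -(rv_newpi_total w l (lam D)).
by apply: eq_bigr => b _; rewrite step_lam.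
Qed.

Lemma step_start_other e' a : a != l -> start D' e' a = start D e' a.
Proof.
move=> al; have [->|->] : e' = e \/ e' = ~~ e.
- by case: (e) (e') => -[]; [left|right|right|left].
- exact: step_start_e.
- exact: step_start_ne.
Qed.

Lemma start_w_last : start D e w = Defs.total D - lam D w.
Proof. by rewrite start_pstart /Defs.total -(pstart_last _ (gD.1 e) pw) addrK. Qed.

Lemma start_l_last : start D (~~ e) l = Defs.total D - lam D l.
Proof. by rewrite start_pstart /Defs.total -(pstart_last _ (gD.1 _) pl) addrK. Qed.

Lemma step_map_other a t : a != l -> 0 <= t < lam D' a ->
  iem_map D' (start D' false a + t) = iem_map D (start D' false a + t).
Proof.
move=> al /andP[t0 ta]; rewrite iem_mapE ?t0 ?ta//; last exact: step_good.
rewrite !step_start_other // iem_mapE // t0 /=.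
exact: lt_le_trans (step_lam_le a).
Qed.

(** A point of the new loser's interval returns after two iterations, visiting the old loser's
    interval and the part cut off the winner's. The type only decides the order of the two visits,
    so a sum over both does not depend on it. *)
Lemma step_loser_orbit t : 0 <= t < lam D l ->
  let x := start D' false l + t in
  (if e then
     x = start D false w + (lam D' w + t) /\ iem_map D x = start D false l + t
   else
     x = start D false l + t /\ iem_map D x = start D false w + (lam D' w + t))
  /\ iem_map D' x = iem_map D (iem_map D x).
Proof.
move=> /andP[t0 tl] x; have lt_lw := ltl.
have T'x : iem_map D' x = start D' true l + t.
  by apply: iem_mapE; [exact: step_good|rewrite step_lam_l t0].
have ew := start_w_last; have el := start_l_last.
have se := step_start_e l; have sl := step_start_loser.
have lw := step_lam_w.
have Tl : iem_map D (start D false l + t) = start D true l + t.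
  by apply: iem_mapE; rewrite ?t0.
have Tw : iem_map D (start D false w + (lam D' w + t)) =
          start D true w + (lam D' w + t).
  by apply: iem_mapE => //; rewrite lw; apply/andP; split; lra.
rewrite T'x; rewrite /x; case: (e) ew el se sl => /= ew el se sl.
  have -> : start D' false l + t = start D false w + (lam D' w + t) by rewrite sl addrA.
  have Tx : start D true w + (lam D' w + t) = start D false l + t.
    by rewrite ew el lw; ring.
  by rewrite Tw Tx Tl se.
rewrite se.
have Tx : start D true l + t = start D false w + (lam D' w + t).
  by rewrite ew el lw; ring.
by rewrite Tl Tx Tw sl -addrA.
Qed.

(** The removed points lie in the last top interval, whose image is to the left of the last bottom
    interval. An orbit thus enters the induced interval after one iteration. *)
Lemma step_map_outside x : Defs.total D' <= x -> x < Defs.total D ->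
  Iset D' (iem_map D x).
Proof.
move=> xge xlt; rewrite step_total in xge; have lt_lw := ltl.
have ew := start_w_last; have el := start_l_last.
have lp := gD.2 l.
have lew : start D (~~ e) w + lam D w <= start D (~~ e) l.
  apply: pstart_lt; [exact: gD.1|exact: gD.2|].
  by rewrite pl; exact: (pos_lt_last (gD.1 _) pl wl).
have lel : start D e l + lam D l <= start D e w.
  apply: pstart_lt; [exact: gD.1|exact: gD.2|].
  by rewrite pw; apply: (pos_lt_last (gD.1 _) pw); rewrite eq_sym; exact: wl.
rewrite /Iset /= step_total.
case: (e) ew el lew lel => /= ew el lew lel.
  have -> : x = start D false l + (x - start D false l) by rewrite addrC subrK.
  have := start_ge0 true l gD; rewrite iem_mapE //; last first.
    by apply/andP; split; lra.
  by move=> ?; apply/andP; split; lra.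
have -> : x = start D false w + (x - start D false w) by rewrite addrC subrK.
have := start_ge0 true w gD; rewrite iem_mapE //; last first.
  by apply/andP; split; lra.
by move=> ?; apply/andP; split; lra.
Qed.

Lemma step_map_iterate x : Iset D' x ->
  iem_map D' x = iem_map D x \/ iem_map D' x = iem_map D (iem_map D x).
Proof.
move=> /(Iset_cover step_good)[a [t [ta ->]]].
have [al|al] := eqVneq a l; last by left; exact: step_map_other.
right; move: ta; rewrite al step_lam_l => /step_loser_orbit; exact: snd.
Qed.

Lemma step_iter m x : Iset D' x -> exists2 m', (m <= m')%N &
  iter m (iem_map D') x = iter m' (iem_map D) x.
Proof.
elim: m x => [|m IH] x xI; first by exists 0%N.
have [m' mm' E] := IH _ (iem_map_Iset step_good xI).
rewrite iterSr E; have [->|->] := step_map_iterate xI.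
  by exists m'.+1; rewrite ?ltnS ?iterSr.
by exists m'.+2; [lia|rewrite !iterSr].
Qed.

(** Only the loser's left end can move in the top row, and then [T] maps the new one to the old
    one. *)
Lemma step_start_false a : start D' false a = start D false a \/
  iem_map D (start D' false a) = start D false a /\
  iem_map D' (start D' false a) = iem_map D (start D false a).
Proof.
have [->|al] := eqVneq a l; last by left; exact: step_start_other.
have ltl0 : 0 <= (0 : R) < lam D l by rewrite lexx gD.2.
have := step_loser_orbit ltl0; rewrite !addr0.
by case: (e) => -[[h1 h2] h3]; [right; rewrite h3 h2|left].
Qed.

(** A connection of the induced map unfolds to one of [T]: its iterates are iterates of [T] of at
    least the same order, and a displaced left end is a preimage of the old one. *)
Lemma step_keane : (1 < #|A|)%N -> keane D -> keane D'.
Proof.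
move=> A1 kD [a [b [m [pb m1 E]]]]; apply: kD.
have sI c : Iset D' (start D' false c).
  rewrite -[start _ _ _]addr0; apply: Iset_start; first exact: step_good.
  by rewrite lexx step_good.2.
have pb0 : (0 < pi0 D b)%N.
  rewrite lt0n; apply/negP => /eqP pb0; move: pb.
  case: (e) pl step_pi_ne step_pi_e => /= [pl' ne _|_ _ ->]; last by rewrite pb0.
  by rewrite ne /rv_newpi pb0.
have [m' m'1 E'] : exists2 m', (1 <= m')%N &
    iter m' (iem_map D) (start D false a) = start D' false b.
  have [sa|[_ T'a]] := step_start_false a.
    have [m' mm' Em] := step_iter m (sI a).
    by exists m'; [exact: leq_trans mm'|rewrite -sa -Em].
  case: m m1 E => // m _; rewrite iterSr => <-.
  have [m' mm' ->] := step_iter m (iem_map_Iset step_good (sI a)).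
  by exists m'.+1; rewrite // iterSr T'a.
have [sb|[Tb _]] := step_start_false b; first by exists a, b, m'; rewrite -sb.
by exists a, b, m'.+1; split=> //; rewrite iterS E' Tb.
Qed.
End Step.
End OneStep.

(** * Every letter wins infinitely often *)

Section Irreducible.
Context {R : realType} {A : finType}.
Implicit Types (D : iem_data R A) (e : bool).

(** Admissibility stated for both orders of the rows, so that the type of a step can be put for
    [e]. *)
Definition irreducible D := forall e k, (1 <= k <= #|A|.-1)%N ->
  ~ forall a, (pi_ D e a < k)%N = (pi_ D (~~ e) a < k)%N.

Lemma admissible_irreducible D :
  admissible (pi0 D) (pi1 D) -> irreducible D.
Proof.
move=> adm e k /adm/eqP; apply: contra_not => h.
by apply/seteqP; split=> a /=; case: e h => /= ->.
Qed.

Lemma step_irreducible D e w l : good D -> step_spec D e w l ->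
  irreducible D -> irreducible (rv_step D).
Proof.
move=> gD sD irr e' k kA h; apply: (irr e k kA) => a.
have wl := step_neq sD; have [info pw pl _] := sD.
have {}h b : (pi_ D e b < k)%N = (rv_newpi (pi_ D (~~ e)) w b < k)%N.
  rewrite -(step_pi_e sD) -(step_pi_ne sD).
  have [ee|ee] : e' = e \/ e' = ~~ e by case: (e) (e') => -[]; [left|right|right|left].
    by have := h b; rewrite ee.
  by have := h b; rewrite ee negbK.
(* The winner is last in row [e], hence outside the first [k] positions of both new rows. Letters
   move only behind the winner, so these positions are those of the old rows. *)
have := h w; rewrite pw (rv_newpi_other (gD.1 _) pl wl wl) leqnn => kw.
rewrite h; have [->|al] := eqVneq a l.
  by rewrite (rv_newpi_loser (gD.1 _) pl wl) pl; lia.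
by rewrite (rv_newpi_other (gD.1 _) pl wl al); case: ifP; lia.
Qed.

Lemma step_pi_mono D e w l e' a : good D -> step_spec D e w l -> a != l ->
  (pi_ D e' a <= pi_ (rv_step D) e' a)%N.
Proof.
move=> gD sD al; have [info pw pl _] := sD.
have [->|->] : e' = e \/ e' = ~~ e by case: (e) (e') => -[]; [left|right|right|left].
  by rewrite (step_pi_e sD).
rewrite (step_pi_ne sD) (rv_newpi_other (gD.1 _) pl (step_neq sD) al).
by case: ifP; lia.
Qed.

End Irreducible.

Lemma eventually_fin (A : finType) (P : A -> nat -> Prop) :
  (forall a, exists N, forall n, (N <= n)%N -> P a n) ->
  exists N, forall n, (N <= n)%N -> forall a, P a n.
Proof.
move=> /choice[N PN]; exists (\max_a N a)%N => n Nn a; apply: PN.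
exact: leq_trans (leq_bigmax a) Nn.
Qed.

Lemma bounded_eventually_const (f : nat -> nat) n0 K :
  (forall n, (n0 <= n)%N -> (f n <= f n.+1)%N) -> (forall n, (f n <= K)%N) ->
  exists N, forall n, (N <= n)%N -> f n.+1 = f n.
Proof.
move=> fm fK; apply: contrapT => /forallNP h.
suff /(_ K.+1)[n _] : forall k, exists2 n, (n0 <= n)%N & (k <= f n)%N.
  by have := fK n; lia.
elim=> [|k [n n0n kn]]; first by exists n0.
have /existsNP[m /not_implyP[nm fmm]] := h n.
have fnm : (f n <= f m)%N.
  elim: m nm {fmm} => [|m IH]; first by rewrite leqn0 => /eqP->.
  rewrite leq_eqVlt => /orP[/eqP->//|nm].
  by apply: leq_trans (IH _) (fm _ _) => //; lia.
by exists m.+1; [lia|have := fm m; lia].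
Qed.

Section Orbit.
Context {R : realType} {A : finType}.
Variables (D : iem_data R A) (e_ : nat -> bool) (w_ l_ : nat -> A).
Hypotheses (gD : good D)
  (specs : forall n, step_spec (rv_data D n) (e_ n) (w_ n) (l_ n)).

Lemma orbit_good n : good (rv_data D n).
Proof. by elim: n => [//|n IH]; exact: (step_good IH (specs n)). Qed.

Lemma orbit_irreducible n : irreducible D -> irreducible (rv_data D n).
Proof.
move=> irr; elim: n => [//|n IH].
exact: (step_irreducible (orbit_good n) (specs n)).
Qed.

(** The winner is still last in its row, hence it is one of the two letters compared by the next
    step. *)
Lemma winner_next n : w_ n.+1 = w_ n \/ l_ n.+1 = w_ n.
Proof.
have [_ pw pl _] := specs n.+1; have [_ pw0 _ _] := specs n.
have pw1 : pi_ (rv_data D n.+1) (e_ n) (w_ n) = #|A|.-1.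
  by rewrite [rv_data _ _.+1]/= (step_pi_e (specs n)).
have [ee|ee] : e_ n.+1 = e_ n \/ ~~ e_ n.+1 = e_ n.
  by case: (e_ n) (e_ n.+1) => -[]; [left|right|right|left].
  by left; apply: ((orbit_good n.+1).1 (e_ n)).1; rewrite pw1 -ee.
by right; apply: ((orbit_good n.+1).1 (e_ n)).1; rewrite pw1 -ee.
Qed.

Section Recurrence.
Hypothesis irr : irreducible D.

Let infw b := forall N, exists2 n, (N <= n)%N & w_ n = b.

Let winners_infw : exists N, forall n, (N <= n)%N -> infw (w_ n).
Proof.
have /eventually_fin[N h] : forall a, exists N, forall n, (N <= n)%N ->
    w_ n = a -> infw a.
  move=> a; have [ia|/existsNP[N nN]] := pselect (infw a); first by exists 0%N.
  by exists N => n Nn wa; exfalso; apply: nN; exists n.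
by exists N => n /h; apply.
Qed.

(* A letter which stops winning keeps a constant length, so it can only lose
   finitely often: each loss subtracts that length from the total. *)
Let losers_infw : exists N, forall n, (N <= n)%N -> infw (w_ n) /\ infw (l_ n).
Proof.
have [N0 hN0] := winners_infw.
suff /eventually_fin[N h] : forall a, exists N, forall n, (N <= n)%N ->
    l_ n = a -> infw a.
  exists (maxn N0 N) => n; rewrite geq_max => /andP[n0n nn].
  by split; [exact (hN0 n n0n)|exact (h n nn _ erefl)].
move=> a; have [ia|nia] := pselect (infw a); first by exists 0%N.
apply: contrapT => /forallNP h; pose c := lam (rv_data D N0) a.
have lamc n : (N0 <= n)%N -> lam (rv_data D n) a = c.
  elim: n => [|n IH]; first by rewrite leqn0 /c => /eqP->.
  rewrite leq_eqVlt => /orP[/eqP<-//|Nn].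
  rewrite [rv_data _ _.+1]/= (step_lam_other (specs n)) ?IH //.
  by apply/eqP => aw; apply: nia; rewrite aw; apply: hN0.
have c0 : 0 < c by apply: (orbit_good N0).2.
have tot n m : (n <= m)%N -> Defs.total (rv_data D m) <= Defs.total (rv_data D n).
  elim: m => [|m IH]; first by rewrite leqn0 => /eqP->.
  rewrite leq_eqVlt => /orP[/eqP<-//|nm]; apply: le_trans (IH nm).
  by rewrite [rv_data _ _.+1]/= (step_total (specs m)) gerBl ltW // (orbit_good m).2.
have dec k : exists2 n, (N0 <= n)%N &
    Defs.total (rv_data D n) <= Defs.total (rv_data D N0) - c *+ k.
  elim: k => [|k [n Nn IH]]; first by exists N0; rewrite ?mulr0n ?subr0.
  have /existsNP[m /not_implyP[nm /not_implyP[lm _]]] := h n.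
  exists m.+1; first lia.
  rewrite [rv_data _ _.+1]/= (step_total (specs m)) lm lamc; last lia.
  by have := tot _ _ nm; rewrite mulrS; lra.
have [k tk] : exists k, Defs.total (rv_data D N0) < c *+ k.
  exists (Num.Def.archi_bound (Defs.total (rv_data D N0) / c)).
  rewrite -mulr_natr mulrC -ltr_pdivrMr //; apply: archi_boundP.
  apply: divr_ge0; last exact: ltW.
  by apply: sumr_ge0 => b _; exact/ltW/(orbit_good N0).2.
have [n _] := dec k; have : 0 <= Defs.total (rv_data D n).
  by apply: sumr_ge0 => b _; exact/ltW/(orbit_good n).2.
lra.
Qed.

(* Letters winning finitely often eventually stop moving in both rows, which
   forces them to occupy the same initial positions of the two rows. *)
Lemma winner_recurrent b m : exists2 n, (m <= n)%N & w_ n = b.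
Proof.
suff : infw b by apply.
apply: contrapT => nb; have [N hN] := losers_infw.
have /eventually_fin[N' hN'] : forall a, exists M, forall n, (M <= n)%N ->
    ~ infw a -> forall e, pi_ (rv_data D n.+1) e a = pi_ (rv_data D n) e a.
  move=> a; have [ia|nia] := pselect (infw a); first by exists 0%N.
  have mono n e : (N <= n)%N -> (pi_ (rv_data D n) e a <= pi_ (rv_data D n.+1) e a)%N.
    move=> Nn; apply: (step_pi_mono _ (orbit_good n) (specs n)).
    by apply/eqP => al; apply: nia; rewrite al; exact: (hN n Nn).2.
  (* Both positions are nondecreasing, so they stabilise together with their sum. *)
  have [||M hM] := @bounded_eventually_const
    (fun n => pi_ (rv_data D n) false a + pi_ (rv_data D n) true a)%N N (#|A| + #|A|).
  - by move=> n Nn; apply: leq_add; exact: mono.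
  - move=> n; have := ((orbit_good n).1 false).2 a.
    by have := ((orbit_good n).1 true).2 a; lia.
  exists (maxn M N) => n; rewrite geq_max => /andP[Mn Nn] _ e.
  have := hM n Mn; have := mono n false Nn; have := mono n true Nn.
  by case: e; lia.
pose M := maxn N N'.
have mv n a e : (M <= n)%N -> ~ infw a ->
    pi_ (rv_data D n.+1) e a = pi_ (rv_data D n) e a.
  by rewrite geq_max => /andP[_ Mn] na; exact (hN' n Mn a na e).
(* A letter in front of a stationary letter stays in front and does not win: the winner is last in
   its own row, and in the other row it pushes the letters behind it to the right. *)
have row n e a c : (M <= n)%N -> ~ infw a ->
    (pi_ (rv_data D n) e c < pi_ (rv_data D n) e a)%N ->
    (pi_ (rv_data D n.+1) e c < pi_ (rv_data D n.+1) e a)%N /\ w_ n != c.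
  move=> Mn na ca; have mva := mv n a e Mn na; have [_ pw pl _] := specs n.
  have al : a != l_ n.
    apply/eqP => al; apply: na; rewrite al.
    by move: Mn; rewrite geq_max => /andP[/hN[]].
  have wl := step_neq (specs n).
  have [ee|ee] : e = e_ n \/ e = ~~ e_ n.
    by case: (e) (e_ n) => -[]; [left|right|right|left].
    rewrite ee in ca *; rewrite [rv_data _ _.+1]/= (step_pi_e (specs n)); split=> //.
    apply/eqP => wc; move: ca; rewrite -wc pw.
    by have := ((orbit_good n).1 (e_ n)).2 a; lia.
  rewrite mva; move: mva ca; rewrite ee [rv_data _ _.+1]/= (step_pi_ne (specs n)).
  have pp := (orbit_good n).1 (~~ e_ n).
  rewrite (rv_newpi_other pp pl wl al); case: ifP => [aw _ ca|_]; last by lia.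
  have cl : c != l_ n by apply/eqP => cl; move: ca (pp.2 a); rewrite cl pl; lia.
  rewrite (rv_newpi_other pp pl wl cl) (leq_trans (ltnW ca) aw); split=> //.
  by apply/eqP => wc; move: ca; rewrite -wc ltnNge aw.
(* A recurrent winner standing in front of [a] would remain there and never win. *)
have before e a c : ~ infw a -> infw c ->
    (pi_ (rv_data D M) e a < pi_ (rv_data D M) e c)%N.
  move=> na ic; rewrite ltnNge leq_eqVlt; apply/negP => /orP[/eqP/((orbit_good M).1 e).1 ca|].
    by apply: na; rewrite -ca.
  move=> ca; have allc n : (M <= n)%N -> (pi_ (rv_data D n) e c < pi_ (rv_data D n) e a)%N.
    elim: n => [|n IH]; first by rewrite leqn0 => /eqP<-.
    by rewrite leq_eqVlt => /orP[/eqP<-//|Mn]; have [] := row n e a c Mn na (IH Mn).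
  have [n Mn wc] := ic M.
  by have [_ /eqP] := row n e a c Mn na (allc n Mn).
pose B := [set a | ~~ `[< infw a >]]%SET.
have inB a : (a \in B) = ~~ `[< infw a >] by rewrite inE.
have wB : w_ M \notin B.
  by rewrite inB negbK; apply/asboolP; have [] := hN M (leq_maxl _ _).
have pB e : forall a, (pi_ (rv_data D M) e a < #|B|)%N = (a \in B).
  have bB : b \in B by rewrite inB; apply/asboolPn.
  have [b1 b1B b1max] : exists2 b1, b1 \in B &
      forall a, a \in B -> (pi_ (rv_data D M) e a <= pi_ (rv_data D M) e b1)%N.
    by case: (arg_maxnP (pi_ (rv_data D M) e) bB) => b1 ? ?; exists b1.
  have pB1 a : (pi_ (rv_data D M) e a < (pi_ (rv_data D M) e b1).+1)%N = (a \in B).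
    apply/idP/idP => [|/b1max//].
    rewrite ltnS; apply: contraLR; rewrite inB negbK -ltnNge => /asboolP ia.
    by apply: before => //; apply/asboolPn; rewrite -inB.
  suff <- : (pi_ (rv_data D M) e b1).+1 = #|B| by [].
  have <- := card_pos_lt ((orbit_good M).1 e) (((orbit_good M).1 e).2 b1).
  by apply: eq_card => a; rewrite inE pB1.
have B1 : (1 <= #|B| <= #|A|.-1)%N.
  apply/andP; split; first by apply/card_gt0P; exists b; rewrite inB; apply/asboolPn.
  suff : (#|B| < #|A|)%N by lia.
  rewrite -(cardsC B) -[X in (X < _)%N]addn0 ltn_add2l.
  by apply/card_gt0P; exists (w_ M); rewrite finset.inE.
have h := orbit_irreducible (n := M) irr; apply: (h false _ B1) => a.
by rewrite !pB.
Qed.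

End Recurrence.
End Orbit.

(** * The accelerated algorithm *)

Section Matrices.
Context {R : realType} {A : finType}.
Local Notation mx := (@mx R A).
Implicit Types (M N : mx) (v : A -> R).

Lemma mmulA M N P : mmul (mmul M N) P = mmul M (mmul N P).
Proof.
apply/funext => a; apply/funext => c; rewrite /mmul.
under eq_bigr do rewrite mulr_suml.
under [RHS]eq_bigr do rewrite mulr_sumr.
rewrite exchange_big; apply: eq_bigr => b _; apply: eq_bigr => d _.
by rewrite mulrA.
Qed.

Lemma sum_delta_l (a : A) v : \sum_b (a == b)%:R * v b = v a.
Proof.
rewrite (bigD1 a) //= eqxx mul1r big1 ?addr0// => b ba.
by rewrite eq_sym (negbTE ba) mul0r.
Qed.

Lemma sum_delta_r (a : A) v : \sum_b v b * (b == a)%:R = v a.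
Proof. by rewrite -[RHS]sum_delta_l; apply: eq_bigr => b _; rewrite mulrC eq_sym. Qed.

Lemma mmulm1 M : mmul M idm = M.
Proof. by apply/funext => a; apply/funext => c; exact: (sum_delta_r c (M a)). Qed.

Lemma mnorm_ge0 M : 0 <= mnorm M.
Proof. by apply: sumr_ge0 => a _; exact: sumr_ge0. Qed.

Lemma mnorm_tr M : mnorm (trmx_ M) = mnorm M.
Proof. by rewrite /mnorm exchange_big. Qed.

Lemma ler_sum_term (f : A -> R) a : (forall b, 0 <= f b) -> f a <= \sum_b f b.
Proof. by move=> f0; rewrite (bigD1 a) //= lerDl sumr_ge0. Qed.

Lemma mnorm_entry M a b : `|M a b| <= mnorm M.
Proof.
apply: le_trans (ler_sum_term (f := fun a => \sum_b `|M a b|) a _).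
  by apply: (ler_sum_term (f := fun b => `|M a b|)).
by move=> c; apply: sumr_ge0.
Qed.

Lemma mnorm_row M a : \sum_b `|M a b| <= mnorm M.
Proof.
by apply: (ler_sum_term (f := fun a => \sum_b `|M a b|)) => c; apply: sumr_ge0.
Qed.

Lemma mnormM M N : mnorm (mmul M N) <= mnorm M * mnorm N.
Proof.
have -> : mnorm M * mnorm N = \sum_a \sum_b `|M a b| * mnorm N.
  by rewrite mulr_suml; apply: eq_bigr => a _; rewrite mulr_suml.
apply: ler_sum => a _.
apply: (@le_trans _ _ (\sum_c \sum_b `|M a b| * `|N b c|)).
  by apply: ler_sum => c _; apply: le_trans (ler_norm_sum _ _ _) _;
     apply: ler_sum => b _; rewrite normrM.
rewrite exchange_big; apply: ler_sum => b _; rewrite -mulr_sumr.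
by apply: ler_wpM2l => //; exact: mnorm_row.
Qed.

(** Entrywise at least the identity: the property of Rauzy-Veech products which makes entries and
    norms grow under multiplication on either side. *)
Definition mx_ge1 M := forall a b, (a == b)%:R <= M a b.

Lemma mx_ge1_ge0 M a b : mx_ge1 M -> 0 <= M a b.
Proof. by move=> /(_ a b); apply: le_trans. Qed.

Lemma mnorm_ge1E M : mx_ge1 M -> mnorm M = \sum_a \sum_b M a b.
Proof.
move=> M1; apply: eq_bigr => a _; apply: eq_bigr => b _.
by rewrite ger0_norm ?mx_ge1_ge0.
Qed.

Lemma mmul_ge_l M N a b : mx_ge1 M -> mx_ge1 N -> M a b <= mmul M N a b.
Proof.
move=> M1 N1; rewrite -[leLHS](sum_delta_r b (M a)); apply: ler_sum => c _.
by apply: ler_wpM2l => //; exact: mx_ge1_ge0.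
Qed.

Lemma mmul_ge_r M N a b : mx_ge1 M -> mx_ge1 N -> N a b <= mmul M N a b.
Proof.
move=> M1 N1; rewrite -[leLHS](sum_delta_l a (N^~ b)); apply: ler_sum => c _.
by apply: ler_wpM2r => //; exact: mx_ge1_ge0.
Qed.

Lemma mmul_ge1 M N : mx_ge1 M -> mx_ge1 N -> mx_ge1 (mmul M N).
Proof. by move=> M1 N1 a b; apply: le_trans (M1 a b) _; exact: mmul_ge_l. Qed.

Lemma idm_ge1 : mx_ge1 idm. Proof. by move=> a b. Qed.

Lemma le_mnorm M N : mx_ge1 M -> mx_ge1 N -> (forall a b, M a b <= N a b) ->
  mnorm M <= mnorm N.
Proof.
move=> M1 N1 MN; rewrite !mnorm_ge1E //.
by apply: ler_sum => a _; apply: ler_sum => b _.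
Qed.

Lemma mnorm_idm : mnorm (idm : mx) = #|A|%:R.
Proof.
rewrite mnorm_ge1E; last exact: idm_ge1.
rewrite (eq_bigr (fun=> 1)) ?sumr_const // => a _.
by rewrite -[RHS](sum_delta_l a (fun=> 1)); apply: eq_bigr => b _; rewrite mulr1.
Qed.

Lemma mnorm_ge_card M : mx_ge1 M -> #|A|%:R <= mnorm M.
Proof. by move=> M1; rewrite -mnorm_idm; apply: le_mnorm => //; exact: idm_ge1. Qed.

(** With a middle factor of entries at least 1, every entry of [M] meets every entry of [N] in the
    product. *)
Lemma mnorm_mul_pos M P N : mx_ge1 M -> mx_ge1 N -> (forall a b, 1 <= P a b) ->
  mnorm M * mnorm N <= mnorm (mmul (mmul M P) N).
Proof.
move=> M1 N1 P1; rewrite (mnorm_ge1E M1) (mnorm_ge1E N1) /mnorm mulr_suml.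
apply: ler_sum => a _; rewrite exchange_big mulr_sumr; apply: ler_sum => c _.
apply: le_trans (ler_norm _); rewrite mulr_sumr; apply: ler_sum => b _.
apply: ler_wpM2r; first exact: mx_ge1_ge0.
apply: ler_sum => d _; rewrite -[leLHS]mulr1; apply: ler_wpM2l => //.
exact: mx_ge1_ge0.
Qed.

Definition elem w l : mx := fun a b => (a == b)%:R + ((a == w) && (b == l))%:R.

Lemma elem_ge1 w l : mx_ge1 (elem w l).
Proof. by move=> a b; rewrite /elem lerDl ler0n. Qed.

Lemma mmul_elem M w l a b :
  mmul M (elem w l) a b = M a b + (b == l)%:R * M a w.
Proof.
rewrite /mmul /elem; under eq_bigr do rewrite mulrDr.
rewrite big_split /= sum_delta_r; congr (_ + _).
rewrite (bigD1 w) //= eqxx /= big1 ?addr0 1?mulrC // => c /negbTE->.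
by rewrite mulr0.
Qed.

End Matrices.

Section Acceleration.
Context {R : realType} {A : finType}.
Variables (D : iem_data R A) (e_ : nat -> bool) (w_ l_ : nat -> A).
Hypotheses (gD : good D) (A1 : (1 < #|A|)%N) (irr : irreducible D)
  (specs : forall n, step_spec (rv_data D n) (e_ n) (w_ n) (l_ n)).

Lemma rv_mxS n : rv_mx D n.+1 = elem (w_ n) (l_ n).
Proof. by rewrite /rv_mx /=; case: (specs n) => ->. Qed.

Lemma rv_nameS n : rv_name D n.+1 = Some (w_ n).
Proof. by rewrite /rv_name /=; case: (specs n) => ->. Qed.

Lemma mprodS m j :
  mprod D m j.+1 = mmul (mprod D m j) (elem (w_ (m + j)) (l_ (m + j))).
Proof. by rewrite /= addnS rv_mxS. Qed.

Lemma mprod_add m i j :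
  mprod D m (i + j) = mmul (mprod D m i) (mprod D (m + i) j).
Proof.
elim: j => [|j IH]; first by rewrite addn0 mmulm1.
by rewrite addnS !mprodS IH mmulA addnA.
Qed.

Lemma mprod_cat i j k : (i <= j)%N -> (j <= k)%N ->
  mmul (mprod D i (j - i)) (mprod D j (k - j)) = mprod D i (k - i).
Proof.
move=> ij jk; rewrite -[X in mmul _ (mprod _ X _)](subnKC ij) -mprod_add.
by congr mprod; lia.
Qed.

Lemma mprod_ge1 m j : mx_ge1 (mprod D m j).
Proof.
elim: j => [|j IH]; first exact: idm_ge1.
by rewrite mprodS; apply: mmul_ge1 => //; exact: elem_ge1.
Qed.

Lemma mprod_lam m j a :
  lam (rv_data D m) a = \sum_b mprod D m j a b * lam (rv_data D (m + j)) b.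
Proof.
elim: j a => [|j IH] a; first by rewrite addn0 sum_delta_l.
rewrite IH mprodS addnS; under [RHS]eq_bigr do rewrite mmul_elem mulrDl.
have sp := specs (m + j); have wl := step_neq sp.
rewrite big_split /= [in RHS](bigD1 (w_ (m + j))) //= (bigD1 (w_ (m + j))) //=.
rewrite [X in _ = _ + X](bigD1 (l_ (m + j))) //= eqxx mul1r.
rewrite [X in _ = _ + (_ + X)]big1 ?addr0; last first.
  by move=> b /negbTE->; rewrite !mul0r.
rewrite (step_lam_w sp) (step_lam_l sp) mulrBr addrAC subrK; congr (_ + _).
by apply: eq_bigr => b bw; rewrite (step_lam_other sp).
Qed.

(** Each factor adds column [w] to column [l], in particular a diagonal entry, which is at least 1.
    The norm of a block matrix thus bounds the number of steps in the block. *)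
Lemma mprod_mnorm_ge m j : j%:R <= mnorm (mprod D m j).
Proof.
elim: j => [|j IH]; first exact: mnorm_ge0.
have M1 := mprod_ge1 m j; rewrite -natr1 (mnorm_ge1E (mprod_ge1 _ _)) mprodS.
under eq_bigr do under eq_bigr do rewrite mmul_elem.
under eq_bigr do rewrite big_split /=.
rewrite big_split /= -(mnorm_ge1E M1) lerD //.
rewrite (bigD1 (w_ (m + j))) //= (bigD1 (l_ (m + j))) //= eqxx mul1r.
have /= := M1 (w_ (m + j)) (w_ (m + j)); rewrite eqxx /= => M1w.
rewrite -addrA; apply: le_trans M1w _; rewrite lerDl addr_ge0 //.
  by apply: sumr_ge0 => b _; rewrite mulr_ge0 ?ler0n // mx_ge1_ge0.
by apply: sumr_ge0 => c _; apply: sumr_ge0 => b _; rewrite mulr_ge0 ?ler0n // mx_ge1_ge0.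
Qed.

Section Support.
Variables (m : nat) (a : A).
(** The support of row [a], since the entries are nonnegative integers. *)
Let supp i := [set b | 1 <= mprod D m (i - m) a b]%SET.

Let suppS i : (m <= i)%N ->
  mprod D m (i.+1 - m) = mmul (mprod D m (i - m)) (elem (w_ i) (l_ i)).
Proof. by move=> mi; rewrite subSn // mprodS subnKC. Qed.

Let supp_sub i : (m <= i)%N -> supp i \subset supp i.+1.
Proof.
move=> mi; apply/fintype.subsetP => b; rewrite !inE suppS // => h.
apply: le_trans h _; apply: mmul_ge_l; [exact: mprod_ge1|exact: elem_ge1].
Qed.

Let supp_win i : (m <= i)%N -> w_ i \in supp i -> l_ i \in supp i.+1.
Proof.
move=> mi; rewrite !inE suppS // mmul_elem eqxx mul1r => h.
by apply: le_trans h _; rewrite lerDr mx_ge1_ge0 //; exact: mprod_ge1.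
Qed.

Let supp_step i : (m <= i)%N -> (#|supp i| < #|supp i.+1|)%N \/ supp i.+1 = supp i.
Proof.
move=> /supp_sub h; have [le|gt] := leqP #|supp i.+1| #|supp i|; last by left.
by right; apply/esym/eqP; rewrite eqEcard h.
Qed.

(* When the name changes, the new winner beats the old one, so its support is
   enlarged by the old winner. *)
Let supp_grow i1 i2 : (m <= i1)%N -> (i1 <= i2)%N -> w_ i1 \notin supp i1 ->
  w_ i2 \in supp i1 -> (#|supp i1| < #|supp i2.+1|)%N.
Proof.
move=> mi i12 w1 w2.
suff h n : (#|supp i1| < #|supp (i1 + n).+1|)%N \/
    (supp (i1 + n).+1 = supp i1 /\ w_ (i1 + n)%N \notin supp i1).
  by have := h (i2 - i1)%N; rewrite subnKC // w2 => -[//|[_]].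
elim: n => [|n IH].
  by rewrite addn0; have [|E] := supp_step mi; [left|right].
have mi' : (m <= (i1 + n).+1)%N by lia.
rewrite addnS; have [lt|[E wi]] := IH.
  by left; apply: leq_trans lt _; apply/subset_leq_card/supp_sub.
have [|E'] := supp_step mi'; first by rewrite E; left.
right; split; first by rewrite E' E.
apply/negP => wS; have [ww|lw] := winner_next gD specs (i1 + n).
  by rewrite ww (negbTE wi) in wS.
by have := supp_win mi'; rewrite E => /(_ wS); rewrite E' E lw (negbTE wi).
Qed.

Let supp_subset i j : (m <= i)%N -> (i <= j)%N -> supp i \subset supp j.
Proof.
move=> mi; elim: j => [|j IH]; first by rewrite leqn0 => /eqP->.
rewrite leq_eqVlt => /orP[/eqP->//|ij]; apply: fintype.subset_trans (IH ij) _.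
by apply: supp_sub; lia.
Qed.

Let supp_le i j : (m <= i)%N -> (i <= j)%N -> (#|supp i| <= #|supp j|)%N.
Proof. by move=> mi ij; apply/subset_leq_card/supp_subset. Qed.

(** As long as the support is not full, two sweeps enlarge it: in the first a letter outside it
    wins, in the second the letter [a] inside it wins, and [supp_grow] applies between these two
    moments. *)
Lemma supp_sweeps (t : nat -> nat) : t 0%N = m ->
  (forall k b, exists2 i, (t k <= i < t k.+1)%N & w_ i = b) ->
  forall j b, (#|A| <= j)%N -> 1 <= mprod D m (t (2 * j)%N - m) a b.
Proof.
move=> t0 sweep.
have tm k : (t k <= t k.+1)%N by have [i + _] := sweep k a; lia.
have mt k : (m <= t k)%N.
  by elim: k => [|k IH]; [rewrite t0|exact: leq_trans (tm k)].
have card j : (minn #|A| j.+1 <= #|supp (t (2 * j)%N)|)%N.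
  elim: j => [|j IH].
    rewrite muln0 t0; apply: leq_trans (geq_minr _ _) _; apply/card_gt0P.
    by exists a; rewrite inE subnn /= /idm eqxx.
  have [full|/eqP nfull] := eqVneq (supp (t (2 * j)%N)) [set: A]%SET.
    apply: leq_trans (geq_minl _ _) _; rewrite -cardsT -full.
    by apply: supp_le; rewrite // mulnS; apply: leq_trans (tm _) (tm _).
  have [b bS] : exists b, b \notin supp (t (2 * j)%N).
    by apply/existsP; apply: contraPT nfull => /existsPn h; apply; apply/setP => b;
       have := h b; rewrite negbK [in RHS]inE.
  have aS : a \in supp (t (2 * j)%N).
    rewrite inE; have := mprod_ge1 m (t (2 * j)%N - m) a a.
    by rewrite eqxx.
  have [i1 /andP[ti1 i1t] wi1] := sweep (2 * j)%N b.
  have [i2 /andP[ti2 i2t] wi2] := sweep (2 * j).+1 a.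
  have -> : (2 * j.+1 = (2 * j).+2)%N by lia.
  suff : (#|supp (t (2 * j)%N)| < #|supp (t (2 * j).+2)|)%N by lia.
  have mi1 : (m <= i1)%N := leq_trans (mt _) ti1.
  have le1 := supp_le (mt _) ti1; have [lt1|ge1] := ltnP #|supp (t (2 * j)%N)| #|supp i1|.
    by apply: leq_trans lt1 _; apply: supp_le => //; lia.
  have E : supp (t (2 * j)%N) = supp i1.
    by apply/eqP; rewrite eqEcard ge1 andbT; exact: supp_subset.
  rewrite E; apply: (@leq_trans #|supp i2.+1|).
    by apply: supp_grow; rewrite ?wi1 ?wi2 -?E //; lia.
  by apply: supp_le => //; lia.
move=> j b Aj; have /setP/(_ b) : supp (t (2 * j)%N) = [set: A]%SET.
  apply/eqP; rewrite eqEcard finset.subsetT cardsT.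
  by apply: leq_trans (card j); rewrite leq_min leqnn; lia.
by rewrite !inE.
Qed.

End Support.

Lemma names_betweenP m N a :
  reflect (exists2 i, (m <= i < N)%N & w_ i = a) (a \in names_between D m N).
Proof.
rewrite inE; apply: (iffP existsP) => [[[[|i] iN] /=]|[i /andP[mi iN] wi]].
- by [].
- by rewrite rv_nameS => /andP[mi /eqP[wi]]; exists i; rewrite // -ltnS mi -ltnS.
by exists (Ordinal (iN : (i.+1 < N.+1)%N)); rewrite /= ltnS mi rv_nameS wi /=.
Qed.

(** Recurrence of all names bounds the indices with at most [#|A|.-1] names, and [m] itself is such
    an index; so [acc_next] never takes its default value 0. *)
Lemma acc_nextP m : is_largest (at_most_dm1_names D m) (acc_next D m).
Proof.
apply: xgetPex; rewrite /at_most_dm1_names.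
have [N hN] : exists N, forall a, exists2 i, (m <= i < N)%N & w_ i = a.
  have /choice[i hi] : forall a, exists i, (m <= i)%N /\ w_ i = a.
    by move=> a; have [i mi wi] := winner_recurrent gD specs irr a m; exists i.
  exists (\max_a i a).+1 => a; have [mi wi] := hi a; exists (i a) => //.
  by rewrite mi ltnS (leq_bigmax a).
have names_N M : (N <= M)%N -> names_between D m M = [set: A]%SET.
  move=> NM; apply/setP => a; rewrite [in RHS]inE; apply/names_betweenP.
  have [i /andP[mi iN] wi] := hN a; exists i => //.
  by rewrite mi (leq_trans iN NM).
have PN M : (#|names_between D m M| <= #|A|.-1)%N -> (M <= N)%N.
  by move=> h; rewrite leqNgt; apply/negP => /ltnW/names_N E; move: h; rewrite E cardsT; lia.
have Pm : exists M, (#|names_between D m M| <= #|A|.-1)%N.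
  exists m; rewrite (_ : names_between D m m = finset.set0) ?cards0 //.
  by apply/setP => a; rewrite [in RHS]inE; apply/names_betweenP => -[i]; lia.
by case: (ex_maxnP Pm PN) => M PM maxM; exists M; split.
Qed.

Lemma acc_next_gt m : (m < acc_next D m)%N.
Proof.
have [_] := acc_nextP m; apply; rewrite /at_most_dm1_names.
apply: (@leq_trans #|[set w_ m]%SET|); last by rewrite cards1; lia.
apply/subset_leq_card/fintype.subsetP => a /names_betweenP[i mi <-].
by rewrite inE (_ : i = m) //; lia.
Qed.

(** By maximality, the block followed by one more step shows all names; the upper bound includes the
    first step of the next block. *)
Lemma acc_next_sweep m a : exists2 i, (m <= i <= acc_next D m)%N & w_ i = a.
Proof.
have [_ /(_ (acc_next D m).+1)] := acc_nextP m; rewrite /at_most_dm1_names ltnn.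
move=> h; have : a \in names_between D m (acc_next D m).+1.
  have -> : names_between D m (acc_next D m).+1 = [set: A]%SET.
    apply/eqP; rewrite eqEcard finset.subsetT cardsT /= leqNgt.
    by apply/negP => lt; suff : false by []; apply: h; rewrite -ltnS prednK // ltnW.
  by rewrite inE.
by move=> /names_betweenP[i ? ?]; exists i.
Qed.

Lemma acc_time_lt k : (acc_time D k < acc_time D k.+1)%N.
Proof. exact: acc_next_gt. Qed.

Lemma acc_time_le k l : (k <= l)%N -> (acc_time D k <= acc_time D l)%N.
Proof.
elim: l => [|l IH]; first by rewrite leqn0 => /eqP->.
rewrite leq_eqVlt => /orP[/eqP->//|kl].
exact: leq_trans (IH kl) (ltnW (acc_time_lt l)).
Qed.

Lemma acc_time_sweep k a :
  exists2 i, (acc_time D k <= i < acc_time D k.+2)%N & w_ i = a.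
Proof.
have [i /andP[h1 h2] wi] := acc_next_sweep (acc_time D k) a; exists i => //.
by rewrite h1; exact: leq_ltn_trans (acc_time_lt k.+1).
Qed.

Lemma QmxE k l : (k <= l)%N ->
  Qmx D k l = mprod D (acc_time D k) (acc_time D l - acc_time D k).
Proof.
move=> /subnKC <-; rewrite /Qmx addKn; elim: (l - k)%N => [|j IH].
  by rewrite addn0 subnn.
have h1 := acc_time_le (leq_addr j k); have h2 := acc_time_lt (k + j).
by rewrite /= IH /Zmx addnS mprod_cat // ltnW.
Qed.

Lemma Qmx_ge1 k l : mx_ge1 (Qmx D k l).
Proof.
have [kl|lk] := leqP k l; first by rewrite QmxE //; exact: mprod_ge1.
by rewrite /Qmx (_ : l - k = 0)%N; [exact: idm_ge1|lia].
Qed.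

Lemma Qmx_id k : Qmx D k k = idm.
Proof. by rewrite /Qmx subnn. Qed.

Lemma Qmx_mul k l m : (k <= l)%N -> (l <= m)%N ->
  Qmx D k m = mmul (Qmx D k l) (Qmx D l m).
Proof.
move=> kl lm; have km := leq_trans kl lm; rewrite !QmxE //.
have h1 := acc_time_le kl; have h2 := acc_time_le lm.
by rewrite mprod_cat.
Qed.

Lemma Zmx_Qmx k : Zmx D k.+1 = Qmx D k k.+1.
Proof. by rewrite QmxE. Qed.

Lemma Qmx_pos k a b : 1 <= Qmx D k (k + 4 * #|A|) a b.
Proof.
rewrite QmxE ?leq_addr //.
(* A sweep takes two accelerated steps, and [supp_sweeps] takes [2 * #|A|] sweeps; hence
   [4 * #|A|]. *)
pose t i := acc_time D (k + 2 * i).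
have -> : acc_time D (k + 4 * #|A|) = t (2 * #|A|)%N by rewrite /t; congr acc_time; lia.
apply: supp_sweeps => //; first by rewrite /t addn0.
move=> j c; have [i hi wi] := acc_time_sweep (k + 2 * j) c; exists i => //.
by rewrite /t (_ : k + 2 * j.+1 = (k + 2 * j).+2)%N //; lia.
Qed.

Lemma Qmx_lam k a :
  lam D a = \sum_b Qmx D 0 k a b * lam (rv_data D (acc_time D k)) b.
Proof. by rewrite QmxE // subn0; exact: (mprod_lam 0 (acc_time D k)). Qed.

End Acceleration.

Section TransposeAction.
Context {R : realType} {A : finType}.
Implicit Types (M N : @mx R A) (v : A -> R).

(** The action of the transpose, so that [vapp (Qmx D k l)] is [Smap D k l]. *)
Definition vapp M v : A -> R := fun a => \sum_b M b a * v b.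

Lemma vapp_mul M N v : vapp (mmul M N) v = vapp N (vapp M v).
Proof.
apply/funext => a; rewrite /vapp /mmul.
under eq_bigr do rewrite mulr_suml.
under [RHS]eq_bigr do rewrite mulr_sumr.
rewrite exchange_big; apply: eq_bigr => b _; apply: eq_bigr => c _.
by rewrite mulrCA mulrA.
Qed.

Lemma vapp_idm v : vapp idm v = v.
Proof.
apply/funext => a; rewrite /vapp -[RHS]sum_delta_l.
by apply: eq_bigr => b _; rewrite /idm eq_sym.
Qed.

Lemma vapp_elem w l v a : vapp (elem w l) v a = v a + (a == l)%:R * v w.
Proof.
rewrite /vapp /elem; under eq_bigr do rewrite mulrDl.
rewrite big_split /=; congr (_ + _).
  by rewrite -[RHS]sum_delta_l; apply: eq_bigr => b _; rewrite eq_sym.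
rewrite (bigD1 w) //= eqxx /= big1 ?addr0 // => b /negbTE->.
by rewrite mul0r.
Qed.

Lemma vappZr M v c : vapp M (fun b => v b * c) = fun a => vapp M v a * c.
Proof.
by apply/funext => a; rewrite /vapp mulr_suml; apply: eq_bigr => b _; rewrite mulrA.
Qed.

Lemma vappD M v w : vapp M (fun b => v b + w b) = fun a => vapp M v a + vapp M w a.
Proof.
apply/funext => a; rewrite /vapp -big_split /=.
by apply: eq_bigr => b _; rewrite mulrDr.
Qed.

Lemma vappN M v : vapp M (fun b => - v b) = fun a => - vapp M v a.
Proof.
by apply/funext => a; rewrite /vapp -sumrN; apply: eq_bigr => b _; rewrite mulrN.
Qed.

Lemma vappB M v w : vapp M (fun b => v b - w b) = fun a => vapp M v a - vapp M w a.
Proof. by rewrite vappD vappN. Qed.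

Lemma vnorm_ge0 v : 0 <= vnorm v. Proof. exact: sumr_ge0. Qed.

Lemma vnorm_entry v a : `|v a| <= vnorm v.
Proof. exact: (ler_sum_term (f := fun a => `|v a|)). Qed.

Lemma vnormD v w : vnorm (fun a => v a + w a) <= vnorm v + vnorm w.
Proof. by rewrite /vnorm -big_split; apply: ler_sum => a _; exact: ler_normD. Qed.

Lemma vnormN v : vnorm (fun a => - v a) = vnorm v.
Proof. by apply: eq_bigr => a _; rewrite normrN. Qed.

Lemma vnormB v w : vnorm (fun a => v a - w a) <= vnorm v + vnorm w.
Proof. by apply: le_trans (vnormD _ _) _; rewrite vnormN. Qed.

Lemma vnormZ v c : vnorm (fun a => v a * c) = vnorm v * `|c|.
Proof. by rewrite /vnorm mulr_suml; apply: eq_bigr => a _; rewrite normrM. Qed.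

Lemma vnorm_vapp M v : vnorm (vapp M v) <= mnorm M * vnorm v.
Proof.
apply: (@le_trans _ _ (\sum_a \sum_b `|M b a| * `|v b|)).
  apply: ler_sum => a _; apply: le_trans (ler_norm_sum _ _ _) _.
  by apply: ler_sum => b _; rewrite normrM.
rewrite exchange_big /= /vnorm mulr_sumr; apply: ler_sum => b _.
by rewrite -mulr_suml; apply: ler_wpM2r => //; exact: mnorm_row.
Qed.

Lemma vapp_const_le M c a : mx_ge1 M -> 0 <= c ->
  vapp M (fun=> c) a <= mnorm M * c.
Proof.
move=> M1 c0; rewrite /vapp -mulr_suml; apply: ler_wpM2r => //.
rewrite (mnorm_ge1E M1) exchange_big /=.
apply: (ler_sum_term (f := fun a => \sum_b M b a)) => b.
by apply: sumr_ge0 => d _; exact: mx_ge1_ge0.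
Qed.

End TransposeAction.

(** * Special Birkhoff sums *)

Section LocalCocycle.
Context {R : realType} {A : finType}.
Variables (D : iem_data R A) (e_ : nat -> bool) (w_ l_ : nat -> A).
Hypotheses (gD : good D)
  (specs : forall n, step_spec (rv_data D n) (e_ n) (w_ n) (l_ n)).
Local Notation ln n := (lam (rv_data D n)).
Implicit Types (P U : A -> R -> R) (h t : R).

(* A function on I is read on each exchanged interval in the coordinate
   t = x - left_end; in these coordinates the special Birkhoff sum of a step does
   not depend on its type. *)
Fixpoint coc P n : A -> R -> R :=
  match n with
  | 0 => P
  | n'.+1 => fun a t =>
     coc P n' a t + (a == l_ n')%:R * coc P n' (w_ n') (ln n'.+1 (w_ n') + t)
  end.

Let lnS_w n : ln n.+1 (w_ n) = ln n (w_ n) - ln n (l_ n).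
Proof. exact: step_lam_w (specs n). Qed.

Let lnS_l n : ln n.+1 (l_ n) = ln n (l_ n).
Proof. exact: step_lam_l (specs n). Qed.

Let lnS_le n a : ln n.+1 a <= ln n a.
Proof. exact: step_lam_le (orbit_good gD specs n) (specs n) _. Qed.

Let ln_gt0 n a : 0 < ln n a.
Proof. exact: (orbit_good gD specs n).2. Qed.

(** The recursion is linear and commutes with shifts of the coordinate, so a bound on the recursion
    applies to increments as well as to values. *)
Lemma coc_incr P h n a t :
  coc (fun b s => P b (s + h) - P b s) n a t = coc P n a (t + h) - coc P n a t.
Proof. by elim: n a t => //= n IH a t; rewrite !IH addrA; ring. Qed.

(** Functions constant on each interval evolve by the transposed matrices; this is how [chi] enters
    the special sums. *)
Lemma coc_sub_const P v n a t :
  coc (fun b s => P b s - v b) n a t = coc P n a t - vapp (mprod D 0 n) v a.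
Proof.
elim: n a t => [|n IH] a t; first by rewrite /= vapp_idm.
rewrite /= !IH -/(mprod D 0 n.+1) (mprodS specs) add0n vapp_mul vapp_elem; ring.
Qed.

(** The margin [h] keeps [t + h] inside the interval: [h = 0] serves for values, [h > 0] for
    increments of length [h]. *)
Lemma coc_cmp P h m (u c : A -> R) : 0 <= h ->
  (forall b t, 0 <= t <= ln m b - h -> `|coc P m b t - u b| <= c b) ->
  forall j b t, 0 <= t <= ln (m + j) b - h ->
    `|coc P (m + j) b t - vapp (mprod D m j) u b| <= vapp (mprod D m j) c b.
Proof.
move=> h0 base; elim=> [|j IH] b t.
  by rewrite addn0 !vapp_idm; exact: base.
rewrite (mprodS specs) !vapp_mul !vapp_elem addnS [coc P _.+1 b t]/= => /andP[t0 tb].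
have [bl|bl] := eqVneq b (l_ (m + j)); last first.
  rewrite !mul0r !addr0; apply: IH; rewrite t0 /=.
  by apply: le_trans tb _; rewrite lerD2r.
rewrite !mul1r bl in tb *; rewrite opprD addrACA.
apply: le_trans (ler_normD _ _) (lerD _ _); apply: IH.
  by rewrite t0 /= -lnS_l.
have := ln_gt0 (m + j).+1 (w_ (m + j)); move: tb; rewrite lnS_l lnS_w => ? ?.
by apply/andP; split; lra.
Qed.

(** The winner's interval is cut in two and the second piece is joined to the loser's, so total
    increments are conserved. This is the invariance of the integral of a derivative under
    induction. *)
Lemma coc_total P n :
  \sum_a (coc P n a (ln n a) - coc P n a 0) = \sum_a (P a (lam D a) - P a 0).
Proof.
elim: n => [//|n <-]; have wl := step_neq (specs n).
rewrite (bigD1 (l_ n)) //= (bigD1 (w_ n)) //=.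
rewrite [RHS](bigD1 (l_ n)) //= [in RHS](bigD1 (w_ n)) //=.
rewrite eqxx (negbTE wl) !mul0r !addr0 !mul1r lnS_l lnS_w subrK !addrA.
set S1 := \sum_(i | _) _; set S2 := \sum_(i | _) _.
have -> : S1 = S2.
  apply: eq_bigr => b /andP[bl bw].
  by rewrite (negbTE bl) !mul0r !addr0 -[rv_step _]/(rv_data D n.+1) (step_lam_other (specs n)).
ring.
Qed.

(* Over any subinterval [x, y] the difference quotients of P oscillate by at most
   U y - U x. *)
Definition slope_ctl P U (len : A -> R) := forall a x y t1 h1 t2 h2,
  0 <= x -> y <= len a -> x <= t1 -> t1 + h1 <= y -> 0 < h1 ->
  x <= t2 -> t2 + h2 <= y -> 0 < h2 ->
  `|(P a (t1 + h1) - P a t1) / h1 - (P a (t2 + h2) - P a t2) / h2| <= U a y - U a x.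

Lemma coc_slope_ctl P U n : slope_ctl P U (lam D) ->
  slope_ctl (coc P n) (coc U n) (ln n).
Proof.
move=> ctl; elim: n => [//|n IH] a x y t1 h1 t2 h2 x0 ya xt1 ty1 h10 xt2 ty2 h20.
have [al|al] := eqVneq a (l_ n); last first.
  rewrite /= (negbTE al) !mul0r !addr0; apply: IH => //.
  exact: le_trans (lnS_le n a).
rewrite al in ya *; rewrite /= eqxx !mul1r -[rv_step _]/(rv_data D n.+1).
set c := ln n.+1 (w_ n).
have c0 : 0 < c := ln_gt0 _ _.
have cE : c = ln n (w_ n) - ln n (l_ n) := lnS_w n.
rewrite lnS_l in ya.
have h := IH (l_ n) x y t1 h1 t2 h2 x0 ya xt1 ty1 h10 xt2 ty2 h20.
have h' : `|(coc P n (w_ n) (c + t1 + h1) - coc P n (w_ n) (c + t1)) / h1 -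
            (coc P n (w_ n) (c + t2 + h2) - coc P n (w_ n) (c + t2)) / h2| <=
          coc U n (w_ n) (c + y) - coc U n (w_ n) (c + x).
  by apply: IH => //; lra.
rewrite !addrA; set X1 := coc P n (l_ n) (t1 + h1) in h *.
set Y1 := coc P n (w_ n) (c + t1 + h1) in h' *.
set X2 := coc P n (l_ n) (t2 + h2) in h *.
set Y2 := coc P n (w_ n) (c + t2 + h2) in h' *.
apply: le_trans (_ : _ <= coc U n (l_ n) y - coc U n (l_ n) x +
  (coc U n (w_ n) (c + y) - coc U n (w_ n) (c + x))) _; last lra.
apply: le_trans (lerD h h'); apply: le_trans (ler_normD _ _).
by rewrite le_eqVlt; apply/orP; left; apply/eqP; congr `|_|; ring.
Qed.

Definition mean_slope P n a := (coc P n a (ln n a) - coc P n a 0) / ln n a.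

(** The quotients over one interval oscillate by at most the increment of the transported [U]. The
    sum of these increments over all intervals is conserved by [coc_total], which makes the bound
    independent of [n]. *)
Lemma mean_slope_ctl P U n : slope_ctl P U (lam D) ->
  forall a t h, 0 < h -> 0 <= t <= ln n a - h ->
  `|coc P n a (t + h) - coc P n a t - mean_slope P n a * h| <=
  (\sum_b (U b (lam D b) - U b 0)) * h.
Proof.
move=> ctl a t h h0 /andP[t0 th].
have ctln : slope_ctl (coc P n) (coc U n) (ln n) by exact: coc_slope_ctl.
have Uge b : 0 <= coc U n b (ln n b) - coc U n b 0.
  apply: le_trans (ctln b 0 (ln n b) 0 (ln n b) 0 (ln n b) _ _ _ _ _ _ _ _);
  by rewrite ?add0r ?lexx.
have /= := ctln a 0 (ln n a) t h 0 (ln n a) (lexx _) (lexx _).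
rewrite add0r t0 h0 lexx ln_gt0 => /(_ isT _ isT (lexx _) isT isT) H.
rewrite -(coc_total U n).
have -> : coc P n a (t + h) - coc P n a t - mean_slope P n a * h =
    ((coc P n a (t + h) - coc P n a t) / h - mean_slope P n a) * h.
  by rewrite mulrBl divfK // gt_eqF.
rewrite normrM (gtr0_norm h0) ler_pM2r //.
apply: le_trans (H _) _; first lra.
exact: (ler_sum_term (f := fun b => coc U n b (ln n b) - coc U n b 0)).
Qed.

End LocalCocycle.

(** * Birkhoff sums in terms of special Birkhoff sums *)

Section Birkhoff.
Context {R : realType} {A : finType}.
Variables (D : iem_data R A) (e_ : nat -> bool) (w_ l_ : nat -> A).
Hypotheses (gD : good D)
  (specs : forall n, step_spec (rv_data D n) (e_ n) (w_ n) (l_ n)).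
Local Notation Dn n := (rv_data D n).
Local Notation T n := (iem_map (Dn n)).
Variable F : R -> R.

(** Special Birkhoff sums in the coordinate of [I]: the return time of a step is two on the loser's
    interval and one elsewhere. *)
Fixpoint gcoc n : R -> R :=
  match n with
  | 0 => F
  | n'.+1 => fun x => gcoc n' x +
      (if (left_end (Dn n'.+1) (l_ n') <= x) && (x < right_end (Dn n'.+1) (l_ n'))
       then gcoc n' (T n' x) else 0)
  end.

Let gDn n : good (Dn n) := orbit_good gD specs n.

Let in_loser n a t : 0 <= t < lam (Dn n.+1) a ->
  ((left_end (Dn n.+1) (l_ n) <= start (Dn n.+1) false a + t) &&
   (start (Dn n.+1) false a + t < right_end (Dn n.+1) (l_ n))) = (a == l_ n).
Proof.
move=> /andP[t0 ta]; apply/idP/eqP => [/andP[h1 h2]|al]; last first.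
  by rewrite /left_end /right_end -al lerDl t0 ltrD2l ta.
pose s := start (Dn n.+1) false a + t - start (Dn n.+1) false (l_ n).
apply: (@pstart_inj _ _ _ _ _ _ t s ((gDn n.+1).1 false) (gDn n.+1).2).
- by rewrite t0.
- by rewrite /s; move: h1 h2; rewrite /left_end /right_end => ? ?; apply/andP; split; lra.
- by rewrite /s -!start_pstart; ring.
Qed.

Lemma gcoc_coc P n a t :
  (forall b s, 0 <= s < lam D b -> F (start D false b + s) = P b s) ->
  0 <= t < lam (Dn n) a ->
  gcoc n (start (Dn n) false a + t) = coc D w_ l_ P n a t.
Proof.
move=> FP; elim: n a t => [|n IH] a t ta; first exact: FP.
rewrite [LHS]/= (in_loser ta) [RHS]/=.
have sp := specs n; have gn := gDn n.
have [al|al] := eqVneq a (l_ n); last first.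
  rewrite mul0r !addr0 [rv_step _]/= (step_start_other gn sp) // IH //.
  case/andP: ta => -> /= ta; exact: lt_le_trans ta (step_lam_le gn sp a).
rewrite mul1r al in ta *; rewrite [rv_step _]/=.
have tl : 0 <= t < lam (Dn n) (l_ n) by move: ta; rewrite (step_lam_l sp).
have tw : 0 <= lam (Dn n.+1) (w_ n) + t < lam (Dn n) (w_ n).
  case/andP: tl => t0 tl; have := (gDn n.+1).2 (w_ n).
  by rewrite (step_lam_w sp) => ?; apply/andP; split; lra.
have [] := step_loser_orbit gn sp tl.
case: (e_ n) => -[-> ->] _; rewrite (IH _ _ tl) (IH _ _ tw) //.
(* For type [true] the winner's interval is visited first. *)
exact: addrC.
Qed.

Definition bsum n N x := \sum_(i < N) gcoc n (iter i (T n) x).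

Lemma bsumS n N x : bsum n N.+1 x = gcoc n x + bsum n N (T n x).
Proof.
rewrite /bsum big_ord_recl /=; congr (_ + _).
by apply: eq_bigr => i _; rewrite add0n -iterS iterSr.
Qed.

Let Iset_sub n x : Iset (Dn n.+1) x -> Iset (Dn n) x.
Proof.
rewrite /Iset /= (step_total (specs n)) => /andP[-> /= xt].
by apply: lt_trans xt _; rewrite ltrBlDr ltrDl (gDn n).2.
Qed.

(** The orbit splits into complete returns, except possibly for one last value. *)
Let step_bsum_inside n (B : R) N x : (forall y, Iset (Dn n) y -> `|gcoc n y| <= B) ->
  Iset (Dn n.+1) x -> exists2 N', (N' <= N)%N &
  `|bsum n N x - bsum n.+1 N' x| <= B.
Proof.
move=> gB; have sp := specs n; have gn := gDn n.
elim/ltn_ind: N x => -[|N] IH x xI.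
  exists 0%N => //; rewrite /bsum !big_ord0 subrr normr0.
  exact: le_trans (gB x (Iset_sub xI)).
have TxI := iem_map_Iset (gDn n.+1) xI.
have [a [t [ta xE]]] := Iset_cover (gDn n.+1) xI.
have gx : gcoc n.+1 x = gcoc n x + if a == l_ n then gcoc n (T n x) else 0.
  by rewrite xE [LHS]/= (in_loser ta).
have [al|al] := eqVneq a (l_ n); last first.
  rewrite (negbTE al) addr0 in gx.
  have Tx : T n.+1 x = T n x by rewrite xE; exact: (step_map_other gn sp al ta).
  have [N' N'N h] := IH N (ltnSn N) _ TxI; exists N'.+1 => //.
  by rewrite !bsumS gx opprD addrACA subrr add0r -Tx.
rewrite al eqxx in gx; have Tx : T n.+1 x = T n (T n x).
  rewrite xE al; have [] // := step_loser_orbit gn sp (t := t).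
  by rewrite -(step_lam_l sp) -al.
(* The sum may stop in the middle of a return, leaving one unpaired value. *)
case: N IH => [|N] IH.
  exists 0%N => //; rewrite /bsum big_ord1 big_ord0 subr0 /=; exact/gB/Iset_sub.
have [N' N'N h] := IH N (leqnSn _) _ TxI; exists N'.+1; first by lia.
by rewrite !bsumS gx addrA opprD addrACA subrr add0r -Tx.
Qed.

(** One [B] pays for an unpaired value at the end, the other for a first point outside the induced
    interval. *)
Lemma step_bsum n (B : R) N x : (forall y, Iset (Dn n) y -> `|gcoc n y| <= B) ->
  Iset (Dn n) x -> exists N' x', [/\ (N' <= N)%N, Iset (Dn n.+1) x' &
  `|bsum n N x| <= B *+ 2 + `|bsum n.+1 N' x'|].
Proof.
move=> gB xI; have B0 : 0 <= B by exact: le_trans (gB x xI).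
have [xI'|xI'] := pselect (Iset (Dn n.+1) x).
  have [N' N'N h] := step_bsum_inside N gB xI'; exists N', x; split=> //.
  rewrite -[bsum n N x](subrK (bsum n.+1 N' x)); apply: le_trans (ler_normD _ _) _.
  by rewrite lerD2r mulr2n; apply: le_trans h _; rewrite lerDl.
have TxI : Iset (Dn n.+1) (T n x).
  case/andP: (xI) => x0 xt; apply: (step_map_outside (gDn n) (specs n)) => //.
  by rewrite leNgt; apply/negP => xt'; apply: xI'; rewrite /Iset /= x0.
case: N => [|N].
  exists 0%N, (T n x); split=> //; rewrite /bsum !big_ord0 normr0 addr0.
  by rewrite mulrn_wge0.
have [N' N'N h] := step_bsum_inside N gB TxI; exists N', (T n x); split=> //.
  exact: leqW.
rewrite bsumS; apply: le_trans (ler_normD _ _) _; rewrite mulr2n -addrA lerD ?gB //.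
rewrite -[bsum n N _](subrK (bsum n.+1 N' (T n x))).
by apply: le_trans (ler_normD _ _) _; rewrite lerD2r.
Qed.

Lemma bsum_bounded (B : nat -> R) (C : R) :
  (forall n y, Iset (Dn n) y -> `|gcoc n y| <= B n) ->
  (forall K, \sum_(n < K) B n <= C) ->
  forall N x, Iset D x -> `|bsum 0 N x| <= C *+ 2 + 1.
Proof.
move=> gB BC N x xI.
have B0 n : 0 <= B n.
  apply: le_trans (gB n 0 _) => //; rewrite /Iset /= lexx /=.
  have [a _] : exists a : A, true by exists (w_ 0%N).
  by rewrite /Defs.total (bigD1 a) //= ltr_wpDr ?(gDn n).2 // sumr_ge0 // => b _;
    exact/ltW/(gDn n).2.
have C0 : 0 <= C by have := BC 0%N; rewrite big_ord0.
have step K : exists N' x', [/\ (N' <= N)%N, Iset (Dn K) x' &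
    `|bsum 0 N x| <= (\sum_(n < K) B n) *+ 2 + `|bsum K N' x'|].
  elim: K => [|K [N' [x' [N'N x'I h]]]].
    by exists N, x; rewrite big_ord0 mul0rn add0r.
  have [N2 [x2 [N2N' x2I h2]]] := step_bsum N' (gB K) x'I.
  exists N2, x2; split=> //; first exact: leq_trans N'N.
  have -> : \sum_(n < K.+1) B n = \sum_(n < K) B n + B K by rewrite big_ord_recr.
  by rewrite mulrnDl -addrA; apply: le_trans h _; exact: lerD.
(* After [K] steps at most [N] terms remain, each bounded by [B K]. As the partial sums of [B] are
   bounded, some [K] makes the remainder at most 1, which is the added 1 of the bound. *)
have [K BK] : exists K, N%:R * B K <= 1.
  apply: contrapT => /forallNP h.
  have C1 K : K%:R <= N%:R * C.
    apply: le_trans (ler_wpM2l (ler0n _ _) (BC K)); rewrite mulr_sumr.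
    rewrite -[K in K%:R]card_ord -sumr_const; apply: ler_sum => i _.
    by have /negP := h i; rewrite -ltNge => /ltW.
  have := archi_boundP (mulr_ge0 (ler0n R N) C0).
  by rewrite ltNge C1.
have [N' [x' [N'N x'I h]]] := step K.
apply: le_trans h _; rewrite lerD ?lerMn2r ?BC ?orbT //.
apply: le_trans BK; rewrite /bsum; apply: le_trans (ler_norm_sum _ _ _) _.
apply: (@le_trans _ _ (\sum_(i < N') B K)).
  apply: ler_sum => i _; apply: gB; elim: (nat_of_ord i) => //= j.
  exact: iem_map_Iset.
have -> : \sum_(i < N') B K = N'%:R * B K by rewrite sumr_const card_ord mulr_natl.
by apply: ler_wpM2r; rewrite // ler_nat.
Qed.

End Birkhoff.

Section Coboundary.
Context {R : realType} {A : finType}.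
Variables (D : iem_data R A) (F : R -> R) (C : R).
Hypothesis gD : good D.
Let s N x := \sum_(i < N) F (iter i (iem_map D) x).
Hypothesis sC : forall N x, Iset D x -> `|s N x| <= C.

Let ubs x := [set y | exists m, forall n, (m <= n)%N -> s n x <= y].
Let Psi x := inf (ubs x).

Let has_inf_ubs x : Iset D x -> has_inf (ubs x).
Proof.
move=> xI; split.
  by exists C, 0%N => n _; apply: le_trans (ler_norm _) _; exact: sC.
exists (- C) => y [m hm]; have := hm m (leqnn m).
by apply: le_trans; have := sC m xI; rewrite ler_norml => /andP[].
Qed.

(* Psi is the upper limit of the Birkhoff sums. *)
Lemma bounded_coboundary : exists Psi : R -> R,
  (forall x, Iset D x -> `|Psi x| <= C) /\
  (forall x, Iset D x -> Psi x - Psi (iem_map D x) = F x).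
Proof.
have sS n x : s n.+1 x = F x + s n (iem_map D x).
  rewrite /s big_ord_recl /=; congr (_ + _).
  by apply: eq_bigr => i _; rewrite add0n -iterS iterSr.
exists Psi; split=> x xI.
  have [ne lb] := has_inf_ubs xI; rewrite ler_norml; apply/andP; split.
    apply: lb_le_inf => // y [m hm]; have := hm m (leqnn m).
    by apply: le_trans; have := sC m xI; rewrite ler_norml => /andP[].
  apply: ge_inf => //; exists 0%N => n _.
  by apply: le_trans (ler_norm _) _; exact: sC.
have TxI := iem_map_Iset gD xI.
have [ne lb] := has_inf_ubs xI; have [neT lbT] := has_inf_ubs TxI.
apply/eqP; rewrite subr_eq eq_le; apply/andP; split.
  rewrite -lerBlDl; apply: lb_le_inf => // y [m hm]; rewrite lerBlDl.
  apply: ge_inf => //; exists m.+1 => -[//|n] mn.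
  by rewrite sS lerD2l; exact: hm.
apply: lb_le_inf => // y [m hm]; rewrite -lerBrDl.
apply: ge_inf => //; exists m => n mn; rewrite lerBrDl -sS.
by apply: hm; exact: leqW.
Qed.

End Coboundary.

(** * Estimates under the Roth type conditions *)

Section Growth.
Context {R : realType}.
Variables (q : nat -> R) (r : nat).
Hypotheses (q1 : forall k, 1 <= q k) (r0 : (0 < r)%N)
  (qmono : forall k l, (k <= l)%N -> q k <= q l)
  (qdouble : forall k, 2 * q k <= q (k + r)%N).

Let q0 k : 0 < q k. Proof. exact: lt_le_trans (q1 k). Qed.

Lemma powR_base_le (x y a : R) : 0 < x -> x <= y -> 0 <= a -> x `^ a <= y `^ a.
Proof.
move=> x0 xy a0; apply: ge0_ler_powR => //; rewrite nnegrE ltW //.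
exact: lt_le_trans xy.
Qed.

Lemma powR_base_ge (x y a : R) : 0 < x -> x <= y -> a <= 0 -> y `^ a <= x `^ a.
Proof.
move=> x0 xy a0; rewrite -[a]opprK !(powRN _ (- a)) lef_pV2 ?posrE ?powR_gt0 //.
  by apply: powR_base_le; rewrite // oppr_ge0.
exact: lt_le_trans xy.
Qed.

Lemma powRDpos (x a b : R) : 0 < x -> x `^ (a + b) = x `^ a * x `^ b.
Proof. by move=> x0; rewrite powRD // (gt_eqF x0) implybT. Qed.

(** As [q] doubles every [r] indices, blocks of [r] terms decrease geometrically with ratio [kap];
    the constant solves [r + C * kap = C]. *)
Lemma sum_powR d : 0 < d -> exists2 C : R, 0 < C &
  forall k m, \sum_(k <= l < m) q l `^ (- d) <= C * q k `^ (- d).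
Proof.
move=> d0; pose kap : R := 2 `^ (- d).
have kap1 : kap < 1.
  rewrite /kap powRN invf_lt1 ?powR_gt0 // -[ltLHS](powRr0 2).
  rewrite /powR pnatr_eq0 /= ltr_expR ltr_pM2r // ln_gt0 // ltr1n //.
have k0 : 0 < 1 - kap by rewrite subr_gt0.
have f0 l : 0 < q l `^ (- d) by rewrite powR_gt0.
have [C CE] : exists C, C = r%:R / (1 - kap) by eexists.
have C0 : 0 < C by rewrite CE divr_gt0 // ltr0n.
exists C => // k m; have [n] := ubnP (m - k); elim: n => // n IH in k *.
rewrite ltnS => mkn.
have short j : (j <= r)%N -> \sum_(k <= l < k + j) q l `^ (- d) <= r%:R * q k `^ (- d).
  move=> jr; apply: (@le_trans _ _ (\sum_(k <= l < k + j) q k `^ (- d))).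
    apply: ler_sum_nat => l /andP[kl _]; apply: powR_base_ge => //; first exact: qmono.
    by rewrite oppr_le0 ltW.
  rewrite sumr_const_nat addKn -[leLHS]mulr_natl; apply: ler_wpM2r; first exact: ltW.
  by rewrite ler_nat.
have rC : r%:R + C * kap = C by rewrite CE; field; rewrite gt_eqF.
have [mk|km] := leqP m (k + r).
  have [mk'|km'] := leqP m k; first by rewrite big_geq // mulr_ge0 ?ltW.
  rewrite -[m in leLHS](subnKC (ltnW km')); apply: le_trans (short _ _) _; first lia.
  apply: ler_wpM2r; first exact: ltW.
  by rewrite -rC lerDl; apply: mulr_ge0; rewrite ltW // powR_gt0.
rewrite (big_cat_nat (leq_addr r k) (ltnW km)) /= -[C in leRHS]rC mulrDl.
apply: lerD; first exact: short.
apply: le_trans (IH (k + r)%N _) _; first lia.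
rewrite -mulrA; apply: ler_wpM2l; first exact: ltW.
rewrite /kap -powRM //; last exact: ltW.
apply: powR_base_ge; rewrite ?qdouble ?mulr_gt0 //.
by rewrite oppr_le0 ltW.
Qed.

(* A geometric interpolation between the two bounds makes the exponents of both
   q k and q l negative. *)
Lemma interpolate_sum (s d p : R) : 0 < s -> 0 < d -> 0 < p ->
  exists eps eta C : R, [/\ 0 < eps, 0 < eta, 0 < C &
  forall (K : R) k (x : nat -> R), 0 <= K ->
   (forall l, (l <= k)%N -> 0 <= x l) ->
   (forall l, (l <= k)%N -> x l <= K * (q k `^ (- s) * q l `^ p)) ->
   (forall l, (l <= k)%N -> x l <= K * (q k `^ eps * q l `^ (- d))) ->
   \sum_(0 <= l < k.+1) x l <= K * (C * q k `^ (- eta))].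
Proof.
(* The weight [t] is chosen so that [p * t - d * (1 - t) = - d / 2]. With [eps = s * t / 2] the
   exponent of [q k] is at most [- s * t / 2]. *)
move=> s0 d0 p0; have [t tE] : exists t, t = d / (2 * (p + d)) by eexists.
have pd0 : 0 < p + d by rewrite addr_gt0.
have t0 : 0 < t by rewrite tE divr_gt0 // mulr_gt0.
have t1 : t < 1 by rewrite tE ltr_pdivrMr ?mulr_gt0 // mul1r; lra.
have [C C0 sC] := sum_powR (divr_gt0 d0 (ltr0n R 2)).
exists (s * t / 2), (s * t / 2), (C * q 0%N `^ (- (d / 2))).
split; rewrite ?divr_gt0 ?mulr_gt0 ?powR_gt0 //.
move=> K k x K0 x0 x1 x2.
have xl l : (l <= k)%N -> x l <= K * (q k `^ (- (s * t / 2)) * q l `^ (- (d / 2))).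
  move=> lk; have [xz|xp] := leP (x l) 0.
    by apply: le_trans xz _; rewrite !mulr_ge0 ?powR_ge0.
  have -> : x l = x l `^ t * x l `^ (1 - t).
    by rewrite -powRDpos // subrKC powRr1 // ltW.
  apply: (@le_trans _ _ ((K * (q k `^ (- s) * q l `^ p)) `^ t *
    (K * (q k `^ (s * t / 2) * q l `^ (- d))) `^ (1 - t))).
    apply: ler_pM; rewrite ?powR_ge0 //; apply: powR_base_le => //.
    - exact: x1.
    - exact: ltW.
    - exact: x2.
    - by rewrite subr_ge0 ltW.
  rewrite !powRM ?mulr_ge0 ?powR_ge0 // -!powRrM.
  have -> : K `^ t * (q k `^ (- s * t) * q l `^ (p * t)) *
    (K `^ (1 - t) * (q k `^ (s * t / 2 * (1 - t)) * q l `^ (- d * (1 - t)))) =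
    (K `^ t * K `^ (1 - t)) * ((q k `^ (- s * t) * q k `^ (s * t / 2 * (1 - t))) *
    (q l `^ (p * t) * q l `^ (- d * (1 - t)))) by ring.
  have -> : K `^ t * K `^ (1 - t) = K.
    by rewrite -powRD ?subrKC ?powRr1 // oner_eq0.
  rewrite -!powRDpos //; apply: ler_wpM2l => //; apply: ler_pM; rewrite ?powR_ge0 //.
    apply: ler_powR => //; have : 0 < s * t * t by rewrite !mulr_gt0.
    by move=> ?; rewrite -subr_ge0; rewrite (_ : _ - _ = s * t * t / 2) ?divr_ge0 ?ltW //; field.
  rewrite le_eqVlt; apply/orP; left; apply/eqP; congr (_ `^ _).
  by rewrite tE; field; rewrite gt_eqF.
apply: (@le_trans _ _ (\sum_(0 <= l < k.+1)
    K * (q k `^ (- (s * t / 2)) * q l `^ (- (d / 2))))).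
  by apply: ler_sum_nat => l /andP[_ lk]; exact: xl.
rewrite -!mulr_sumr; apply: ler_wpM2l => //; rewrite mulrC.
by apply: ler_wpM2r; rewrite ?powR_ge0.
Qed.

End Growth.

(** * Determinants, inverses and coordinates in finite dimension *)

Section LinearAlgebra.
Context {R : realType} {A : finType}.
Implicit Types (M N : @mx R A) (v : A -> R).
Local Notation n := #|A|.

(** Transposed, so that [vapp] becomes multiplication of a column. *)
Definition tomx M : 'M[R]_n := \matrix_(i, j) M (enum_val j) (enum_val i).
Definition tocol v : 'cV[R]_n := \col_i v (enum_val i).

Lemma tocolK v a : tocol v (enum_rank a) 0 = v a.
Proof. by rewrite mxE enum_rankK. Qed.

Lemma sum_enum_val (f : A -> R) : \sum_(i < n) f (enum_val i) = \sum_a f a.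
Proof. by rewrite [RHS](reindex (@enum_val A A)) //=; exact/onW_bij/enum_val_bij. Qed.

Lemma tomx_vapp M v : tomx M *m tocol v = tocol (vapp M v).
Proof.
apply/matrixP => i j; rewrite !mxE /vapp -sum_enum_val.
by apply: eq_bigr => k _; rewrite !mxE.
Qed.

Lemma tomx_mul M N : tomx (mmul M N) = tomx N *m tomx M.
Proof.
apply/matrixP => i j; rewrite !mxE /mmul -sum_enum_val.
by apply: eq_bigr => k _; rewrite !mxE mulrC.
Qed.

Lemma det_tomx_idm : \det (tomx idm) = 1.
Proof.
rewrite (_ : tomx idm = 1%:M) ?det1 //; apply/matrixP => i j; rewrite !mxE /idm.
by rewrite eq_sym (inj_eq enum_val_inj).
Qed.

Lemma det_tomx_elem w l : w != l -> \det (tomx (elem w l)) = 1.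
Proof.
move=> wl; pose i0 : 'I_n := enum_rank l; pose j0 : 'I_n := enum_rank w.
have ij0 : i0 != j0 by rewrite (inj_eq enum_rank_inj) eq_sym.
(* Row [i0] is a sum of two unit rows. Splitting it gives the identity and a matrix whose rows [i0]
   and [j0] coincide, of determinant 0. *)
pose B : 'M[R]_n := 1%:M; pose C : 'M[R]_n := \matrix_(i, j) (j == (if i == i0 then j0 else i))%:R.
have E (i j : 'I_n) : tomx (elem w l) i j = (i == j)%:R + ((i == i0) && (j == j0))%:R.
  rewrite mxE /elem (inj_eq enum_val_inj) eq_sym; congr (_ + (_ : bool)%:R).
  by rewrite andbC; congr (_ && _); rewrite -(inj_eq enum_rank_inj) enum_valK.
rewrite (@determinant_multilinear _ _ _ B C i0 1 1).
- have -> : \det C = 0.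
    apply: (determinant_alternate ij0) => j; rewrite !mxE eqxx.
    by rewrite [j0 == i0]eq_sym (negbTE ij0).
  by rewrite det1 mulr1 mulr0 addr0.
- by apply/rowP => j; rewrite [LHS]mxE E !mxE eqxx /= !mul1r.
- apply/matrixP => i j; rewrite [LHS]mxE [RHS]mxE E [LHS]mxE.
  by rewrite [lift i0 i == i0]eq_sym (negbTE (neq_lift _ _)) addr0.
- apply/matrixP => i j; rewrite [LHS]mxE [RHS]mxE E [LHS]mxE.
  by rewrite [lift i0 i == i0]eq_sym (negbTE (neq_lift _ _)) addr0 eq_sym.
Qed.

Lemma det_bound m (B : 'M[R]_m) (x : R) : (forall i j, `|B i j| <= x) ->
  `|\det B| <= m`!%:R * x ^+ m.
Proof.
move=> Bx; apply: le_trans (ler_norm_sum _ _ _) _.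
apply: (@le_trans _ _ (\sum_(s : 'S_m) x ^+ m)); last first.
  by rewrite sumr_const card_Sn mulr_natl.
apply: ler_sum => s _; rewrite normrM normrX normrN1 expr1n mul1r normr_prod.
rewrite -[X in x ^+ X]card_ord -prodr_const; apply: ler_prod => i _.
by rewrite normr_ge0 Bx.
Qed.

(** For determinant 1 the inverse is the adjugate, whose entries are polynomial in those of [M]. The
    size of the power does not matter: the interpolation absorbs it. *)
Lemma vapp_inverse M v : \det (tomx M) = 1 -> 1 <= mnorm M ->
  exists2 u, vapp M u = v &
    vnorm u <= (n%:R * n`!%:R) * mnorm M ^+ n * vnorm v.
Proof.
move=> dM M1; pose u := \adj (tomx M) *m tocol v.
have uE : tocol (fun a => u (enum_rank a) 0) = u.
  by apply/colP => i; rewrite !mxE enum_valK.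
exists (fun a => u (enum_rank a) 0).
  apply/funext => a; rewrite -tocolK -tomx_vapp uE mulmxA mul_mx_adj dM mul1mx.
  exact: tocolK.
have adjb i j : `|\adj (tomx M) i j| <= n`!%:R * mnorm M ^+ n.
  rewrite mxE /cofactor normrM normrX normrN1 expr1n mul1r.
  apply: le_trans (det_bound (x := mnorm M) _) _.
    by move=> k k'; rewrite !mxE; exact: mnorm_entry.
  apply: ler_pM; rewrite ?exprn_ge0 ?ler0n ?mnorm_ge0 //.
    by rewrite ler_nat; apply: leq_fact; exact: leq_pred.
  by apply: ler_weXn2l => //; exact: leq_pred.
rewrite /vnorm -mulrA -mulrA mulr_natl -sumr_const; apply: ler_sum => a _.
rewrite mxE; apply: le_trans (ler_norm_sum _ _ _) _.
rewrite mulrA mulr_sumr -sum_enum_val; apply: ler_sum => i _.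
by rewrite normrM [tocol v i 0]mxE; apply: ler_wpM2r.
Qed.

(* Coordinates with respect to a family of vectors of G of maximal rank. *)
Lemma subspace_coord (G : set (A -> R)) :
  exists (m : nat) (b : 'I_m -> A -> R) (K : R),
    [/\ 0 <= K, forall i, G (b i) &
    forall v, G v -> exists c : 'I_m -> R,
      v = (fun a => \sum_i c i * b i a) /\ forall i, `|c i| <= K * vnorm v].
Proof.
pose GM (rk : nat) := `[< exists m (B : 'M[R]_(m, n)),
  (forall i, G (fun a => B i (enum_rank a))) /\ \rank B = rk >].
have GM0 : exists rk, GM rk.
  by exists 0%N; apply/asboolP; exists 0%N, 0; split; [case|rewrite mxrank0].
have GMn rk : GM rk -> (rk <= n)%N by move=> /asboolP[m [B [_ <-]]]; exact: rank_leq_col.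
case: (ex_maxnP GM0 GMn) => rk /asboolP[m [B [GB rB]]] rmax.
exists m, (fun i a => B i (enum_rank a)), (\sum_i \sum_j `|pinvmx B i j|).
split=> //; first by apply: sumr_ge0 => i _; exact: sumr_ge0.
move=> v Gv; pose v' : 'rV[R]_n := (tocol v)^T.
have vB : (v' <= B)%MS.
  apply: contraT => nvB; have : GM (\rank (col_mx B v')).
    apply/asboolP; exists (m + 1)%N, (col_mx B v'); split=> // i.
    case: (split_ordP i) => j ->.
      rewrite (_ : (fun a => _) = (fun a => B j (enum_rank a))) //.
      by apply/funext => a; rewrite col_mxEu.
    rewrite (_ : (fun a => _) = v) //.
    by apply/funext => a; rewrite col_mxEd !mxE enum_rankK.
  move=> /rmax; rewrite leqNgt -rB; apply: contraNT => _.
  by apply: rank_ltmx; rewrite /ltmx col_mx_sub submx_refl nvB andbT -addsmxE addsmxSl.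
exists (fun i => (v' *m pinvmx B) 0 i); split.
  apply/funext => a; have /matrixP/(_ 0 (enum_rank a)) := mulmxKpV vB.
  by rewrite [in RHS]mxE [RHS]mxE enum_rankK => <-; rewrite mxE.
move=> i; rewrite mxE; apply: le_trans (ler_norm_sum _ _ _) _.
rewrite mulr_sumr; under eq_bigr do rewrite normrM mulrC.
apply: (@le_trans _ _ (\sum_k (\sum_i \sum_j `|pinvmx B i j|) * `|v' 0 k|)).
  apply: ler_sum => k _; apply: ler_wpM2r => //.
  rewrite (bigD1 k) //= (bigD1 i) //= -addrA lerDl addr_ge0 ?sumr_ge0 //.
  by move=> j _; exact: sumr_ge0.
rewrite -mulr_sumr -mulr_sumr; apply: ler_wpM2l.
  by apply: sumr_ge0 => k _; exact: sumr_ge0.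
by rewrite -sum_enum_val; apply: ler_sum => k _; rewrite !mxE.
Qed.

End LinearAlgebra.

Section RothEstimates.
Context {R : realType} {A : finType}.
Variables (D : iem_data R A) (e_ : nat -> bool) (w_ l_ : nat -> A).
Hypotheses (gD : good D) (A1 : (1 < #|A|)%N) (irr : irreducible D)
  (specs : forall n, step_spec (rv_data D n) (e_ n) (w_ n) (l_ n)).
Local Notation Q := (@Qmx R A D).
Local Notation q k := (mnorm (Q 0 k)).
Local Notation S k l v := (vapp (Q k l) v).
Local Notation lk k := (lam (rv_data D (acc_time D k))).
Local Notation r := (4 * #|A|)%N.

Let Qmul k l m : (k <= l)%N -> (l <= m)%N -> Q k m = mmul (Q k l) (Q l m).
Proof. exact: (Qmx_mul gD A1 irr specs). Qed.

Lemma Q_ge1 k l : mx_ge1 (Q k l).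
Proof. exact: (Qmx_ge1 gD A1 irr specs). Qed.

Lemma S_comp k l m v : (k <= l)%N -> (l <= m)%N -> S k m v = S l m (S k l v).
Proof. by move=> kl lm; rewrite (Qmul kl lm) vapp_mul. Qed.

Lemma S_id k v : S k k v = v.
Proof. by rewrite /Qmx subnn vapp_idm. Qed.

Lemma Q_norm_mul k l m : (k <= l)%N -> (l <= m)%N ->
  mnorm (Q k m) <= mnorm (Q k l) * mnorm (Q l m).
Proof. by move=> kl lm; rewrite (Qmul kl lm); exact: mnormM. Qed.

Lemma Q_norm_ge1 k l : 1 <= mnorm (Q k l).
Proof.
by apply: le_trans (mnorm_ge_card (@Q_ge1 k l)); rewrite ler1n ltnW.
Qed.

Lemma Q_norm_gt0 k l : 0 < mnorm (Q k l).
Proof. exact: lt_le_trans (Q_norm_ge1 k l). Qed.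

Lemma Q_norm_le_r k l m : (k <= l)%N -> (l <= m)%N -> mnorm (Q l m) <= mnorm (Q k m).
Proof.
move=> kl lm; rewrite (Qmul kl lm).
apply: le_mnorm; first exact: Q_ge1.
  by apply: mmul_ge1; exact: Q_ge1.
by move=> a b; apply: mmul_ge_r; exact: Q_ge1.
Qed.

Lemma Q_norm_le_l k l m : (k <= l)%N -> (l <= m)%N -> mnorm (Q k l) <= mnorm (Q k m).
Proof.
move=> kl lm; rewrite (Qmul kl lm).
apply: le_mnorm; first exact: Q_ge1.
  by apply: mmul_ge1; exact: Q_ge1.
by move=> a b; apply: mmul_ge_l; exact: Q_ge1.
Qed.

Lemma q_mono k l : (k <= l)%N -> q k <= q l.
Proof. exact: Q_norm_le_l. Qed.

Lemma Q_norm_pos k j m : (j <= k)%N -> (k + r <= m)%N ->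
  mnorm (Q j k) * mnorm (Q (k + r) m) <= mnorm (Q j m).
Proof.
move=> jk km; rewrite (Qmul (leq_trans jk (leq_addr r k)) km) (Qmul jk (leq_addr r k)).
apply: mnorm_mul_pos; try exact: Q_ge1.
by move=> a b; exact: (Qmx_pos gD A1 irr specs).
Qed.

(** The factor 2 is the norm of the identity, [#|A|], which is at least 2. *)
Lemma q_double k : 2 * q k <= q (k + r)%N.
Proof.
apply: le_trans (Q_norm_pos (leq0n k) (leqnn (k + r))); rewrite mulrC.
apply: ler_wpM2l; first exact: mnorm_ge0.
by rewrite (Qmx_id D (k + r)) mnorm_idm ler_nat.
Qed.

Lemma r_gt0 : (0 < r)%N. Proof. by have := A1; lia. Qed.

Lemma powq_ge1 k (a : R) : 0 <= a -> 1 <= q k `^ a.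
Proof. by move=> a0; rewrite -(powRr0 (q k)); exact: ler_powR (Q_norm_ge1 _ _) _ _ a0. Qed.

Lemma powq_le k (a b : R) : a <= b -> q k `^ a <= q k `^ b.
Proof. by move=> ab; exact: ler_powR (Q_norm_ge1 _ _) _ _ ab. Qed.

Lemma powq_gt0 k (a : R) : 0 < q k `^ a.
Proof. by rewrite powR_gt0 // Q_norm_gt0. Qed.

Lemma powq_add k (a b : R) : q k `^ a * q k `^ b = q k `^ (a + b).
Proof. by rewrite -powRDpos // Q_norm_gt0. Qed.

Lemma powq_mono k l (a : R) : (k <= l)%N -> 0 <= a -> q k `^ a <= q l `^ a.
Proof. by move=> kl a0; apply: powR_base_le; rewrite ?Q_norm_gt0 ?q_mono. Qed.

(** Lengths go from level [l] back to level [k] by [Q(k, l)], and [S(k, l)] is its transpose, so the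
    pairing is preserved. *)
Lemma S_lam k l v : (k <= l)%N ->
  \sum_a lk l a * S k l v a = \sum_a lk k a * v a.
Proof.
move=> kl; rewrite /vapp.
under eq_bigr do rewrite mulr_sumr.
rewrite exchange_big; apply: eq_bigr => b _ /=.
rewrite (QmxE gD A1 irr specs kl) (mprod_lam specs (acc_time D k) (acc_time D l - acc_time D k)).
rewrite subnKC; last exact: (acc_time_le gD A1 irr specs).
by rewrite mulr_suml; apply: eq_bigr => a _; rewrite mulrCA mulrA.
Qed.

Lemma det_Q k : \det (tomx (Q 0 k)) = 1.
Proof.
rewrite (QmxE gD A1 irr specs) //; elim: (_ - _)%N => [|j IH]; first exact: det_tomx_idm.
rewrite (mprodS specs) tomx_mul det_mulmx IH mulr1.
by apply: det_tomx_elem; exact: step_neq (specs _).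
Qed.

Lemma S_inverse : exists2 K : R, 0 < K & forall k v, exists2 u,
  S 0 k u = v & vnorm u <= K * q k `^ #|A|%:R * vnorm v.
Proof.
exists (#|A|%:R * (#|A|)`!%:R) => [|k v].
  by rewrite mulr_gt0 // ltr0n ?fact_gt0 // ltnW.
rewrite powR_mulrn ?mnorm_ge0 //.
by apply: vapp_inverse; [exact: det_Q|exact: Q_norm_ge1].
Qed.

Section GammaS.

Lemma Gamma_sP k v : Gamma_s D k v <-> exists2 sigma : R, 0 < sigma &
  exists2 C : R, 0 <= C &
  forall l, (k <= l)%N -> vnorm (S k l v) <= C * mnorm (Q k l) `^ (- sigma).
Proof.
split=> [[s s0 [C C0 h]]|[s s0 [C C0 h]]].
  exists s => //; exists (C * vnorm v); first by rewrite mulr_ge0 ?vnorm_ge0 ?ltW.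
  move=> l kl; rewrite mulrAC; have := h l kl; rewrite /Snorm mnorm_tr.
  exact.
have [v0|vn0] := eqVneq (vnorm v) 0.
  exists 1 => //; exists 1 => // l kl; rewrite v0 mulr0.
  by apply: le_trans (vnorm_vapp _ _) _; rewrite v0 mulr0.
have vp : 0 < vnorm v by rewrite lt_neqAle eq_sym vn0 vnorm_ge0.
exists s => //; exists ((C + 1) / vnorm v).
  by rewrite divr_gt0 // ltr_wpDl.
move=> l kl; rewrite /Snorm mnorm_tr mulrAC divfK //.
apply: le_trans (h l kl) _; apply: ler_wpM2r; first exact: powR_ge0.
by rewrite lerDl.
Qed.

Lemma Gamma_s0 k : Gamma_s D k (fun=> 0).
Proof.
apply/Gamma_sP; exists 1 => //; exists 0 => // l kl; rewrite mul0r.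
apply: le_trans (vnorm_vapp _ _) _.
by rewrite /vnorm big1 ?mulr0 // => a _; rewrite normr0.
Qed.

Lemma Gamma_sD k v w : Gamma_s D k v -> Gamma_s D k w ->
  Gamma_s D k (fun a => v a + w a).
Proof.
move=> /Gamma_sP[s s0 [C C0 h]] /Gamma_sP[s' s'0 [C' C'0 h']].
apply/Gamma_sP; exists (Num.min s s'); first by rewrite lt_min s0.
exists (C + C'); first by rewrite addr_ge0.
move=> l kl; rewrite vappD; apply: le_trans (vnormD _ _) _.
rewrite mulrDl; apply: lerD.
  apply: le_trans (h l kl) _; apply: ler_wpM2l => //.
  by apply: ler_powR; rewrite ?Q_norm_ge1 // lerN2 ge_min lexx.
apply: le_trans (h' l kl) _; apply: ler_wpM2l => //.
by apply: ler_powR; rewrite ?Q_norm_ge1 // lerN2 ge_min lexx orbT.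
Qed.

Lemma Gamma_sZ k v c : Gamma_s D k v -> Gamma_s D k (fun a => v a * c).
Proof.
move=> /Gamma_sP[s s0 [C C0 h]]; apply/Gamma_sP; exists s => //.
exists (C * `|c|); first by rewrite mulr_ge0.
move=> l kl; rewrite vappZr vnormZ mulrAC; apply: ler_wpM2r => //.
exact: h.
Qed.

Lemma Gamma_sN k v : Gamma_s D k v -> Gamma_s D k (fun a => - v a).
Proof. by move=> /(@Gamma_sZ _ _ (-1)); under eq_fun do rewrite mulrN1. Qed.

Lemma Gamma_sB k v w : Gamma_s D k v -> Gamma_s D k w ->
  Gamma_s D k (fun a => v a - w a).
Proof. by move=> vG /Gamma_sN; exact: Gamma_sD. Qed.

Lemma Gamma_s_sum k (I : Type) (s : seq I) (P : pred I) (f : I -> A -> R) :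
  (forall i, P i -> Gamma_s D k (f i)) ->
  Gamma_s D k (fun a => \sum_(i <- s | P i) f i a).
Proof.
move=> h; elim: s => [|i s IH].
  by under eq_fun do rewrite big_nil; exact: Gamma_s0.
under eq_fun do rewrite big_cons.
case: (boolP (P i)) => Pi; last exact: IH.
by apply: (@Gamma_sD k (f i)) => //; exact: h.
Qed.

Lemma S_Gamma_s k l v : (k <= l)%N -> Gamma_s D k v -> Gamma_s D l (S k l v).
Proof.
move=> kl /Gamma_sP[s s0 [C C0 h]]; apply/Gamma_sP; exists s => //.
exists C => // m lm; rewrite -S_comp //.
apply: le_trans (h m (leq_trans kl lm)) _; apply: ler_wpM2l => //.
apply: powR_base_ge; first exact: Q_norm_gt0.
  exact: Q_norm_le_r.
by rewrite oppr_le0 ltW.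
Qed.

Lemma Gamma_s_preimage l v : Gamma_s D l (S 0 l v) -> Gamma_s D 0 v.
Proof.
move=> /Gamma_sP[s s0 [C C0 h]]; apply/Gamma_sP; exists s => //.
(* The first term serves for [m >= l], where [q m <= q l * mnorm (Q l m)], the second for the
   finitely many [m < l]. *)
exists (C * q l `^ s + q l * vnorm v * q l `^ s).
  by rewrite addr_ge0 ?mulr_ge0 ?powR_ge0 ?vnorm_ge0 ?mnorm_ge0.
move=> m _; rewrite mulrDl; have [lm|ml] := leqP l m.
  apply: ler_wpDr; first by rewrite !mulr_ge0 ?powR_ge0 ?vnorm_ge0 ?mnorm_ge0.
  rewrite (S_comp _ (leq0n l) lm); apply: le_trans (h m lm) _.
  rewrite -mulrA; apply: ler_wpM2l => //.
  have -> : mnorm (Q l m) `^ (- s) = q l `^ s * (q l * mnorm (Q l m)) `^ (- s).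
    by rewrite powRM ?mnorm_ge0 // mulrA powq_add subrr powRr0 mul1r.
  apply: ler_wpM2l; first exact: powR_ge0.
  apply: powR_base_ge; first exact: Q_norm_gt0.
    exact: Q_norm_mul.
  by rewrite oppr_le0 ltW.
apply: ler_wpDl; first by rewrite !mulr_ge0 ?powR_ge0.
apply: le_trans (vnorm_vapp _ _) _; rewrite -mulrA.
rewrite -[leLHS]mulr1; apply: ler_pM; rewrite ?mulr_ge0 ?vnorm_ge0 ?mnorm_ge0 //.
  by apply: ler_wpM2r; [exact: vnorm_ge0|exact/q_mono/ltnW].
apply: (@le_trans _ _ (q m `^ s * q m `^ (- s))).
  by rewrite powq_add subrr powRr0.
apply: ler_wpM2r; first exact: powR_ge0.
by apply: powq_mono; [exact: ltnW|exact: ltW].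
Qed.

(** In [Gamma_s] the exponent and the constant depend on the vector; finitely many spanning vectors
    make them uniform. *)
Lemma Gamma_s_uniform : exists2 s : R, 0 < s & exists2 C : R, 0 < C &
  forall v k, Gamma_s D 0 v -> vnorm (S 0 k v) <= C * q k `^ (- s) * vnorm v.
Proof.
have [m [b [K [K0 bG bcoord]]]] := subspace_coord (Gamma_s D 0).
have /choice[sC h] : forall i, exists sC : R * R, [/\ 0 < sC.1, 0 <= sC.2 &
    forall l, vnorm (S 0 l (b i)) <= sC.2 * q l `^ (- sC.1)].
  move=> i; have /Gamma_sP[s s0 [C C0 h]] := bG i.
  by exists (s, C); split=> // l; exact: h.
(* Positive and below every exponent, even if the family is empty. *)
pose s := (1 + \sum_i (sC i).1^-1)^-1.
have sum0 : 0 <= \sum_i (sC i).1^-1.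
  by apply: sumr_ge0 => i _; rewrite invr_ge0 ltW //; case: (h i).
have s0 : 0 < s by rewrite invr_gt0 ltr_wpDr.
have sle i : s <= (sC i).1.
  have si0 : 0 < (sC i).1 by case: (h i).
  rewrite /s -[leRHS]invrK lef_pV2 ?posrE ?invr_gt0 ?ltr_wpDr //.
  rewrite (bigD1 i) //= addrCA lerDl addr_ge0 // sumr_ge0 // => j _.
  by rewrite invr_ge0 ltW //; case: (h j).
exists s => //; exists (1 + K * \sum_i (sC i).2).
  by rewrite ltr_wpDr // mulr_ge0 // sumr_ge0 // => i _; case: (h i).
move=> v k vG; have [c [vE cK]] := bcoord v vG.
have SE : S 0 k v = fun a => \sum_i c i * S 0 k (b i) a.
  rewrite {1}vE; apply/funext => a; rewrite /vapp.
  under eq_bigr do rewrite mulr_sumr.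
  rewrite exchange_big; apply: eq_bigr => i _; rewrite mulr_sumr.
  by apply: eq_bigr => a' _; rewrite mulrCA.
have : vnorm (S 0 k v) <= \sum_i `|c i| * vnorm (S 0 k (b i)).
  rewrite SE /vnorm; under [leRHS]eq_bigr do rewrite mulr_sumr.
  rewrite exchange_big; apply: ler_sum => a _.
  apply: le_trans (ler_norm_sum _ _ _) _.
  by apply: ler_sum => i _; rewrite normrM.
move=> /le_trans; apply.
apply: (@le_trans _ _ (\sum_i (K * vnorm v) * ((sC i).2 * q k `^ (- s)))).
  apply: ler_sum => i _; apply: ler_pM; rewrite ?vnorm_ge0 //.
  have [_ C0 hi] := h i; apply: le_trans (hi k) _; apply: ler_wpM2l => //.
  by apply: powq_le; rewrite lerN2.
rewrite -mulr_sumr -mulr_suml.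
rewrite [leRHS](_ : _ = q k `^ (- s) * vnorm v + K * vnorm v * ((\sum_i (sC i).2) * q k `^ (- s))).
  by rewrite lerDr mulr_ge0 ?powR_ge0 ?vnorm_ge0.
ring.
Qed.

End GammaS.

(** The defect of equivariance of [m] under [S]. At level 0 it is [m 0] itself, which makes the
    telescoping sum exact. *)
Definition incr (m : nat -> A -> R) k : A -> R :=
  if k is k'.+1 then fun a => m k a - S k' k (m k') a else m 0%N.

Lemma telescope m k a : m k a = \sum_(0 <= l < k.+1) S l k (incr m l) a.
Proof.
elim: k a => [|k IH] a; first by rewrite big_nat1 S_id.
rewrite big_nat_recr //= S_id -[LHS](subrK (S k k.+1 (m k) a)) addrC; congr (_ + _).
have -> : S k k.+1 (m k) a =
    \sum_b \sum_(0 <= l < k.+1) Q k k.+1 b a * S l k (incr m l) b.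
  by apply: eq_bigr => b _; rewrite IH mulr_sumr.
rewrite exchange_big; apply: eq_big_nat => l /andP[_ lk].
by rewrite (S_comp _ (lk : (l <= k)%N) (leqnSn k)).
Qed.

Lemma telescope_norm m k :
  vnorm (m k) <= \sum_(0 <= l < k.+1) vnorm (S l k (incr m l)).
Proof.
rewrite /vnorm exchange_big; apply: ler_sum => a _.
by rewrite (telescope m k a); exact: ler_norm_sum.
Qed.

Section Bounds.
Hypothesis roth_a : forall eps : R, 0 < eps -> exists2 C : R, 0 < C &
  forall k, mnorm (Zmx D k.+1) <= C * q k `^ eps.

Lemma Q_step (eps : R) : 0 < eps -> exists2 C : R, 0 < C &
  forall k, mnorm (Q k k.+1) <= C * q k `^ eps.
Proof.
move=> /roth_a[C C0 h]; exists C => // k.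
by rewrite -(Zmx_Qmx gD A1 irr specs).
Qed.

Lemma Q_near_add n (eps : R) : 0 < eps -> exists2 C : R, 0 < C &
  forall k, mnorm (Q k (k + n)) <= C * q (k + n) `^ eps.
Proof.
elim: n eps => [|n IH] eps e0.
  exists #|A|%:R; first by rewrite ltr0n ltnW.
  move=> k; rewrite addn0 Qmx_id mnorm_idm -[leLHS]mulr1; apply: ler_wpM2l => //.
  by apply: powq_ge1; exact: ltW.
have [|C C0 h] := IH (eps / 2); first by rewrite divr_gt0.
have [|C' C'0 h'] := @Q_step (eps / 2); first by rewrite divr_gt0.
exists (C * C'); first by rewrite mulr_gt0.
move=> k; rewrite addnS.
apply: le_trans (Q_norm_mul (leq_addr n k) (leqnSn _)) _.
apply: le_trans (ler_pM (mnorm_ge0 _) (mnorm_ge0 _) (h k) (h' (k + n)%N)) _.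
rewrite mulrACA powq_add -splitr; apply: ler_wpM2l; first by rewrite mulr_ge0 ?ltW.
by apply: powq_mono; rewrite ?ltW.
Qed.

Lemma Q_near (eps : R) : 0 < eps -> exists2 C : R, 0 < C &
  forall j k, (j <= k <= j + r)%N -> mnorm (Q j k) <= C * q k `^ eps.
Proof.
move=> e0; have [C C0 h] := Q_near_add r e0; exists (C + q r).
  by rewrite addr_gt0 // Q_norm_gt0.
move=> j k /andP[jk kj]; rewrite mulrDl; have [rk|kr] := leqP r k.
  apply: ler_wpDr; first by rewrite mulr_ge0 ?mnorm_ge0 ?powR_ge0.
  have := h (k - r)%N; rewrite subnK //; apply: le_trans.
  by apply: Q_norm_le_r => //; lia.
apply: ler_wpDl; first by rewrite mulr_ge0 ?powR_ge0 ?ltW.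
apply: le_trans (Q_norm_le_r (leq0n j) jk) _.
rewrite -[leLHS]mulr1; apply: ler_pM; rewrite ?mnorm_ge0 //.
  by apply: q_mono; exact: ltnW.
by apply: powq_ge1; exact: ltW.
Qed.

(** Norms are supermultiplicative across a positive block of [r] levels, and by (a) inserting such a
    block costs only a small power. *)
Lemma Q_rest (eps : R) : 0 < eps -> exists2 C : R, 0 < C &
  forall j k, (j <= k)%N -> mnorm (Q j k) * q j <= C * q k `^ eps * q k.
Proof.
move=> e0; have [C C0 h] := Q_near e0; exists C => // j k jk.
have [kj|jrk] := leqP k (j + r).
  apply: ler_pM; rewrite ?mnorm_ge0 //; first by apply: h; rewrite jk.
  exact: q_mono.
apply: le_trans (ler_wpM2r (mnorm_ge0 _) (Q_norm_mul (leq_addr r j) (ltnW jrk))) _.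
rewrite -[leLHS]mulrA [mnorm (Q (j + r) k) * _]mulrC; apply: ler_pM; rewrite ?mulr_ge0 ?mnorm_ge0 //.
  apply: le_trans (h j (j + r)%N _) _; first by rewrite leq_addr leqnn.
  apply: ler_wpM2l; first exact: ltW.
  by apply: powq_mono; [exact: ltnW|exact: ltW].
exact: Q_norm_pos (leq0n j) (ltnW jrk).
Qed.

(** The last [r] levels form a positive block, so each column sum of [Q(0, k)] is at least
    [q (k - r)]. Its product with the corresponding length is at most the total length, and (a)
    replaces [q (k - r)] by [q k]. *)
Lemma lam_small (eps : R) : 0 < eps -> exists2 C : R, 0 < C &
  forall k a, lk k a * q k <= C * q k `^ eps.
Proof.
move=> e0; have [C C0 h] := Q_near e0.
have l0 k a : 0 < lk k a by exact: (orbit_good gD specs _).2.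
have total k : Defs.total D = \sum_b \sum_c Q 0 k b c * lk k c.
  by apply: eq_bigr => b _; exact: (Qmx_lam gD A1 irr specs).
have tot0 : 0 < Defs.total D.
  apply: lt_le_trans (l0 0%N (w_ 0%N)) _.
  by apply: (ler_sum_term (f := lam D)) => b; exact/ltW/gD.2.
have colsum k a : lk k a * \sum_b Q 0 k b a <= Defs.total D.
  rewrite (total k) mulrC mulr_suml; apply: ler_sum => b _.
  apply: (ler_sum_term (f := fun c => Q 0 k b c * lk k c)) => c.
  by apply: mulr_ge0; [apply: mx_ge1_ge0; exact: Q_ge1|exact/ltW/l0].
exists (Defs.total D * C + Defs.total D * q r).
  by rewrite addr_gt0 ?mulr_gt0 // Q_norm_gt0.
move=> k a; rewrite mulrDl; have [rk|kr] := leqP r k.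
  apply: ler_wpDr; first by rewrite !mulr_ge0 ?mnorm_ge0 ?powR_ge0 ?ltW.
  have jk : (k - r <= k)%N by rewrite leq_subr.
  apply: (@le_trans _ _ (lk k a * (q (k - r) * mnorm (Q (k - r) k)))).
    apply: ler_wpM2l; first exact/ltW/l0.
    exact: Q_norm_mul.
  rewrite mulrA -mulrA; apply: (@le_trans _ _ (Defs.total D * mnorm (Q (k - r) k))); last first.
    rewrite -mulrA; apply: ler_wpM2l; first exact: ltW.
    by apply: h; rewrite jk subnK /=.
  rewrite mulrA; apply: ler_wpM2r; first exact: mnorm_ge0.
  apply: le_trans (colsum k a); apply: ler_wpM2l; first exact/ltW/l0.
  rewrite (mnorm_ge1E (@Q_ge1 0 (k - r))) (Qmul (leq0n _) jk); apply: ler_sum => b _.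
  rewrite /mmul; apply: ler_sum => c _; rewrite -[leLHS]mulr1; apply: ler_wpM2l.
    by rewrite mx_ge1_ge0 //; exact: Q_ge1.
  by have := Qmx_pos gD A1 irr specs (k - r) c a; rewrite subnK.
apply: ler_wpDl; first by rewrite !mulr_ge0 ?powR_ge0 ?ltW.
have lk0 := ltW (l0 k a).
rewrite -[leLHS]mulr1; apply: ler_pM; rewrite ?mulr_ge0 ?mnorm_ge0 //.
  apply: ler_pM; rewrite ?mnorm_ge0 //; last by apply: q_mono; exact: ltnW.
  apply: le_trans (colsum k a); rewrite -[leLHS]mulr1; apply: ler_wpM2l.
    exact/ltW/l0.
  have := @Q_ge1 0 k a a; rewrite eqxx => /le_trans; apply.
  by apply: (ler_sum_term (f := fun b => Q 0 k b a)) => b; rewrite mx_ge1_ge0 //; exact: Q_ge1.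
by apply: powq_ge1; exact: ltW.
Qed.

(** By (a) with exponent 1, [q k.+1] is at most a constant times the square of [q k]. *)
Lemma q_shift (a : R) : 0 <= a -> exists2 C : R, 0 < C &
  forall k, q k `^ (- a) <= C * q k.+1 `^ (- (a / 2)).
Proof.
move=> a0; have [C C0 h] := Q_step ltr01; exists (C `^ (a / 2)).
  by rewrite powR_gt0.
move=> k; have qS : q k.+1 <= C * (q k * q k).
  apply: le_trans (Q_norm_mul (leq0n k) (leqnSn k)) _.
  rewrite mulrCA; apply: ler_wpM2l; first exact: mnorm_ge0.
  by have := h k; rewrite powRr1 ?mnorm_ge0.
have := powR_base_ge (Q_norm_gt0 0 k.+1) qS (_ : - (a / 2) <= 0).
rewrite oppr_le0 divr_ge0 // => /(_ isT).
have C0' := ltW C0.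
rewrite !powRM ?mulr_ge0 ?mnorm_ge0 // powq_add -opprD -splitr => hS.
apply: le_trans (ler_wpM2l (powR_ge0 C (a / 2)) hS).
by rewrite mulrA -powRDpos // subrr powRr0 mul1r.
Qed.

(** The increments are orthogonal to the lengths, so their pull-backs to level 0 lie in
    [Gamma_star], where (b) applies. For [l] near [k] one uses [Q_rest]: increments of size [q l] to
    the power 1/2 still leave the power -1/2 of [q l]. Both bounds go into [interpolate_sum]. *)
Lemma mean_growth (m : nat -> A -> R) (V : R) :
  (exists2 theta : R, 0 < theta & exists2 C : R, 0 < C &
     forall k v, Gamma_star D v ->
       vnorm (S 0 k v) <= C * q k `^ (1 - theta) * vnorm v) ->
  0 <= V -> (forall k, \sum_a lk k a * m k a = 0) ->
  (forall k a, `|incr m k.+1 a| <= S k k.+1 (fun=> V) a) ->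
  exists2 eta : R, 0 < eta & exists2 C : R, 0 <= C &
    forall k a, `|m k a| <= C * q k `^ (- eta) * q k.
Proof.
move=> [th th0 [Cb Cb0 hb]] V0 mean0 mincr.
have h2 : (0 : R) < 2^-1 by rewrite invr_gt0.
have [K K0 inv] := S_inverse.
have p0 : (0 : R) < #|A|%:R + 2^-1 by rewrite ltr_wpDl.
have [eps [eta [C3 [e0 eta0 C30 interp]]]] :=
  interpolate_sum (Q_norm_ge1 0) r_gt0 q_mono q_double th0 h2 p0.
have [C2 C20 hrest] := Q_rest e0.
have [Cz Cz0 hz] := Q_step h2.
have [E E0 incrE] : exists2 E : R, 0 <= E &
    forall l, vnorm (incr m l) <= E * q l `^ 2^-1.
  exists (vnorm (m 0%N) + #|A|%:R * (Cz * V)).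
    by rewrite addr_ge0 ?vnorm_ge0 // !mulr_ge0 // ltW.
  move=> [|l]; rewrite mulrDl.
    apply: ler_wpDr; first by rewrite !mulr_ge0 ?powR_ge0 // ltW.
    rewrite -[leLHS]mulr1; apply: ler_wpM2l; first exact: vnorm_ge0.
    by apply: powq_ge1; exact: ltW.
  apply: ler_wpDl; first by rewrite mulr_ge0 ?vnorm_ge0 ?powR_ge0.
  rewrite -mulrA mulr_natl -sumr_const; apply: ler_sum => a _.
  apply: le_trans (mincr l a) _; apply: le_trans (vapp_const_le _ (@Q_ge1 l l.+1) V0) _.
  rewrite mulrAC; apply: ler_wpM2r => //; apply: le_trans (hz l) _.
  apply: ler_wpM2l; first exact: ltW.
  by apply: powq_mono; rewrite ?ltW.
have incr0 l : \sum_a lk l a * incr m l a = 0.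
  case: l => [|l]; first exact: mean0.
  have -> : \sum_a lk l.+1 a * incr m l.+1 a =
      \sum_a lk l.+1 a * m l.+1 a - \sum_a lk l.+1 a * S l l.+1 (m l) a.
    by rewrite -sumrB; apply: eq_bigr => a _; rewrite -mulrBr.
  by rewrite mean0 S_lam // mean0 subrr.
have KK0 : 0 <= Cb * K * E + C2 * E by rewrite addr_ge0 ?mulr_ge0 // ltW.
exists eta => //; exists ((Cb * K * E + C2 * E) * C3).
  by rewrite mulr_ge0 // ltW.
move=> k a; apply: le_trans (vnorm_entry _ _) _; apply: le_trans (telescope_norm m k) _.
have -> : (Cb * K * E + C2 * E) * C3 * q k `^ (- eta) * q k =
  (Cb * K * E + C2 * E) * q k * (C3 * q k `^ (- eta)) by ring.
apply: interp.
- by rewrite mulr_ge0 ?mnorm_ge0.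
- by move=> l _; exact: vnorm_ge0.
- move=> l lk'; have [w wS wn] := inv l (incr m l).
  have wG : Gamma_star D w.
    by rewrite /Gamma_star /= -(S_lam w (leq0n l)) wS; exact: incr0.
  rewrite -wS -(S_comp _ (leq0n l) lk'); apply: le_trans (hb k w wG) _.
  have qth : q k `^ (1 - th) = q k * q k `^ (- th).
    by rewrite -powq_add powRr1 // mnorm_ge0.
  apply: (@le_trans _ _ (Cb * q k `^ (1 - th) * (K * q l `^ #|A|%:R * (E * q l `^ 2^-1)))).
    apply: ler_wpM2l; first by rewrite mulr_ge0 ?powR_ge0 // ltW.
    apply: le_trans wn _; apply: ler_wpM2l; last exact: incrE.
    by rewrite mulr_ge0 ?powR_ge0 // ltW.
  rewrite qth -powq_add [leLHS](_ : _ = Cb * K * E * q k *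
    (q k `^ (- th) * (q l `^ #|A|%:R * q l `^ 2^-1))); last by ring.
  apply: ler_wpM2r; first by rewrite !mulr_ge0 ?powR_ge0.
  apply: ler_wpM2r; first exact: mnorm_ge0.
  by rewrite lerDl mulr_ge0 // ltW.
- move=> l lk'; apply: le_trans (vnorm_vapp _ _) _.
  apply: le_trans (ler_wpM2l (mnorm_ge0 _) (incrE l)) _.
  have -> : q l `^ 2^-1 = q l * q l `^ (- 2^-1).
    rewrite -[X in X * _](powRr1 (mnorm_ge0 _)) powq_add; congr (_ `^ _).
    by field.
  rewrite [leLHS](_ : _ = mnorm (Q l k) * q l * (E * q l `^ (- 2^-1))); last by ring.
  apply: (@le_trans _ _ (C2 * q k `^ eps * q k * (E * q l `^ (- 2^-1)))).
    apply: ler_wpM2r; last exact: hrest.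
    by rewrite mulr_ge0 ?powR_ge0.
  rewrite [leLHS](_ : _ = C2 * E * q k * (q k `^ eps * q l `^ (- 2^-1))); last by ring.
  apply: ler_wpM2r; first by rewrite mulr_ge0 ?powR_ge0.
  apply: ler_wpM2r; first exact: mnorm_ge0.
  by rewrite lerDr !mulr_ge0 // ltW.
Qed.

(** * Solving for the piecewise constant correction *)

Section Correction.
Hypothesis roth_c : forall eps : R, 0 < eps -> exists2 C : R, 0 < C &
  forall k l, (k <= l)%N ->
    (forall v, qnorm (Gamma_s D k) v <=
       C * q l `^ eps * qnorm (Gamma_s D l) (S k l v)) /\
    (forall v, Gamma_s D k v -> vnorm (S k l v) <= C * q l `^ eps * vnorm v).

(** [qnorm] is an infimum; this form keeps an actual stable vector. *)
Let nearG k v (B : R) := exists2 g, Gamma_s D k g & vnorm (fun a => v a - g a) <= B.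

Let qnorm_near k v (B : R) : qnorm (Gamma_s D k) v < B -> nearG k v B.
Proof.
move=> /inf_lt[].
  by exists (vnorm (fun a => v a - 0)), (fun=> 0) => //; exact: Gamma_s0.
by move=> _ [g gG <-] lt; exists g => //; exact: ltW.
Qed.

Let qnorm_le k v : qnorm (Gamma_s D k) v <= vnorm v.
Proof.
apply: ge_inf; first by exists 0 => _ [g _ <-]; exact: vnorm_ge0.
exists (fun=> 0); first exact: Gamma_s0.
by apply: eq_bigr => a _; rewrite subr0.
Qed.

Let near_sum k (v : nat -> A -> R) (B : nat -> R) i j :
  (forall l, (i <= l < j)%N -> nearG k (v l) (B l)) ->
  nearG k (fun a => \sum_(i <= l < j) v l a) (\sum_(i <= l < j) B l).
Proof.
have [ji _|ij] := leqP j i.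
  rewrite big_geq //; exists (fun=> 0); first exact: Gamma_s0.
  by rewrite /vnorm big1 // => a _; rewrite big_geq // subrr normr0.
rewrite -(subnKC (ltnW ij)); elim: (j - i)%N => [|n IH] h.
  rewrite addn0 big_geq //; exists (fun=> 0); first exact: Gamma_s0.
  by rewrite /vnorm big1 // => a _; rewrite big_geq // subrr normr0.
have [|g gG hg] := IH; first by move=> l /andP[il ln]; apply: h; rewrite il; lia.
have [|g' g'G hg'] := h (i + n)%N; first by lia.
exists (fun a => g a + g' a); first exact: (Gamma_sD gG g'G).
rewrite addnS big_nat_recr ?leq_addr //=; apply: le_trans (lerD hg hg').
apply: le_trans (vnormD _ _); rewrite le_eqVlt; apply/orP; left; apply/eqP.
by apply: eq_bigr => a _; rewrite big_nat_recr ?leq_addr //= opprD addrACA.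
Qed.

Lemma abs_series_limit (f g : nat -> R) (C : R) : (forall l, `|f l| <= g l) ->
  (forall n, \sum_(0 <= l < n) g l <= C) -> exists L, forall e : R, 0 < e ->
  exists N, forall n, (N <= n)%N -> `|L - \sum_(0 <= l < n) f l| <= e.
Proof.
move=> fg gC; have cf : cvgn (series f).
  apply: normed_cvg; apply: nondecreasing_is_cvgn.
    by apply: (@nondecreasing_series _ (fun l => `|f l|) xpredT 0%N) => l.
  exists C => _ [n _ <-] /=; apply: le_trans (gC n); rewrite /series /=.
  by apply: ler_sum => l _; exact: fg.
exists (limn (series f)) => e e0; have /cvgrPdist_le/(_ e e0)[N _ h] := cf.
by exists N => n Nn; have := h n Nn; rewrite /series.
Qed.

(* The series defining chi converges only modulo the stable space; the remaining
   stable component is then shown to decay by interpolation. *)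
Lemma correction (c : nat -> A -> R) (C delta : R) : 0 < delta ->
  (forall k, vnorm (incr c k.+1) <= C * q k.+1 `^ (- delta)) ->
  exists chi : A -> R, exists2 eta : R, 0 < eta & exists2 C' : R, 0 <= C' &
    forall k, vnorm (fun a => c k a - S 0 k chi a) <= C' * q k `^ (- eta).
Proof.
move=> d0 hc; have d20 : 0 < delta / 2 by rewrite divr_gt0.
have d2m : - (delta / 2) <= 0 by rewrite oppr_le0 ltW.
have [K K0 inv] := S_inverse.
have [Cc Cc0 hcc] := roth_c d20.
have C0 : 0 <= C.
  have := le_trans (vnorm_ge0 _) (hc 0%N).
  by rewrite pmulr_lge0 // powq_gt0.
have /choice[u uS] : forall l, exists u, S 0 l u = incr c l.
  by move=> l; have [u uS _] := inv l (incr c l); exists u.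
(* The 1 gives the strict inequality asked by [qnorm_near]; the last term covers [l = 0]. *)
pose b := 1 + Cc * C + vnorm (u 0%N) * q 0 `^ (delta / 2).
have b0 : 0 < b by rewrite !ltr_pwDl ?mulr_ge0 ?vnorm_ge0 ?powR_ge0 // ltW.
pose f l := b * q l `^ (- (delta / 2)).
have f0 l : 0 <= f l by rewrite mulr_ge0 ?powR_ge0 ?ltW.
have near_u k l : (0 < l)%N -> (k <= l)%N -> nearG k (S 0 k (u l)) (f l).
  case: l => // l _ kl; apply: qnorm_near.
  have [h _] := hcc k l.+1 kl; apply: le_lt_trans (h _) _.
  rewrite -(S_comp _ (leq0n k) kl) uS.
  apply: le_lt_trans (_ : _ <= Cc * q l.+1 `^ (delta / 2) * (C * q l.+1 `^ (- delta))) _.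
    apply: ler_wpM2l; first by rewrite mulr_ge0 ?powR_ge0 // ltW.
    exact: le_trans (qnorm_le _ _) (hc l).
  rewrite mulrACA powq_add (_ : delta / 2 - delta = - (delta / 2)); last by field.
  rewrite /f ltr_pM2r ?powq_gt0 // /b -addrA addrC -addrA ltrDl.
  by rewrite ltr_pwDr // mulr_ge0 ?vnorm_ge0 ?powR_ge0.
have near_u0 l : nearG 0 (u l) (f l).
  case: l => [|l]; last by rewrite -[u _](S_id 0); exact: near_u.
  exists (fun=> 0); first exact: Gamma_s0.
  rewrite (_ : vnorm _ = vnorm (u 0%N)); last by apply: eq_bigr => a _; rewrite subr0.
  rewrite /f /b 2!mulrDl -[X in _ + X]mulrA powq_add subrr powRr0 mulr1.
  by rewrite lerDr addr_ge0 // !mulr_ge0 ?powR_ge0 // ltW.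
(* Only after subtraction of these stable vectors is the series of the pull-backs [u l] absolutely
   convergent; its sum is [chi]. *)
have /choice[gam hgam] : forall l, exists g, Gamma_s D 0 g /\ vnorm (fun a => u l a - g a) <= f l.
  by move=> l; have [g gG hg] := near_u0 l; exists g.
have [Cs Cs0 hs] := sum_powR (Q_norm_ge1 0) r_gt0 q_mono q_double d20.
have sumf k m : \sum_(k <= l < m) f l <= b * Cs * q k `^ (- (delta / 2)).
  by rewrite /f -mulr_sumr -mulrA; apply: ler_wpM2l; [exact: ltW|exact: hs].
have /choice[chi hchi] : forall a, exists L, forall e : R, 0 < e ->
    exists N, forall n, (N <= n)%N ->
    `|L - \sum_(0 <= l < n) (u l a - gam l a)| <= e.
  move=> a; apply: (abs_series_limit (g := f)) (sumf 0%N) => l.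
  exact: le_trans (vnorm_entry (fun a => u l a - gam l a) a) (hgam l).2.
exists chi.
(* By telescoping, the terms with [l <= k] cancel [c k]. Modulo the stable space of level [k] there
   remains the tail over [l > k]. *)
have [B B0 near_c] : exists2 B : R, 0 <= B & forall k,
    nearG k (fun a => c k a - S 0 k chi a) (B * q k `^ (- (delta / 2))).
  exists (b * Cs + 1); first by rewrite addr_ge0 // mulr_ge0 // ltW.
  move=> k.
  (* The truncation error is multiplied by [q k], the norm of [S(0, k)], and summed over the
     letters. *)
  pose e := q k `^ (- (delta / 2)) / (q k * #|A|%:R).
  have A0 : (0 : R) < #|A|%:R by rewrite ltr0n ltnW.
  have e0 : 0 < e by rewrite divr_gt0 ?mulr_gt0 ?powq_gt0 ?Q_norm_gt0.
  have /eventually_fin[N hN] : forall a, exists N, forall n, (N <= n)%N ->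
      `|chi a - \sum_(0 <= l < n) (u l a - gam l a)| <= e.
    by move=> a; exact: hchi.
  pose n := maxn N k.+1.
  have kn : (k.+1 <= n)%N by exact: leq_maxr.
  pose x a := chi a - \sum_(0 <= l < n) (u l a - gam l a).
  have xe : vnorm x <= #|A|%:R * e.
    rewrite mulr_natl -sumr_const; apply: ler_sum => a _.
    by apply: hN; exact: leq_maxl.
  have [g gG hg] : nearG k (fun a => \sum_(k.+1 <= l < n) S 0 k (u l) a)
      (\sum_(k.+1 <= l < n) f l).
    apply: near_sum => l /andP[kl _].
    by apply: near_u; [exact: leq_ltn_trans kl|exact: ltnW].
  have sumS : forall (v : nat -> A -> R) j, S 0 k (fun a => \sum_(0 <= l < j) v l a) =
      fun a => \sum_(0 <= l < j) S 0 k (v l) a.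
    move=> v j; apply/funext => a; rewrite /vapp.
    by under eq_bigr do rewrite mulr_sumr; rewrite exchange_big.
  exists (fun a => S 0 k (fun a => \sum_(0 <= l < n) gam l a) a - g a).
    apply: Gamma_sB gG; apply: S_Gamma_s => //.
    by apply: Gamma_s_sum => l _; exact: (hgam l).1.
  have ck a : c k a = \sum_(0 <= l < k.+1) S 0 k (u l) a.
    rewrite telescope; apply: eq_big_nat => l /andP[_ lk'].
    by rewrite (S_comp _ (leq0n l) (lk' : (l <= k)%N)) uS.
  have -> : (fun a => c k a - S 0 k chi a -
      (S 0 k (fun a0 => \sum_(0 <= l < n) gam l a0) a - g a)) =
      (fun a => - (\sum_(k.+1 <= l < n) S 0 k (u l) a - g a) - S 0 k x a).
    apply/funext => a; rewrite /x vappB.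
    have -> : (fun b0 => \sum_(0 <= l < n) (u l b0 - gam l b0)) =
        (fun b0 => \sum_(0 <= l < n) u l b0 - \sum_(0 <= l < n) gam l b0).
      by apply/funext => a'; rewrite sumrB.
    rewrite vappB !sumS ck.
    have -> : \sum_(0 <= l < n) S 0 k (u l) a = \sum_(0 <= l < k.+1) S 0 k (u l) a +
        \sum_(k.+1 <= l < n) S 0 k (u l) a by rewrite (big_cat_nat (leq0n k.+1) kn).
    ring.
  apply: le_trans (vnormB _ _) _; rewrite vnormN mulrDl mul1r; apply: lerD.
    apply: le_trans hg _; apply: le_trans (sumf k n).
    rewrite [leRHS](big_cat_nat (leqnSn k) kn) /= lerDr.
    by apply: sumr_ge0.
  apply: le_trans (vnorm_vapp _ _) _.
  apply: le_trans (ler_wpM2l (mnorm_ge0 _) xe) _.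
  rewrite le_eqVlt; apply/orP; left; apply/eqP; rewrite /e; field.
  by rewrite !gt_eqF // Q_norm_gt0.
have /choice[g hg] : forall k, exists g, Gamma_s D k g /\
    vnorm (fun a => c k a - S 0 k chi a - g a) <= B * q k `^ (- (delta / 2)).
  by move=> k; have [g gG hg] := near_c k; exists g.
pose s k a := c k a - S 0 k chi a - g k a.
have sB k : vnorm (s k) <= B * q k `^ (- (delta / 2)) := (hg k).2.
(* [S(0, k) chi] is equivariant and drops out of the increments. Those of the stable parts [g] are
   thus both stable and small. *)
have incr_g k : incr g k.+1 = fun a => S k k.+1 (s k) a + incr c k.+1 a - s k.+1 a.
  apply/funext => a; rewrite /= /s !vappB -(S_comp _ (leq0n k) (leqnSn k)); ring.
have incrG l : Gamma_s D l (incr g l).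
  case: l => [|l]; first exact: (hg 0%N).1.
  by apply: Gamma_sB; [exact: (hg l.+1).1|apply: S_Gamma_s; rewrite ?leqnSn //; exact: (hg l).1].
(* The exponent [delta / 2] of [s] loses [delta / 4] to one accelerated step, and [q_shift] halves
   the rest. *)
have d80 : 0 < delta / 8 by rewrite divr_gt0.
have d8m : - (delta / 8) <= 0 by rewrite oppr_le0 ltW.
have [H H0 incrH] : exists2 H : R, 0 <= H &
    forall l, vnorm (incr g l) <= H * q l `^ (- (delta / 8)).
  have d40 : 0 < delta / 4 by rewrite divr_gt0.
  have [Cz Cz0 hz] := Q_step d40.
  have [Ch Ch0 hh] := q_shift (ltW d40).
  have X0 : 0 <= vnorm (g 0%N) * q 0 `^ (delta / 8) by rewrite mulr_ge0 ?vnorm_ge0 ?powR_ge0.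
  have Y0 : 0 <= Cz * B * Ch by rewrite !mulr_ge0 // ltW.
  have Z0 : 0 <= C + B by rewrite addr_ge0.
  exists (vnorm (g 0%N) * q 0 `^ (delta / 8) + (Cz * B * Ch + (C + B))).
    by rewrite !addr_ge0.
  move=> [|l].
    rewrite mulrDl; apply: ler_wpDr; first by rewrite mulr_ge0 ?powR_ge0 // addr_ge0.
    by rewrite -mulrA powq_add subrr powRr0 mulr1.
  rewrite mulrDl; apply: ler_wpDl; first by rewrite mulr_ge0 ?powR_ge0.
  rewrite incr_g; apply: le_trans (vnormB _ _) _.
  apply: le_trans (lerD (vnormD _ _) (lexx _)) _; rewrite -addrA mulrDl; apply: lerD.
    apply: le_trans (vnorm_vapp _ _) _.
    apply: le_trans (ler_pM (mnorm_ge0 _) (vnorm_ge0 _) (hz l) (sB l)) _.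
    rewrite mulrACA powq_add (_ : delta / 4 - delta / 2 = - (delta / 4)); last by field.
    rewrite -[leRHS]mulrA; apply: ler_wpM2l; first by rewrite mulr_ge0 // ltW.
    by have := hh l; rewrite (_ : delta / 4 / 2 = delta / 8) //; field.
  rewrite mulrDl; apply: lerD.
    apply: le_trans (hc l) _; apply: ler_wpM2l => //.
    by apply: powq_le; rewrite lerN2; lra.
  apply: le_trans (sB l.+1) _; apply: ler_wpM2l => //.
  by apply: powq_le; rewrite lerN2; lra.
have [sg sg0 [Cg Cg0 hsg]] := Gamma_s_uniform.
have p0 : (0 : R) < #|A|%:R by rewrite ltr0n ltnW.
(* The two bounds are the uniform decay of [S(0, k)] on the stable space after a pull-back, and the
   second half of (c) applied directly from level [l]. *)
have [eps [eta [C3 [e0 eta0 C30 interp]]]] :=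
  interpolate_sum (Q_norm_ge1 0) r_gt0 q_mono q_double sg0 d80 p0.
have [C2 C20 hC2] := roth_c e0.
have KK0 : 0 <= Cg * K * H + C2 * H by rewrite addr_ge0 // !mulr_ge0 // ltW.
have gk k : vnorm (g k) <= (Cg * K * H + C2 * H) * (C3 * q k `^ (- eta)).
  apply: le_trans (telescope_norm g k) _; apply: interp => // l lk'.
  - exact: vnorm_ge0.
  - have [w wS wn] := inv l (incr g l).
    have wG : Gamma_s D 0 w by apply: (@Gamma_s_preimage l); rewrite wS.
    rewrite -wS -(S_comp _ (leq0n l) lk'); apply: le_trans (hsg w k wG) _.
    apply: (@le_trans _ _ (Cg * q k `^ (- sg) * (K * q l `^ #|A|%:R * H))).
      apply: ler_wpM2l; first by rewrite mulr_ge0 ?powR_ge0 // ltW.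
      apply: le_trans wn _; apply: ler_wpM2l; first by rewrite mulr_ge0 ?powR_ge0 // ltW.
      apply: le_trans (incrH l) _; rewrite -[leRHS]mulr1; apply: ler_wpM2l => //.
      by rewrite -[leRHS](powRr0 (q l)); exact: powq_le.
    rewrite [leLHS](_ : _ = Cg * K * H * (q k `^ (- sg) * q l `^ #|A|%:R)); last by ring.
    apply: ler_wpM2r; first by rewrite mulr_ge0 ?powR_ge0.
    by rewrite lerDl mulr_ge0 // ltW.
  have [_ h] := hC2 l k lk'; apply: le_trans (h _ (incrG l)) _.
  apply: (@le_trans _ _ (C2 * q k `^ eps * (H * q l `^ (- (delta / 8))))).
    by apply: ler_wpM2l; rewrite ?mulr_ge0 ?powR_ge0 // ltW.
  rewrite [leLHS](_ : _ = C2 * H * (q k `^ eps * q l `^ (- (delta / 8)))); last by ring.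
  apply: ler_wpM2r; first by rewrite mulr_ge0 ?powR_ge0.
  by rewrite lerDr !mulr_ge0 // ltW.
pose et := Num.min (delta / 2) eta.
have et1 : et <= delta / 2 by rewrite ge_min lexx.
have et2 : et <= eta by rewrite ge_min lexx orbT.
exists et; first by rewrite lt_min d20.
exists (B + (Cg * K * H + C2 * H) * C3).
  by rewrite addr_ge0 // mulr_ge0 // ltW.
move=> k; have -> : (fun a => c k a - S 0 k chi a) = (fun a => s k a + g k a).
  by apply/funext => a; rewrite /s subrK.
apply: le_trans (vnormD _ _) _; rewrite mulrDl; apply: lerD.
  apply: le_trans (sB k) _; apply: ler_wpM2l => //.
  by apply: powq_le; rewrite lerN2.
apply: le_trans (gk k) _; rewrite mulrA; apply: ler_wpM2l.
  by rewrite mulr_ge0 // ltW.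
by apply: powq_le; rewrite lerN2.
Qed.

Local Notation acc := (acc_time D).
Local Notation cc := (coc D w_ l_).

Lemma coc_cmp_Q P (h : R) k l (u c : A -> R) : 0 <= h -> (k <= l)%N ->
  (forall b t, 0 <= t <= lk k b - h -> `|cc P (acc k) b t - u b| <= c b) ->
  forall b t, 0 <= t <= lk l b - h ->
    `|cc P (acc l) b t - S k l u b| <= S k l c b.
Proof.
move=> h0 kl base b t tb; have akl := acc_time_le gD A1 irr specs kl.
rewrite (QmxE gD A1 irr specs kl) -{1}(subnKC akl).
by apply: (coc_cmp gD specs h0 base); rewrite subnKC.
Qed.

Lemma acc_block n : exists k, (acc k <= n < acc k.+1)%N.
Proof.
elim: n => [|n [k /andP[kn nk]]].
  by exists 0%N; exact: (acc_time_lt gD A1 irr specs 0).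
have [nk'|nk'] := leqP (acc k.+1) n.+1.
  exists k.+1; rewrite nk' /=; apply: leq_ltn_trans nk _.
  exact: (acc_time_lt gD A1 irr specs k.+1).
by exists k; rewrite nk' (leq_trans kn).
Qed.

Lemma acc_block_uniq n k k' : (acc k <= n < acc k.+1)%N ->
  (acc k' <= n < acc k'.+1)%N -> k = k'.
Proof.
move=> /andP[a1 a2] /andP[b1 b2]; apply/eqP; rewrite eqn_leq; apply/andP; split.
  rewrite leqNgt; apply/negP => lt.
  by have := acc_time_le gD A1 irr specs lt; rewrite leqNgt (leq_ltn_trans a1 b2).
rewrite leqNgt; apply/negP => lt.
by have := acc_time_le gD A1 irr specs lt; rewrite leqNgt (leq_ltn_trans b1 a2).
Qed.

Lemma acc_ge k : (k <= acc k)%N.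
Proof.
by elim: k => [//|k IH]; exact: leq_ltn_trans IH (acc_time_lt gD A1 irr specs k).
Qed.

(** Block [k] has at most [mnorm (Q k k.+1)] steps, by [mprod_mnorm_ge]. *)
Lemma acc_block_sum (b : nat -> R) (kk : nat -> nat) (C : R) :
  (forall k, 0 <= b k) -> (forall n, (acc (kk n) <= n < acc (kk n).+1)%N) ->
  (forall K, \sum_(0 <= k < K) mnorm (Q k k.+1) * b k <= C) ->
  forall K, \sum_(n < K) b (kk n) <= C.
Proof.
move=> b0 hkk hC K; apply: le_trans (hC K).
have -> : \sum_(n < K) b (kk n) = \sum_(0 <= n < K) b (kk n) by rewrite big_mkord.
apply: (@le_trans _ _ (\sum_(0 <= n < acc K) b (kk n))).
  by rewrite [leRHS](big_cat_nat (leq0n K) (acc_ge K)) /= lerDl sumr_ge0.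
elim: K => [|K IH]; first by rewrite !big_geq.
have lt := acc_time_lt gD A1 irr specs K.
rewrite (big_cat_nat (leq0n (acc K)) (ltnW lt)) big_nat_recr //=; apply: lerD => //.
rewrite (eq_big_nat _ _ (F2 := fun=> b K)); last first.
  by move=> n hn; rewrite (acc_block_uniq (hkk n) hn).
rewrite sumr_const_nat -[leLHS]mulr_natl; apply: ler_wpM2r => //.
rewrite (QmxE gD A1 irr specs (leqnSn K)); exact: (mprod_mnorm_ge specs).
Qed.

Lemma cocycle_bounded (P U : A -> R -> R) :
  (exists2 theta : R, 0 < theta & exists2 C : R, 0 < C &
     forall k v, Gamma_star D v ->
       vnorm (S 0 k v) <= C * q k `^ (1 - theta) * vnorm v) ->
  slope_ctl P U (lam D) -> \sum_a (P a (lam D a) - P a 0) = 0 ->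
  exists (chi : A -> R) (B : nat -> R) (C : R),
    (forall n a t, 0 <= t <= lam (rv_data D n) a ->
       `|cc (fun b s => P b s - chi b) n a t| <= B n) /\
    (forall K, \sum_(n < K) B n <= C).
Proof.
move=> roth_b ctl sumP; pose V := \sum_b (U b (lam D b) - U b 0).
have lk0 k a : 0 < lk k a by exact: (orbit_good gD specs _).2.
have V0 : 0 <= V.
  apply: sumr_ge0 => b _; have lb := gD.2 b.
  apply: le_trans (ctl b 0 (lam D b) 0 (lam D b) 0 (lam D b) _ _ _ _ _ _ _ _);
  by rewrite ?add0r ?lexx.
pose m k := mean_slope D w_ l_ P (acc k).
have slope k a t h : 0 < h -> 0 <= t <= lk k a - h ->
    `|cc P (acc k) a (t + h) - cc P (acc k) a t - m k a * h| <= V * h.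
  by move=> h0 th; exact: (mean_slope_ctl gD specs ctl h0 th).
have mean0 k : \sum_a lk k a * m k a = 0.
  rewrite -[RHS]sumP -(coc_total specs P (acc k)); apply: eq_bigr => a _.
  by rewrite /m /mean_slope mulrCA divff ?mulr1 // gt_eqF.
have mincr k a : `|incr m k.+1 a| <= S k k.+1 (fun=> V) a.
  (* Compare increments of length [h], the whole new interval. At level [k] they are [m k b * h] up
     to [V * h]; at level [k.+1] the increment is exactly [m k.+1 a * h]. *)
  have h0 := lk0 k.+1 a; set h := lk k.+1 a in h0.
  have := @coc_cmp_Q (fun b s => P b (s + h) - P b s) h k k.+1
    (fun b => m k b * h) (fun=> V * h) (ltW h0) (leqnSn k) _ a 0.
  rewrite !vappZr coc_incr lexx subrr lexx add0r.
  have -> : cc P (acc k.+1) a h - cc P (acc k.+1) a 0 = m k.+1 a * h.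
    by rewrite /m /mean_slope divfK // gt_eqF.
  rewrite -mulrBl normrM (gtr0_norm h0) ler_pM2r //; apply => // b t tb.
  by rewrite coc_incr; exact: slope.
have [eta eta0 [C1 C10 hm]] := mean_growth roth_b V0 mean0 mincr.
(* The slopes are then at most of order [q k] to the power [1 - 2 * ep]: [eta / 2] serves for the
   mean and [1 / 2] for the constant [V]. Interval lengths are of order [ep - 1], so the product has
   exponent [- ep]. *)
have [ep [ep0 ep1 ep2]] : exists ep : R, [/\ 0 < ep, ep <= eta / 2 & ep <= 1 / 2].
  exists (Num.min eta 1 / 2); split.
  - by rewrite divr_gt0 // lt_min eta0 ltr01.
  - by rewrite ler_pM2r ?invr_gt0 // ge_min lexx.
  - by rewrite ler_pM2r ?invr_gt0 // ge_min lexx orbT.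
have [C2 C20 hl] := lam_small ep0.
have [Os Os0 osc] : exists2 Os : R, 0 <= Os & forall k a t, 0 <= t <= lk k a ->
    `|cc P (acc k) a t - cc P (acc k) a 0| <= Os * q k `^ (- ep).
  exists ((C1 + V) * C2); first by rewrite !mulr_ge0 ?addr_ge0 // ltW.
  move=> k a t /andP[t0 tl]; move: t0; rewrite le_eqVlt => /orP[/eqP<-|t0].
    by rewrite subrr normr0 mulr_ge0 ?powR_ge0 // !mulr_ge0 ?addr_ge0 // ltW.
  have hs := slope k a 0 t t0; rewrite add0r lexx subr_ge0 tl in hs.
  have {}hs := hs isT.
  have q0 : 0 < q k by exact: Q_norm_gt0.
  have s1 : `|cc P (acc k) a t - cc P (acc k) a 0| <= (`|m k a| + V) * t.
    rewrite -[X in `|X|](subrK (m k a * t)); apply: le_trans (ler_normD _ _) _.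
    by rewrite addrC mulrDl normrM (gtr0_norm t0) lerD2l.
  apply: le_trans s1 _.
  have s2 : `|m k a| + V <= (C1 + V) * q k `^ (- ep) * q k `^ (- ep) * q k.
    rewrite mulrDl mulrDl mulrDl; apply: lerD.
      apply: le_trans (hm k a) _; apply: ler_wpM2r; first exact: ltW.
      rewrite -mulrA powq_add; apply: ler_wpM2l => //.
      by apply: powq_le; rewrite -opprD lerN2; lra.
    rewrite -!mulrA -[leLHS]mulr1; apply: ler_wpM2l => //.
    rewrite -[X in _ * (_ * X)](powRr1 (ltW q0)) !powq_add.
    by apply: powq_ge1; lra.
  apply: (@le_trans _ _ ((C1 + V) * q k `^ (- ep) * q k `^ (- ep) * q k * lk k a)).
    apply: ler_pM => //; last by rewrite ltW.
    by rewrite addr_ge0.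
  rewrite -mulrA [q k * _]mulrC.
  apply: (@le_trans _ _ ((C1 + V) * q k `^ (- ep) * q k `^ (- ep) * (C2 * q k `^ ep))).
    by apply: ler_wpM2l; rewrite ?mulr_ge0 ?powR_ge0 ?addr_ge0.
  rewrite [leLHS](_ : _ = (C1 + V) * C2 * q k `^ (- ep) * (q k `^ (- ep) * q k `^ ep)); last by ring.
  by rewrite powq_add addNr powRr0 mulr1.
pose c k a := cc P (acc k) a 0.
have ep20 : 0 < ep / 2 by rewrite divr_gt0.
have ep40 : 0 < ep / 2 / 2 by rewrite divr_gt0.
have [Cz Cz0 hz] := Q_step ep20.
have [Ch Ch0 hh] := q_shift (ltW ep20).
(* The values at 0 are equivariant up to the transported oscillation. One accelerated step costs
   [ep / 2], and passing from [q k] to [q k.+1] halves the exponent again. *)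
have hc k : vnorm (incr c k.+1) <= (#|A|%:R * Cz * Os * Ch) * q k.+1 `^ (- (ep / 2 / 2)).
  have O1 : 0 <= Os * q k `^ (- ep) by rewrite mulr_ge0 ?powR_ge0.
  apply: (@le_trans _ _ (#|A|%:R * (Cz * Os * q k `^ (- (ep / 2))))).
    rewrite mulr_natl -sumr_const; apply: ler_sum => a _.
    have := @coc_cmp_Q P 0 k k.+1 (c k) (fun=> Os * q k `^ (- ep)) (lexx 0) (leqnSn k) _ a 0.
    rewrite lexx subr0 ltW // => /(_ _ isT) h; apply: le_trans (h _) _.
      by move=> b t; rewrite subr0; exact: osc.
    apply: le_trans (vapp_const_le _ (@Q_ge1 k k.+1) O1) _.
    apply: le_trans (ler_wpM2r O1 (hz k)) _.
    by rewrite mulrACA powq_add (_ : ep / 2 - ep = - (ep / 2)) //; field.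
  rewrite -[leRHS]mulrA.
  rewrite [leLHS](_ : _ = #|A|%:R * Cz * Os * q k `^ (- (ep / 2))); last by ring.
  by apply: ler_wpM2l; rewrite ?hh // !mulr_ge0 // ltW.
have [chi [eta' eta'0 [C5 C50 hchi]]] := correction ep40 hc.
have [et [et0 et1 et2]] : exists et : R, [/\ 0 < et, et <= ep & et <= eta'].
  exists (Num.min ep eta'); split; first by rewrite lt_min ep0.
    by rewrite ge_min lexx.
  by rewrite ge_min lexx orbT.
pose b k := (Os + C5) * q k `^ (- et).
have b0 k : 0 <= b k by rewrite mulr_ge0 ?powR_ge0 ?addr_ge0.
have hb k a t : 0 <= t <= lk k a ->
    `|cc (fun b0 s => P b0 s - chi b0) (acc k) a t| <= b k.
  move=> ht; rewrite (coc_sub_const specs).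
  have -> : mprod D 0 (acc k) = Q 0 k by rewrite (QmxE gD A1 irr specs) //= subn0.
  rewrite -(subrKA (cc P (acc k) a 0)); apply: le_trans (ler_normD _ _) _.
  rewrite /b mulrDl; apply: lerD.
    apply: le_trans (osc k a t ht) _; apply: ler_wpM2l => //.
    by apply: powq_le; rewrite lerN2.
  apply: le_trans (vnorm_entry (fun a => c k a - S 0 k chi a) a) _.
  apply: le_trans (hchi k) _; apply: ler_wpM2l => //.
  by apply: powq_le; rewrite lerN2.
have /choice[kk hkk] := acc_block.
have et40 : 0 < et / 4 by rewrite divr_gt0.
have et20 : 0 < et / 2 by rewrite divr_gt0.
have [Cw Cw0 hw] := Q_step et40.
have [Cs Cs0 hs] := sum_powR (Q_norm_ge1 0) r_gt0 q_mono q_double et20.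
(* Inside a block the sums grow by at most its norm. Counting the steps of the block gives the norm
   a second time, so each factor is allowed the exponent [et / 4]. *)
pose B n := mnorm (Q (kk n) (kk n).+1) * b (kk n).
exists chi, B, (Cw * Cw * (Os + C5) * (Cs * q 0 `^ (- (et / 2)))); split.
  move=> n a t ht; have /andP[k1 k2] := hkk n; set k := kk n in k1 k2 *.
  have := coc_cmp gD specs (P := fun b0 s => P b0 s - chi b0) (h := 0) (m := acc k)
    (u := fun=> 0) (c := fun=> b k) (lexx 0) _ (j := (n - acc k)%N) (b := a) (t := t).
  rewrite subnKC // subr0 => /(_ _ ht) h.
  have {}h : `|cc (fun b0 s => P b0 s - chi b0) n a t -
      vapp (mprod D (acc k) (n - acc k)) (fun=> 0) a| <=
      vapp (mprod D (acc k) (n - acc k)) (fun=> b k) a.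
    by apply: h => a' t'; rewrite !subr0; exact: hb.
  have v0 : vapp (mprod D (acc k) (n - acc k)) (fun=> 0) a = 0.
    by rewrite /vapp big1 // => i _; rewrite mulr0.
  rewrite v0 subr0 in h; apply: le_trans h _.
  apply: le_trans (vapp_const_le _ (mprod_ge1 specs _ _) (b0 k)) _.
  apply: ler_wpM2r => //; rewrite (QmxE gD A1 irr specs (leqnSn k)).
  rewrite -(mprod_cat A1 specs k1 (ltnW k2)); apply: le_mnorm.
  - exact: (mprod_ge1 specs).
  - by apply: mmul_ge1; exact: (mprod_ge1 specs).
  - by move=> i j; apply: mmul_ge_l; exact: (mprod_ge1 specs).
apply: (acc_block_sum (b := fun k => mnorm (Q k k.+1) * b k)) hkk _ => [k|K].
  by rewrite mulr_ge0 ?mnorm_ge0.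
apply: (@le_trans _ _ (Cw * Cw * (Os + C5) * \sum_(0 <= k < K) q k `^ (- (et / 2)))).
  rewrite mulr_sumr; apply: ler_sum => k _; rewrite mulrA.
  apply: (@le_trans _ _ (Cw * q k `^ (et / 4) * (Cw * q k `^ (et / 4)) * b k)).
    by apply: ler_wpM2r => //; apply: ler_pM; rewrite ?mnorm_ge0.
  rewrite /b [leLHS](_ : _ = Cw * Cw * (Os + C5) *
    (q k `^ (et / 4) * q k `^ (et / 4) * q k `^ (- et))); last by ring.
  by rewrite !powq_add (_ : et / 4 + et / 4 - et = - (et / 2)) //; field.
by apply: ler_wpM2l; rewrite ?mulr_ge0 ?addr_ge0 // ltW.
Qed.

End Correction.
End Bounds.
End RothEstimates.

(** * Absolute continuity and bounded variation *)

Section AbsoluteContinuity.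
Context {R : realType}.
Local Notation mu := (@lebesgue_measure R).
Implicit Types (a b x y : R) (f g : R -> R).

Lemma derive_increment f (c d eta : R) : is_derive c 1 f d -> 0 < eta ->
  exists2 r : R, 0 < r &
    forall z, `|z - c| < r -> `|f z - f c - d * (z - c)| <= eta * `|z - c|.
Proof.
move=> [df fd] eta0; have : h^-1 *: ((f \o shift c) (h *: 1) - f c) @[h --> 0^'] --> d.
  by rewrite -fd; exact: df.
move=> /cvgrPdist_le/(_ eta eta0)[r /= r0 hr]; exists r => // z zr.
have [->|zc] := eqVneq z c; first by rewrite !subrr mulr0 subr0 normr0 mulr0.
have h0 : z - c != 0 by rewrite subr_eq0.
have := hr (z - c); rewrite /= sub0r normrN => /(_ zr h0).
rewrite /shift /= [_ *: 1]mulr1 subrK [_ *: _]/(_ * _) => hz.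
have {}hz : `|d - (z - c)^-1 * (f z - f c)| <= eta := hz.
have -> : f z - f c - d * (z - c) = - ((d - (z - c)^-1 * (f z - f c)) * (z - c)).
  by field.
by rewrite normrN normrM; apply: ler_wpM2r.
Qed.

Lemma null_open_cover (N : set R) (e : R) : 0 < e -> measurable N -> mu N = 0%E ->
  exists2 U : set R, open U & N `<=` U /\ (mu U < e%:E)%E.
Proof.
move=> e0 mN N0; have [|U [oU NU UN]] := lebesgue_regularity_outer mN _ e0.
  by rewrite [X in (X < _)%E]N0 ltry.
exists U => //; split=> //.
have mU : measurable U by exact: measurable_realfun.open_measurable.
rewrite -(setDUK NU) measureU //; last 2 first.
- exact: measurableD.
- by rewrite setIDA setIC -setIDA setDv setI0.
apply: (@le_lt_trans _ _ (mu N + mu (U `\` N))%E); first by [].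
by rewrite N0 add0e.
Qed.

Lemma open_interval (U : set R) c : open U -> U c ->
  exists2 r : R, 0 < r & forall z, `|z - c| < r -> U z.
Proof.
move=> oU Uc; have /nbhs_ballP[r /= r0 hr] : nbhs c U by exact: open_nbhs_nbhs.
by exists r => // z zr; apply: hr; rewrite /ball /= distrC.
Qed.

(* The null set of bad points is covered by an open set U of small measure; going
   from x to y, an increment is controlled by the derivative at good points and by
   absolute continuity on the intervals inside U. *)
Section LowerBound.
Variables (f g : R -> R) (a b x y m : R).
Hypotheses (acf : abs_cont_on a b f) (ax : a <= x) (xy : x <= y) (yb : y < b)
  (dfg : {ae mu, forall z, x < z < y -> is_derive z 1 f (g z)})
  (gm : forall z, x < z < y -> m <= g z).

Let lower_bound_eta (eta : R) : 0 < eta -> eta <= 1 ->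
  m * (y - x) - eta * ((y - x) + `|m| + 2) <= f y - f x.
Proof.
move=> eta0 eta1; have [delta0 d00 hac] := acf eta0.
pose delta := Num.min delta0 eta.
have de0 : 0 < delta by rewrite lt_min d00.
have [N [mN N0 NP]] := dfg.
have [||U oU [NU Ud]] := @null_open_cover (N `|` [set x] `|` [set y]) delta de0.
- by apply: measurableU => //; apply: measurableU.
- rewrite measureU0 ?measureU0 //; try exact: lebesgue_measure_set1.
  exact: measurableU.
have mU : measurable U by exact: measurable_realfun.open_measurable.
have Ux : U x by apply: NU; left; right.
have Uy : U y by apply: NU; right.
have good z : x <= z <= y -> ~ U z -> x < z < y /\ is_derive z 1 f (g z).
  move=> /andP[xz zy] nU.
  have xzy : x < z < y.
    rewrite !lt_neqAle xz zy !andbT; apply/andP; split.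
      by apply/eqP => E; apply: nU; rewrite -E.
    by apply/eqP => E; apply: nU; rewrite E.
  split=> //; apply: contrapT => nd; apply: nU; apply: NU; left; left; apply: NP => /=.
  by move=> h; apply: nd; exact: h.
(* The measure of [U] up to [z]: a budget for the length of the discarded intervals, which stays
   below [delta]. *)
pose u z := fine (mu (U `&` `[x, z])).
have ufin z : mu (U `&` `[x, z]) \is a fin_num.
  rewrite ge0_fin_numE //; apply: (@le_lt_trans _ _ (mu U)).
    by apply: le_measure; rewrite ?inE //; exact: measurableI.
  exact: lt_trans Ud (ltry _).
have u_mono s t : s <= t -> u s <= u t.
  move=> st; apply: fine_le => //; apply: le_measure; rewrite ?inE //; try exact: measurableI.
  by apply: setIS => z /=; rewrite !in_itv /= => /andP[-> /le_trans]; apply.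
have u_incr s t : x <= s -> s <= t -> (forall z, s <= z <= t -> U z) -> t - s <= u t - u s.
  move=> xs st Ust; rewrite -lee_fin EFinB /u EFinB !fineK //.
  rewrite leeBrDl //; have -> : (t%:E - s%:E = mu `]s, t])%E.
    rewrite lebesgue_measure_itv /= lte_fin; case: ltP => // ts.
    by rewrite (_ : s = t) ?subee //; apply/eqP; rewrite eq_le st.
  rewrite -measureU //; last 2 first.
  - exact: measurableI.
  - apply/seteqP; split=> // z [[_ /=]]; rewrite !in_itv /= => /andP[_ zs] /andP[sz _].
    by move: (lt_le_trans sz zs); rewrite ltxx.
  apply: le_measure; rewrite ?inE //.
  - by apply: measurableU => //; exact: measurableI.
  - exact: measurableI.
  move=> z [[Uz /=]|/=]; rewrite !in_itv /=.
    by move=> /andP[-> zs]; split=> //=; exact: le_trans st.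
  move=> /andP[sz zt]; split; first by apply: Ust; rewrite ltW.
  by rewrite /= ?in_itv /= zt andbT (le_trans xs (ltW sz)).
(* State of an induction along the line: on reaching [z], finitely many disjoint intervals have been
   discarded within the budget [u z], and the rest of the way has slope at least [m - eta]. *)
pose P z (n : nat) (s t : nat -> R) := [/\
  forall i, (i < n)%N -> x <= s i /\ s i <= t i /\ t i <= z,
  forall i j, (i < n)%N -> (j < n)%N -> i <> j -> t i <= s j \/ t j <= s i,
  \sum_(i < n) (t i - s i) <= u z &
  (m - eta) * (z - x - \sum_(i < n) (t i - s i)) - \sum_(i < n) `|f (t i) - f (s i)|
    <= f z - f x].
pose S := [set z | x <= z <= y /\ exists n s t, P z n s t].
have Sx : S x.
  split; first by rewrite lexx.
  exists 0%N, (fun=> 0), (fun=> 0); split=> //; rewrite !big_ord0 ?subrr ?mulr0 ?subr0 //.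
  by rewrite fine_ge0.
have Sgood z z' : S z -> z <= z' -> z' <= y -> (m - eta) * (z' - z) <= f z' - f z -> S z'.
  move=> [/andP[xz zy] [n [s [t [h1 h2 h3 h4]]]]] zz' z'y hf.
  split; first by rewrite (le_trans xz zz').
  exists n, s, t; split=> //.
  - by move=> i /h1[? [? ?]]; do 2 split=> //; exact: le_trans zz'.
  - exact: le_trans h3 (u_mono _ _ zz').
  - move: h4 hf; set A := \sum_(i < n) (_ - _); set B := \sum_(i < n) _ => h4 hf.
    have -> : (m - eta) * (z' - x - A) - B = ((m - eta) * (z - x - A) - B) + (m - eta) * (z' - z) by ring.
    by apply: le_trans (lerD h4 hf) _; lra.
have Sbad z z' : S z -> z <= z' -> z' <= y -> (forall c, z <= c <= z' -> U c) -> S z'.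
  move=> [/andP[xz zy] [n [s [t [h1 h2 h3 h4]]]]] zz' z'y hU.
  split; first by rewrite (le_trans xz zz').
  pose s' i := if (i < n)%N then s i else z; pose t' i := if (i < n)%N then t i else z'.
  have sumL : \sum_(i < n.+1) (t' i - s' i) = \sum_(i < n) (t i - s i) + (z' - z).
    rewrite big_ord_recr /= {2}/t' {2}/s' ltnn; congr (_ + _).
    by apply: eq_bigr => i _; rewrite /t' /s' ltn_ord.
  have sumF : \sum_(i < n.+1) `|f (t' i) - f (s' i)| =
      \sum_(i < n) `|f (t i) - f (s i)| + `|f z' - f z|.
    rewrite big_ord_recr /= {2}/t' {2}/s' ltnn; congr (_ + _).
    by apply: eq_bigr => i _; rewrite /t' /s' ltn_ord.
  exists n.+1, s', t'; split.
  - move=> i _; rewrite /s' /t'; case: ltnP => [/h1[? [? ?]]|_] //.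
    by do 2 split=> //; exact: le_trans zz'.
  - move=> i j; rewrite !ltnS /s' /t'; case: ltnP => [i_n _|n_i i_n]; case: ltnP => [j_n _|n_j j_n] ij.
    + exact: h2.
    + by left; have [_ []] := h1 i i_n.
    + by right; have [_ []] := h1 j j_n.
    + case: ij; apply/eqP.
      by rewrite eqn_leq (leq_trans i_n n_j) (leq_trans j_n n_i).
  - rewrite sumL; have := u_incr z z' xz zz' hU.
    by move=> hu; apply: le_trans (lerD h3 hu) _; lra.
  - rewrite sumL sumF; move: h4; set A := \sum_(i < n) (_ - _); set B := \sum_(i < n) _ => h4.
    have -> : (m - eta) * (z' - x - (A + (z' - z))) - (B + `|f z' - f z|) =
      ((m - eta) * (z - x - A) - B) - `|f z' - f z| by ring.
    have := ler_norm (- (f z' - f z)); rewrite normrN; lra.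
have hsS : has_sup S.
  by split; [exists x|exists y => z [/andP[]]].
(* From points close to [c] one can pass beyond [c], by a discarded interval if [c] is in [U] and by
   the derivative at [c] otherwise, unless [c] is [y]. *)
pose c := sup S.
have xc : x <= c by exact: sup_upper_bound.
have cy : c <= y by apply: ge_sup => [|z [/andP[]]]; [exists x|].
have Sy : S y.
  have [Uc|nUc] := pselect (U c).
    have [r r0 hr] := open_interval oU Uc.
    have [z Sz zc] := sup_adherent r0 hsS.
    have zc' : z <= c by exact: sup_upper_bound.
    pose z' := Num.min y (c + r / 2).
    have [z'y z'c] : z' <= y /\ z' <= c + r / 2 by rewrite !ge_min !lexx orbT.
    have cz' : c <= z' by rewrite le_min cy lerDl divr_ge0 // ltW.
    have Sz' : S z'.
      apply: Sbad Sz _ z'y _; first exact: le_trans cz'.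
      move=> d /andP[zd dz']; apply: hr; rewrite ltr_norml; apply/andP; split.
        by rewrite -/c in zc; lra.
      by lra.
    have z'c2 : z' <= c by exact: sup_upper_bound.
    suff -> : y = z' by [].
    apply/eqP; rewrite eq_le z'y andbT leNgt; apply/negP => z'y'.
    by move: z'c2; rewrite /z' ge_min => /orP[yc|]; [move: z'y'; rewrite /z' gt_min ltxx /=|]; lra.
  have [/andP[xc' cy'] dc] : x < c < y /\ is_derive c 1 f (g c) by apply: good; rewrite ?xc.
  have [r r0 hr] := derive_increment dc eta0.
  have [z Sz zc] := sup_adherent r0 hsS; rewrite -/c in zc.
  have zc' : z <= c by exact: sup_upper_bound.
  pose z' := Num.min y (c + r / 2).
  have [z'y z'c] : z' <= y /\ z' <= c + r / 2 by rewrite !ge_min !lexx orbT.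
  have cz' : c < z' by rewrite lt_min cy' ltrDl divr_gt0.
  suff Sz' : S z' by have := sup_upper_bound hsS Sz'; rewrite -/c leNgt cz'.
  have mg : m <= g c by apply: gm; rewrite xc'.
  apply: Sgood Sz _ z'y _; first exact: le_trans zc' (ltW cz').
  have h1 := hr z; have h2 := hr z'.
  rewrite (ler0_norm (_ : z - c <= 0)) ?subr_le0 // in h1.
  rewrite (gtr0_norm (_ : 0 < z' - c)) ?subr_gt0 // in h2.
  have {}h1 : `|f z - f c - g c * (z - c)| <= eta * - (z - c) by apply: h1; lra.
  have {}h2 : `|f z' - f c - g c * (z' - c)| <= eta * (z' - c) by apply: h2; lra.
  move: h1 h2; rewrite !ler_norml => /andP[_ h1] /andP[h2 _].
  have : (m - eta) * (z' - z) <= (g c - eta) * (z' - z).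
    by apply: ler_wpM2r; lra.
  move=> /le_trans; apply; move: h1 h2.
  rewrite (_ : (g c - eta) * (z' - z) = g c * (z' - c) - g c * (z - c) - eta * (z' - c) - eta * - (z - c)); last by ring.
  lra.
have [_ [n [s [t [h1 h2 h3 h4]]]]] := Sy.
have sd : \sum_(i < n) (t i - s i) < delta.
  apply: le_lt_trans h3 _; rewrite -lte_fin fineK //; apply: le_lt_trans Ud.
  by apply: le_measure; rewrite ?inE //; exact: measurableI.
have := hac n s t; move: h4 sd; set A := \sum_(i < n) (_ - _); set B := \sum_(i < n) _.
rewrite lt_min => h4 /andP[Ad Ae] hB.
have A0 : 0 <= A.
  by apply: sumr_ge0 => i _; rewrite subr_ge0; have [_ []] := h1 i (ltn_ord i).
have {hB}Be : B < eta.
  apply: hB => //; move=> i /h1[? [? ty]]; split; first exact: le_trans ax _.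
  by split=> //; exact: le_lt_trans ty yb.
apply: le_trans h4.
have mA : (m - eta) * A <= (`|m|) * eta.
  apply: (@le_trans _ _ (`|m| * A)); last by apply: ler_wpM2l; rewrite // ltW.
  by apply: ler_wpM2r => //; have := ler_norm m; lra.
rewrite [leLHS](_ : _ = m * (y - x) - eta * (y - x) - (`|m| * eta + 2 * eta)); last by ring.
rewrite [leRHS](_ : _ = m * (y - x) - eta * (y - x) - ((m - eta) * A + B)); last by ring.
by rewrite lerB // lerD // (le_trans (ltW Be)) // ler_peMl ?ltW // ltr1n.
Qed.

Lemma ac_increment_ge : m * (y - x) <= f y - f x.
Proof.
rewrite leNgt; apply/negP => lt.
pose K := (y - x) + `|m| + 2.
have K0 : 0 < K.
  by have := normr_ge0 m; have : 0 <= y - x by [rewrite subr_ge0]; rewrite /K; lra.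
pose gap := m * (y - x) - (f y - f x).
have gap0 : 0 < gap by rewrite subr_gt0.
pose eta := Num.min 1 (gap / (2 * K)).
have eta0 : 0 < eta by rewrite lt_min ltr01 divr_gt0 // mulr_gt0.
have eta1 : eta <= 1 by rewrite ge_min lexx.
have eta2 : eta * K <= gap / 2.
  apply: (@le_trans _ _ (gap / (2 * K) * K)).
    by apply: ler_wpM2r; [exact: ltW|rewrite ge_min lexx orbT].
  by rewrite le_eqVlt; apply/orP; left; apply/eqP; field; rewrite gt_eqF.
have := lower_bound_eta eta0 eta1; rewrite -/K; move: eta2 gap0; rewrite /gap; lra.
Qed.

End LowerBound.
End AbsoluteContinuity.

(** * Primitives of functions of bounded variation *)

Section BoundedVariation.
Context {R : realType}.
Local Notation mu := (@lebesgue_measure R).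

(** Cut [[x, y]] into [n.+1] equal parts: the increments of [W] telescope, while the common length
    of the parts tends to 0. *)
Lemma quadratic_increment_eq (k W : R -> R) (x y : R) : x <= y ->
  (forall s t, x <= s -> s <= t -> t <= y -> `|k t - k s| <= (W t - W s) * (t - s)) ->
  k y = k x.
Proof.
move=> xy hk; apply/eqP; rewrite -subr_eq0 -normr_le0 leNgt; apply/negP => lt0.
have bound (n : nat) : `|k y - k x| <= (W y - W x) * (y - x) / n.+1%:R.
  pose p (i : nat) : R := x + (y - x) * (i%:R / n.+1%:R).
  have n0 : n.+1%:R != 0 :> R by rewrite pnatr_eq0.
  have pE i : p i.+1 - p i = (y - x) / n.+1%:R.
    by rewrite /p -[in X in X - _]addn1 natrD; field.
  have d0 : 0 <= (y - x) / n.+1%:R by rewrite divr_ge0 // subr_ge0.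
  have pS i : p i <= p i.+1 by rewrite -subr_ge0 pE.
  have pn : p n.+1 = y by rewrite /p divff // mulr1; ring.
  have p0 : p 0%N = x by rewrite /p mul0r mulr0 addr0.
  have px i : x <= p i.
    by rewrite /p lerDl mulr_ge0 ?subr_ge0 // divr_ge0.
  have py i : (i <= n.+1)%N -> p i <= y.
    move=> i_n; rewrite -[leRHS]pn /p lerD2l ler_wpM2l ?subr_ge0 //.
    by rewrite ler_pM2r ?invr_gt0 ?ltr0n // ler_nat.
  rewrite -[in k y]pn -[in k x]p0 -[in W y]pn -[in W x]p0.
  rewrite -(telescope_sumr (fun i => k (p i)) (leq0n n.+1)) -(telescope_sumr (fun i => W (p i)) (leq0n n.+1)).
  rewrite -mulrA mulr_suml; apply: le_trans (ler_norm_sum _ _ _) _.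
  rewrite big_seq [leRHS]big_seq; apply: ler_sum => i.
  rewrite mem_index_iota => /andP[_ i_n].
  by rewrite -(pE i); apply: hk => //; exact: py.
pose r := (W y - W x) * (y - x) / `|k y - k x|.
have hn : r < (Num.bound `|r|).+1%:R.
  apply: le_lt_trans (ler_norm _) _; apply: lt_trans (archi_boundP (normr_ge0 r)) _.
  by rewrite ltr_nat.
have := bound (Num.bound `|r|); rewrite leNgt => /negP; apply.
by rewrite ltr_pdivrMr ?ltr0n // [ltRHS]mulrC -ltr_pdivrMr.
Qed.

Variables (a b : R) (g : R -> R).
Hypothesis bv : bounded_variation a b g.

Definition tvar s := fine (total_variation a s g).

Lemma tvarD x y : a <= x -> x <= y -> y <= b ->
  tvar y = tvar x + fine (total_variation x y g).
Proof.
move=> ax xy yb.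
have by_ : bounded_variation a y g by exact: bounded_variationl (le_trans ax xy) yb bv.
rewrite /tvar (total_variationD _ ax xy) fineD //; apply/bounded_variationP => //.
- exact: bounded_variationl by_.
- exact: bounded_variationr by_.
Qed.

Lemma tvar_ge x y : a <= x -> x <= y -> y <= b -> `|g y - g x| <= tvar y - tvar x.
Proof.
move=> ax xy yb; rewrite (tvarD ax xy yb) addrAC subrr add0r -lee_fin fineK ?total_variation_ge //.
apply/bounded_variationP => //; apply: (bounded_variationr ax xy).
exact: bounded_variationl (le_trans ax xy) yb bv.
Qed.

Lemma tvar_le x y : a <= x -> x <= y -> y <= b -> tvar x <= tvar y.
Proof. by move=> ax xy yb; rewrite -subr_ge0; apply: le_trans (tvar_ge ax xy yb). Qed.

Lemma tvar_increment x z z' y : a <= x -> x <= z -> z <= z' -> z' <= y -> y <= b ->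
  `|g z' - g z| <= tvar y - tvar x.
Proof.
move=> ax xz zz zy yb; have az := le_trans ax xz.
apply: le_trans (tvar_ge az zz (le_trans zy yb)) _; apply: lerB.
  by apply: tvar_le => //; exact: le_trans zz.
by apply: tvar_le => //; exact: le_trans (le_trans zz zy) yb.
Qed.

Let itv_measure s t : s <= t -> mu `[s, t] = (t - s)%:E.
Proof.
move=> st; rewrite lebesgue_measure_itv /= lte_fin -EFinB.
by case: ltP => // ts; rewrite (_ : s = t) ?subrr //; apply/eqP; rewrite eq_le st.
Qed.

Lemma bv_integrable : mu.-integrable `[a, b] (EFin \o g).
Proof.
have [ba|ab] := ltP b a; first by rewrite set_itv_ge ?integrable_set0 // bnd_simp -ltNge.
apply: measurable_bounded_integrable => //.
- by apply: le_lt_trans (ltry (b - a)); rewrite -itv_measure.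
(* Clamping to [[a, b]] makes both parts of the Jordan decomposition monotone on the whole line. *)
- pose c x := Num.max a (Num.min b x).
  have ca x : a <= c x by rewrite le_max lexx.
  have cb x : c x <= b by rewrite ge_max ab ge_min lexx.
  have cc x y : x <= y -> c x <= c y.
    move=> xy; rewrite /c ge_max le_max lexx /= le_max; apply/orP; right.
    by rewrite le_min !ge_min lexx xy orbT.
  have E : {in `[a, b]%classic, (fun x => tvar (c x) - (tvar (c x) - g (c x))) =1 g}.
    move=> x; rewrite inE /= in_itv /= => /andP[ax xb].
    by rewrite /c (min_r xb) (max_r ax); ring.
  apply: (eq_measurable_fun _ E).
  apply: measurable_realfun.measurable_funB; apply: measurable_realfun.nondecreasing_measurable => // x y xy.
    by apply: tvar_le => //; exact: cc.
  have := tvar_ge (ca x) (cc _ _ xy) (cb y); have := ler_norm (g (c y) - g (c x)); lra.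
- exists (`|g a| + (tvar b - tvar a)); split; first by rewrite num_real.
  move=> M M0 x /=; rewrite in_itv /= => /andP[ax xb]; apply: le_trans (ltW M0).
  have := tvar_increment (lexx a) (lexx a) ax xb (lexx b).
  move=> h; have -> : g x = g a + (g x - g a) by ring.
  by apply: le_trans (ler_normD _ _) _; rewrite lerD2l.
Qed.

Definition prim s t := \int[mu]_(x in `[s, t]) g x.

Let itv_integrable s t : a <= s -> t <= b -> mu.-integrable `[s, t] (EFin \o g).
Proof.
move=> sa tb; apply: integrableS bv_integrable => //.
by move=> z /=; rewrite !in_itv /= => /andP[/(le_trans sa) -> /le_trans ->].
Qed.

Lemma prim_add r s t : a <= r -> r <= s -> s <= t -> t <= b ->
  prim r t = prim r s + prim s t.
Proof.
move=> ar rs st tb; have := @Rintegral_itvB R g (BLeft r) (BRight t) s.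
rewrite !bnd_simp => /(_ (itv_integrable ar tb) rs st).
rewrite Rintegral_itv_obnd_cbnd -/(prim s t) => [<-|]; first by rewrite -/(prim r t) -/(prim r s); ring.
apply: integrableS (itv_integrable ar tb) => //.
by move=> z /=; rewrite !in_itv /= => /andP[sz ->]; rewrite andbT ltW // (le_lt_trans rs).
Qed.

Lemma prim_near x s t y : a <= x -> x <= s -> s <= t -> t <= y -> y <= b ->
  `|prim s t - g x * (t - s)| <= (tvar y - tvar x) * (t - s).
Proof.
move=> ax xs st ty yb.
have cst (c : R) : \int[mu]_(z in `[s, t]) c = c * (t - s).
  by rewrite Rintegral_cst //; congr (_ * _); rewrite -[RHS]/(fine (t - s)%:E) -itv_measure.
have icst (c : R) : mu.-integrable `[s, t] (EFin \o (fun=> c)).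
  apply: measurable_bounded_integrable => //.
    by apply: le_lt_trans (ltry (t - s)); rewrite -itv_measure.
  by exists `|c|; split; [rewrite num_real|move=> M /ltW ? z _].
have ig := itv_integrable (le_trans ax xs) (le_trans ty yb).
have near z : s <= z <= t -> `|g z - g x| <= tvar y - tvar x.
  by move=> /andP[sz zt]; apply: tvar_increment => //; [exact: le_trans sz|exact: le_trans ty].
rewrite ler_norml -mulNr; apply/andP; split.
  rewrite lerBrDr -mulrDl -cst; apply: le_Rintegral => // z /=; rewrite in_itv /= => /near.
  by rewrite ler_norml => /andP[]; lra.
rewrite lerBlDr -mulrDl -cst; apply: le_Rintegral => // z /=; rewrite in_itv /= => /near.
by rewrite ler_norml => /andP[]; lra.
Qed.

(** Both averages are compared with [g x], whence the factor 2. *)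
Lemma prim_mean x y s1 h1 s2 h2 : a <= x -> y <= b ->
  x <= s1 -> s1 + h1 <= y -> 0 < h1 -> x <= s2 -> s2 + h2 <= y -> 0 < h2 ->
  `|prim s1 (s1 + h1) / h1 - prim s2 (s2 + h2) / h2| <= 2 * (tvar y - tvar x).
Proof.
move=> ax yb.
have near s h : x <= s -> s + h <= y -> 0 < h -> `|prim s (s + h) / h - g x| <= tvar y - tvar x.
  move=> xs sy h0; have := prim_near ax xs _ sy yb; rewrite lerDl ltW // => /(_ isT).
  rewrite (_ : s + h - s = h); last by ring.
  move=> H; rewrite -(ler_pM2r h0) -[X in _ * X <= _](gtr0_norm h0) -normrM mulrBl divfK ?gt_eqF //.
move=> ? ? ? ? ? ?; rewrite (_ : _ - _ = (prim s1 (s1 + h1) / h1 - g x) - (prim s2 (s2 + h2) / h2 - g x)); last by ring.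
by apply: le_trans (ler_normB _ _) _; rewrite mulr2n mulrDl mul1r lerD ?near.
Qed.

(** On [[s, t]] the increments of [f] and of the primitive both differ from [g s * (t - s)] by at
    most the variation times the length. Their difference thus satisfies [quadratic_increment_eq]
    with [W] twice the variation, without continuity of [g]. *)
Lemma ac_ftc f x y : abs_cont_on a b f ->
  {ae mu, forall z, a < z < b -> is_derive z 1 f (g z)} ->
  a <= x -> x <= y -> y < b -> f y - f x = prim x y.
Proof.
move=> acf dfg ax xy yb.
pose k z := f z - prim x z.
have kxy : k y = k x.
  apply: (@quadratic_increment_eq k (fun z => 2 * tvar z)) => // s t xs st ty.
  have as_ := le_trans ax xs; have tb := le_lt_trans ty yb.
  have sub z : s < z < t -> a < z < b.
    by move=> /andP[sz zt]; rewrite (le_lt_trans as_ sz) (lt_trans zt tb).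
  have dfst : {ae mu, forall z, s < z < t -> is_derive z 1 f (g z)}.
    have [N [mN N0 NP]] := dfg.
    by exists N; split=> // z nz; apply: NP => h; apply: nz => /sub/h.
  have h0 := prim_near as_ (lexx s) st (lexx t) (ltW tb).
  have near z : s < z < t -> `|g z - g s| <= tvar t - tvar s.
    by move=> /andP[sz zt]; apply: tvar_increment (ltW sz) (ltW zt) _ => //; exact: ltW.
  have h1 : (g s - (tvar t - tvar s)) * (t - s) <= f t - f s.
    apply: (ac_increment_ge acf as_ st tb (g := g)).
      exact: dfst.
    by move=> z /near; rewrite ler_norml => /andP[]; lra.
  have acN : abs_cont_on a b (fun z => - f z).
    move=> e /acf[d d0 hd]; exists d => // n u v h2 h3 h4; have := hd n u v h2 h3 h4.
    by under eq_bigr do rewrite -normrN opprB addrC -[X in _ + X]opprK.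
  have h2 : - (g s + (tvar t - tvar s)) * (t - s) <= - f t - - f s.
    apply: (ac_increment_ge acN as_ st tb (g := fun z => - g z)).
      by have [N [mN N0 NP]] := dfst; exists N; split=> // z nz; apply: NP => h; apply: nz => /h dz; exact: is_deriveN.
    by move=> z /near; rewrite ler_norml => /andP[]; lra.
  have E : k t - k s = (f t - f s - g s * (t - s)) - (prim s t - g s * (t - s)).
    by rewrite /k (prim_add ax xs st (ltW tb)); ring.
  rewrite E; move: h0; rewrite !ler_norml => /andP[]; nra.
have p0 : prim x x = 0 by rewrite /prim set_itv1 Rintegral_set1.
by move: kxy; rewrite /k p0; lra.
Qed.

End BoundedVariation.

(** * The cohomological equation *)

Section RothCoboundary.
Context {R : realType} {A : finType}.
Local Notation mu := (@lebesgue_measure R).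
Implicit Types (D : iem_data R A) (g : R -> R).

Lemma Jset_itv D a : Jset D a = `[left_end D a, right_end D a[%classic.
Proof. by apply/seteqP; split=> x /=; rewrite in_itv. Qed.

Lemma Jset_start D a t : Jset D a (start D false a + t) <-> 0 <= t < lam D a.
Proof. by rewrite /Jset /= /left_end /right_end lerDl ltrD2l. Qed.

Lemma Jset_inj D a b x : good D -> Jset D a x -> Jset D b x -> a = b.
Proof.
move=> gD; rewrite -[x in Jset D a x](subrKC (start D false a)) Jset_start.
rewrite -[x in Jset D b x](subrKC (start D false b)) Jset_start => xa xb.
by apply: (pstart_inj (gD.1 false) gD.2 xa xb); rewrite -!start_pstart !subrKC.
Qed.

Lemma Iset_bigsetU D : good D -> Iset D = \big[setU/classical_sets.set0]_(a <- enum A) Jset D a.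
Proof.
move=> gD; rewrite -bigcup_seq; apply/seteqP; split=> x.
  move=> /(Iset_cover gD)[a [t [ta ->]]]; exists a; last exact/Jset_start.
  by rewrite /= mem_enum.
move=> [a _]; rewrite -[x in X in X -> _](subrKC (start D false a)) Jset_start => xa.
by rewrite -(subrKC (start D false a) x); exact: Iset_start.
Qed.

Lemma sum_prim_eq0 D g : good D ->
  (forall a, bounded_variation (left_end D a) (right_end D a) g) ->
  (\int[mu]_(x in Iset D) (g x)%:E = 0)%E ->
  \sum_a prim g (left_end D a) (right_end D a) = 0.
Proof.
move=> gD bv; rewrite (Iset_bigsetU gD) => int0.
have mJ a : measurable (Jset D a) by rewrite Jset_itv.
have iJ a : mu.-integrable (Jset D a) (EFin \o g).
  rewrite Jset_itv; apply: integrableS (bv_integrable (bv a)) => //.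
  by move=> x /=; rewrite !in_itv /= => /andP[-> /ltW].
have mg (s : seq A) : measurable (\big[setU/classical_sets.set0]_(a <- s) Jset D a) /\
    measurable_fun (\big[setU/classical_sets.set0]_(a <- s) Jset D a) g.
  elim: s => [|a s [ms IH]]; first by rewrite !big_nil; split=> //; exact: measurable_fun_set0.
  rewrite !big_cons; split; first exact: measurableU.
  by apply/measurable_funU => //; split=> //; apply/measurable_realfun.measurable_EFinP; exact: measurable_int (iJ a).
move: int0; rewrite integral_bigsetU_EFin ?enum_uniq //; last 2 first.
- apply/trivIsetP => a b _ _ ab; apply/seteqP; split=> x //= [xa xb].
  by case/eqP: ab; exact: Jset_inj xa xb.
- by apply/measurable_realfun.measurable_EFinP; exact: (mg _).2.
rewrite (eq_bigr (fun a => (prim g (left_end D a) (right_end D a))%:E)).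
  by rewrite big_enum sumEFin; case.
move=> a _; rewrite -[LHS]fineK; last by apply: integrable_fin_num (iJ a); rewrite Jset_itv.
congr _%:E.
rewrite -/(Rintegral mu (Jset D a) g) Jset_itv Rintegral_itv_bndo_bndc //.
by rewrite -Jset_itv.
Qed.

Lemma keane_specs D : good D -> (1 < #|A|)%N -> keane D ->
  exists (e_ : nat -> bool) (w_ l_ : nat -> A),
    forall n, step_spec (rv_data D n) (e_ n) (w_ n) (l_ n).
Proof.
move=> gD A1 kD.
have gk n : good (rv_data D n) /\ keane (rv_data D n).
  elim: n => [//|n [gn kn]]; have [e [w [l sn]]] := keane_step gn A1 kn.
  by split; [exact: step_good gn sn|exact: step_keane gn sn A1 kn].
have /choice[h hP] n : exists h : bool * A * A, step_spec (rv_data D n) h.1.1 h.1.2 h.2.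
  have [gn kn] := gk n; have [e [w [l sn]]] := keane_step gn A1 kn.
  by exists (e, w, l).
by exists (fun n => (h n).1.1), (fun n => (h n).1.2), (fun n => (h n).2).
Qed.

Variables (D : iem_data R A) (Phi g : R -> R).
Hypotheses (gD : good D)
  (ac : forall a, abs_cont_on (left_end D a) (right_end D a) Phi)
  (bv : forall a, bounded_variation (left_end D a) (right_end D a) g)
  (dPhi : forall a, {ae mu, forall x, Jint D a x -> is_derive x 1 Phi (g x)})
  (int0 : (\int[mu]_(x in Iset D) (g x)%:E = 0)%E).

(* [Phi] in local coordinates, extended by continuity to the right end point. *)
Definition local_prim a t := Phi (left_end D a) + prim g (left_end D a) (left_end D a + t).

Lemma local_primE a t : 0 <= t < lam D a -> Phi (start D false a + t) = local_prim a t.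
Proof.
move=> /andP[t0 ta].
rewrite /local_prim -(@ac_ftc _ _ _ _ (bv a) Phi _ _ (ac a) (dPhi a)) ?lexx //.
- by rewrite /left_end; ring.
- by rewrite lerDl.
- by rewrite ltrD2l.
Qed.

Lemma local_prim_slope :
  slope_ctl local_prim (fun a t => 2 * tvar (left_end D a) g (left_end D a + t)) (lam D).
Proof.
move=> a x y t1 h1 t2 h2 x0 ya xt1 ty1 h10 xt2 ty2 h20.
have E t h : x <= t -> t + h <= y -> 0 < h ->
    local_prim a (t + h) - local_prim a t
    = prim g (left_end D a + t) (left_end D a + t + h).
  move=> xt ty h0; rewrite /local_prim addrA.
  rewrite (@prim_add _ _ _ _ (bv a) (left_end D a) (left_end D a + t)) ?lexx //.
  - by ring.
  - by rewrite lerDl; exact: le_trans xt.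
  - by rewrite lerDl ltW.
  - by rewrite -addrA lerD2l; exact: le_trans ty ya.
rewrite !E // -mulrBr.
by apply: (prim_mean (bv a)); rewrite ?lerDl ?lerD2l -?addrA ?lerD2l.
Qed.

Lemma sum_local_prim : \sum_a (local_prim a (lam D a) - local_prim a 0) = 0.
Proof.
rewrite -[RHS](sum_prim_eq0 gD bv int0); apply: eq_bigr => a _.
rewrite /local_prim -/(right_end D a) addr0.
rewrite [X in _ - (_ + X)](_ : _ = 0) ?addr0; first by rewrite addrC addKr.
by rewrite /prim set_itv1 Rintegral_set1.
Qed.

Lemma roth_coboundary : (1 < #|A|)%N -> irreducible D -> roth_type D ->
  exists chi Psi : R -> R,
    [/\ forall a x y, Jset D a x -> Jset D a y -> chi x = chi y,
        exists M : R, forall x, Iset D x -> `|Psi x| <= M &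
        forall x, Iset D x -> Psi x - Psi (iem_map D x) = Phi x - chi x].
Proof.
move=> A1 irr [kD roth_a roth_b roth_c].
have [e_ [w_ [l_ specs]]] := keane_specs gD A1 kD.
have [c [B [C [hB hC]]]] := cocycle_bounded gD A1 irr specs roth_a roth_c roth_b
  local_prim_slope sum_local_prim.
pose chi x := \sum_a (if `[< Jset D a x >] then c a else 0).
have chiE a x : Jset D a x -> chi x = c a.
  move=> xa; rewrite /chi (bigD1 a) //= asboolT // big1 ?addr0 // => b ba.
  case: asboolP => // xb; case/eqP: ba; exact: Jset_inj xb xa.
pose F x := Phi x - chi x.
have hF n y : Iset (rv_data D n) y -> `|gcoc D l_ F n y| <= B n.
  have gn := orbit_good gD specs n.
  move=> /(Iset_cover gn)[a [t [ta ->]]].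
  rewrite (gcoc_coc gD specs (P := fun b s => local_prim b s - c b)) //.
    by apply: hB; case/andP: ta => -> /ltW.
  by move=> b s sb; rewrite /F (chiE b) ?local_primE //; exact/Jset_start.
have [Psi [PsiC PsiE]] := bounded_coboundary gD (bsum_bounded gD specs hF hC).
exists chi, Psi; split=> //; last by exists (C *+ 2 + 1).
by move=> a x y /chiE -> /chiE ->.
Qed.

End RothCoboundary.

Theorem theoremA (R : realType) (A : finType) (D : iem_data R A) (Phi : R -> R) :
  is_iem D ->
  roth_type D ->
  (exists g : R -> R,
     (forall a : A,
        [/\ abs_cont_on (left_end D a) (right_end D a) Phi,
            bounded_variation (left_end D a) (right_end D a) g &
            {ae (@lebesgue_measure R), forall x : R,
               Jint D a x -> is_derive x 1 Phi (g x)}])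
     /\ (\int[@lebesgue_measure R]_(x in Iset D) (g x)%:E = 0)%E) ->
  exists chi Psi : R -> R,
    [/\ (forall (a : A) (x y : R),
           Jset D a x ->
           Jset D a y -> chi x = chi y),
        (exists M : R, forall x, Iset D x -> `|Psi x| <= M) &
        (forall x, Iset D x -> Psi x - Psi (iem_map D x) = Phi x - chi x)].
Proof.
move=> iD roth [g [hg int0]]; have gD := is_iem_good iD.
case: iD => A1 _ _ adm _.
apply: (roth_coboundary gD _ _ _ int0) => //; try by move=> a; have [] := hg a.
exact: admissible_irreducible.
Qed.
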